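(* There is an absolute constant $C_0>0$ such that for every $n\in\mathbb N$ and every non-commutative polynomial $\mathfrak p\in\mathbb C\langle x_1,\dots,x_n\rangle$ of degree two there are constants $C,c>0$ depending only on $\mathfrak p$ such that the following holds. For $N\in\mathbb N$ let $X_1,\dots,X_n$ be independent $N\times N$ complex Ginibre matrices and $P=\mathfrak p(X_1,\dots,X_n)$. (1) For any $N\in\mathbb N$, any Borel set $\Omega\subset\mathbb C$ and any $\varepsilon>0$, $$\mathbb E\,\mathrm{Leb}(\Lambda_\varepsilon(P)\cap\Omega)\le C\big(N^{C_0}\varepsilon^{c}+e^{-N}\big)\mathrm{Leb}(\Omega).$$ (2) In particular, for any $K>0$ there exists $C'=C'(K,\mathfrak p)>0$ such that for all $N$ sufficiently large depending on $\mathfrak p$, for any fixed Borel set $\Omega\subset\mathbb C$ of finite Lebesgue measure, with probability at least $1-N^{-100}$, $$\mathrm{Leb}\big(\Lambda_{N^{-C'}}(P)\cap\Omega\big)\le N^{-K}\,\mathrm{Leb}(\Omega).$$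
   Context: $\mathbb C\langle x_1,\dots,x_n\rangle$ is the set of polynomials with complex coefficients in $n$ non-commuting indeterminates. An $N\times N$ complex Ginibre matrix $X$ is a random matrix such that $(\sqrt N\,\Re X_{i,j})_{i,j}$ and $(\sqrt N\,\Im X_{i,j})_{i,j}$ are independent families of i.i.d. $\mathcal N(0,1/2)$ variables. For a square matrix $A$ and $\varepsilon>0$, the $\varepsilon$-pseudospectrum is $\Lambda_\varepsilon(A)=\{z\in\mathbb C:\sigma_{\min}(A-z)\le\varepsilon\}$, where $\sigma_{\min}$ is the smallest singular value. $\mathrm{Leb}$ is Lebesgue measure on $\mathbb C$. *)

(* Defs.v *)
From HB Require Import structures.
From mathcomp Require Import all_boot all_order all_algebra.
From mathcomp Require Import finmap.
From mathcomp Require Import all_classical all_reals all_analysis.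
From mathcomp Require Import complex.
(* The notations of [monalg] clash with those of MathComp-Analysis. *)
From mathcomp.multinomials Require Import(canonicals, coercions) monalg.

Set Implicit Arguments.
Unset Strict Implicit.
Unset Printing Implicit Defensive.

Import Order.TTheory GRing.Theory Num.Theory.
Import numFieldNormedType.Exports.

Local Open Scope classical_set_scope.
Local Open Scope ring_scope.
Local Open Scope complex_scope.
Local Open Scope sesquilinear_scope.

(* The free algebra R<x_0, ..., x_(n-1)>, as the monoid algebra of the free
   monoid of words in 'I_n. *)
Definition ncpoly (R : nzRingType) (n : nat) :=
  monalg.malg (monalg.fmonom 'I_n) R.

(* [mmeasure] is the degree plus one (and 0 for the zero polynomial). *)
Definition ncdegree (R : nzRingType) (n : nat) (p : ncpoly R n) : nat :=
  (monalg.mmeasure (@monalg.fdeg 'I_n) p).-1.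

Definition nceval (R : comNzRingType) (n N : nat) (p : ncpoly R n)
    (A : 'I_n -> 'M[R]_N) : 'M[R]_N :=
  \sum_(w <- monalg.msupp p) monalg.mcoeff w p *: \prod_(i <- (w : seq _)) A i.

Definition singular_values (R : realType) (N : nat) (A : 'M[R[i]]_N) : set R :=
  [set s | 0 <= s /\ eigenvalue (A^t* *m A) (s ^+ 2)%:C].

(* For [0 < N] the set of singular values is finite and nonempty, so that [inf]
   is its least element. *)
Definition sigma_min (R : realType) (N : nat) (A : 'M[R[i]]_N) : R :=
  inf (singular_values A).

Definition pseudospectrum (R : realType) (N : nat) (eps : R)
    (A : 'M[R[i]]_N) : set R[i] :=
  [set z | sigma_min (A - z%:M) <= eps].

(* The alias [^o] carries the topology of the modulus. *)
Definition borelC (R : realType) : set_system R[i] :=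
  <<s (open : set_system (R[i])^o) >>.

Definition lebesgueC (R : realType) (A : set R[i]) : \bar R :=
  (@lebesgue_measure R \x @lebesgue_measure R)%E
    ((fun p : R * R => p.1 +i* p.2) @^-1` A).

(* Mutual independence of a finite family of sigma-algebras. *)
Definition mutually_independent (d : measure_display) (T : measurableType d)
    (R : realType) (P : probability T R) (I : finType)
    (F : I -> set_system T) : Prop :=
  forall (J : {set I}) (E : I -> set T), (forall i, i \in J -> F i (E i)) ->
    P (\bigcap_(i in [set` J]) E i) = (\prod_(i in J) P (E i))%E.

Definition sigma_family (d : measure_display) (T : measurableType d)
    (R : realType) (I : Type) (f : I -> T -> R) : set_system T :=
  <<s \bigcup_i g_sigma_algebra_preimage (f i) >>.

Definition iid_family (d : measure_display) (T : measurableType d)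
    (R : realType) (P : probability T R) (I : finType) (f : I -> T -> R)
    (mu : set R -> \bar R) : Prop :=
  [/\ forall i, measurable_fun setT (f i),
      forall i (B : set R), measurable B -> P (f i @^-1` B) = mu B
    & mutually_independent P (fun i => g_sigma_algebra_preimage (f i))].

(* [b] selects the real ([true]) or imaginary ([false]) parts of the entries. *)
Definition entry_part (R : realType) (T : Type) (N : nat)
    (X : T -> 'M[R[i]]_N) (b : bool) (ij : 'I_N * 'I_N) : T -> R :=
  fun w => let x := X w ij.1 ij.2 in if b then complex.Re x else complex.Im x.

(* [normal_prob m s] has standard deviation [s], hence variance 1/2 here. *)
Definition ginibre (d : measure_display) (T : measurableType d)
    (R : realType) (P : probability T R) (N : nat)
    (X : T -> 'M[R[i]]_N) : Prop :=
  let scaled b ij w := Num.sqrt (N%:R : R) * entry_part X b ij w in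
  (forall b, iid_family P (scaled b) (normal_prob 0 (Num.sqrt 2^-1)))
  /\ mutually_independent P (fun b : bool => sigma_family (scaled b)).

Definition sigma_mx (d : measure_display) (T : measurableType d)
    (R : realType) (N : nat) (X : T -> 'M[R[i]]_N) : set_system T :=
  sigma_family (fun k : bool * ('I_N * 'I_N) => entry_part X k.1 k.2).

Definition independent_ginibre (d : measure_display) (T : measurableType d)
    (R : realType) (P : probability T R) (n N : nat)
    (X : 'I_n -> T -> 'M[R[i]]_N) : Prop :=
  (forall k, ginibre P (X k))
  /\ mutually_independent P (fun k => sigma_mx (X k)).

(* Main.v *)
(* Let [M = p(X) - z] with [p] quadratic and [G = M^-1]. Along the real part
   of a single Gaussian entry, every entry of [adj M], [det M] and the minors
   measuring how far a column of [adj M] is from an eigenvector of a partial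
   derivative of [p] are polynomials of degree O(N); since [|q'/q| <= sum
   1/|s-r|] over the roots [r] of [q], all their logarithmic derivatives are
   at most [L] outside an event of probability O(N^8/L). On the complementary
   event suppose that [|G|] is much larger than [N L^2]. The first derivatives
   force each left partial derivative [R_i] of [p] to satisfy [R_i G ~ lam_i
   G], and each right one [G R'_i ~ - lam_i G]; differentiating the first
   relation once more shows that [A_ij I] is nearly a rank one perturbation of
   a product [Delta_i Q_j], with [A] the matrix of the quadratic part. If [A]
   has a nonzero 2x2 minor, counting dimensions ([N + 2 < 2 N]) gives a
   contradiction. If [A] has rank one, [M] either factors into affine pencils
   [sum_j v_j X_j - r], whose inverses are bounded by the same argument, or
   the relations combine so that such a pencil, or a nonzero constant, nearly
   annihilates [G]. Hence [sigma_min M <= eps] has probability O(N^10 sqrt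
   eps) for every [z] other than the constant term of [p]; Tonelli's theorem
   and Markov's inequality conclude. *)
Require Import Defs.
From HB Require Import structures.
From mathcomp Require Import all_boot all_order all_algebra.
From mathcomp Require Import finmap.
From mathcomp Require Import all_classical all_reals all_analysis.
From mathcomp Require Import complex.
From mathcomp Require Import perm measurable_realfun.
From mathcomp Require Import ring lra zify.
From mathcomp.multinomials Require Import(canonicals, coercions) monalg.

Set Implicit Arguments.
Unset Strict Implicit.
Unset Printing Implicit Defensive.

Import Order.TTheory GRing.Theory Num.Theory.
Import numFieldNormedType.Exports.

Local Open Scope classical_set_scope.
Local Open Scope ring_scope.


(** * A deterministic resolvent bound *)

(** The main probabilistic input is that a polynomial of degree [m] on a line has logarithmic
    derivative above [L] only on a set of measure O(m^2/L), whatever its coefficients. The bounds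
    are therefore uniform in the spectral parameter, which enters only through a constant
    coefficient. The obstacle is the second differentiation: the multiplier lam_i depends on X and
    nothing controls its derivative. The relation is tested through 2x2 minors of a column of the
    adjugate and its image, in which lam_i cancels. These minors are again polynomials in the
    entries, and the lost derivative of lam_i accounts for the rank one perturbation. All relations
    are normalised at an entry of G of largest modulus. The exponents come from balancing: |G| <= C
    N L^2 and sigma_min <= eps force 1 <= C N^3 L^2 eps, so L is taken of order (N^3 eps)^(-1/2),
    and N^8/L is then at most a constant times N^10 eps^(1/2). The count N + 2 < 2 N fails for N <=
    2; there e^(-N) times a constant at least e^3 makes the claim trivial. *)

Section Modulus.
Variable R : rcfType.
Local Notation nrm := (@ComplexField.Normc.normc R).

Lemma nrm_ge0 (x : R[i]) : 0 <= nrm x.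
Proof. by case: x => a b; rewrite /= sqrtr_ge0. Qed.

Lemma nrm_eq0 (x : R[i]) : (nrm x == 0) = (x == 0).
Proof.
apply/eqP/eqP => [/ComplexField.Normc.eq0_normc //|->].
exact: ComplexField.Normc.normc0.
Qed.

Lemma nrm_gt0 (x : R[i]) : (0 < nrm x) = (x != 0).
Proof. by rewrite lt_def nrm_ge0 andbT nrm_eq0. Qed.

Lemma nrmM (x y : R[i]) : nrm (x * y) = nrm x * nrm y.
Proof. exact: ComplexField.Normc.normcM. Qed.

Lemma nrmD (x y : R[i]) : nrm (x + y) <= nrm x + nrm y.
Proof. exact: le_normcD. Qed.

Lemma nrmN (x : R[i]) : nrm (- x) = nrm x.
Proof. exact: normcN. Qed.

Lemma nrmB (x y : R[i]) : nrm (x - y) <= nrm x + nrm y.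
Proof. by rewrite (le_trans (nrmD _ _)) // nrmN. Qed.

Lemma nrm0 : nrm 0 = 0.
Proof. exact: ComplexField.Normc.normc0. Qed.

Lemma nrm_sum (I : Type) (r : seq I) (Q : pred I) (F : I -> R[i]) :
  nrm (\sum_(i <- r | Q i) F i) <= \sum_(i <- r | Q i) nrm (F i).
Proof.
elim/big_ind2: _ => [|x1 x2 y1 y2 h1 h2|i _]; rewrite ?nrm0 //.
by rewrite (le_trans (nrmD _ _)) // lerD.
Qed.

Lemma nrm_sum_ord m (F : 'I_m -> R[i]) (e : R) :
  (forall i, nrm (F i) <= e) -> nrm (\sum_i F i) <= m%:R * e.
Proof.
move=> h; apply: (le_trans (nrm_sum _ _ _)).
apply: (le_trans (ler_sum _ (fun i _ => h i))).
by rewrite sumr_const card_ord mulr_natl.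
Qed.

Lemma nrm_mulmx m1 m2 m3 (B : 'M[R[i]]_(m1, m2)) (C : 'M[R[i]]_(m2, m3)) (e f : R) :
  (forall i j, nrm (B i j) <= e) -> (forall i j, nrm (C i j) <= f) ->
  forall i j, nrm ((B *m C) i j) <= m2%:R * (e * f).
Proof.
move=> hB hC i j; rewrite mxE; apply: nrm_sum_ord => k.
by rewrite nrmM ler_pM ?nrm_ge0.
Qed.

End Modulus.

(** * First-order coefficients of polynomial matrices *)

Section FirstOrder.
Variable K : fieldType.

(* First-order expansions along a line are read off the coefficients of index
   0 and 1 of polynomial matrices. *)
Definition mxcoef m1 m2 r (B : 'M[{poly K}]_(m1, m2)) := map_mx (coefp r) B.

Lemma mxcoef0M m1 m2 m3 (B : 'M[{poly K}]_(m1, m2)) (C : 'M[{poly K}]_(m2, m3)) :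
  mxcoef 0 (B *m C) = mxcoef 0 B *m mxcoef 0 C.
Proof.
apply/matrixP => i j; rewrite !mxE /coefp /= coef_sum; apply: eq_bigr => k _.
by rewrite !mxE /coefp /= coefM big_ord1 subn0.
Qed.

Lemma mxcoef1M m1 m2 m3 (B : 'M[{poly K}]_(m1, m2)) (C : 'M[{poly K}]_(m2, m3)) :
  mxcoef 1 (B *m C) = mxcoef 0 B *m mxcoef 1 C + mxcoef 1 B *m mxcoef 0 C.
Proof.
apply/matrixP => i j; rewrite !mxE /coefp /= coef_sum -big_split.
apply: eq_bigr => k _.
by rewrite !mxE /coefp /= coefM !big_ord_recl big_ord0 addr0 /= subn0 subnn.
Qed.

Lemma mxcoefD m1 m2 r (B C : 'M[{poly K}]_(m1, m2)) :
  mxcoef r (B + C) = mxcoef r B + mxcoef r C.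
Proof. by rewrite /mxcoef map_mxD. Qed.

Lemma mxcoef_sum m1 m2 r (I : Type) (s : seq I) (F : I -> 'M[{poly K}]_(m1, m2)) :
  mxcoef r (\sum_(i <- s) F i) = \sum_(i <- s) mxcoef r (F i).
Proof. by rewrite /mxcoef map_mx_sum. Qed.

Lemma mxcoefZ m1 m2 r a (B : 'M[{poly K}]_(m1, m2)) :
  mxcoef r (a%:P *: B) = a *: mxcoef r B.
Proof. by apply/matrixP => i j; rewrite !mxE /coefp /= coefCM. Qed.

Lemma mxcoef0_map m1 m2 (B : 'M[K]_(m1, m2)) : mxcoef 0 (map_mx polyC B) = B.
Proof. by apply/matrixP => i j; rewrite !mxE /coefp /= coefC. Qed.

Lemma mxcoef1_map m1 m2 (B : 'M[K]_(m1, m2)) : mxcoef 1 (map_mx polyC B) = 0.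
Proof. by apply/matrixP => i j; rewrite !mxE /coefp /= coefC. Qed.

Lemma mxcoef0E m1 m2 (B : 'M[{poly K}]_(m1, m2)) :
  mxcoef 0 B = map_mx (horner_eval 0) B.
Proof. by apply/matrixP => i j; rewrite !mxE /coefp /= /horner_eval horner_coef0. Qed.

Lemma det_mxcoef0 m (B : 'M[{poly K}]_m) : \det (mxcoef 0 B) = (\det B)`_0.
Proof. by rewrite mxcoef0E det_map_mx -horner_coef0. Qed.

Lemma adj_mxcoef0 m (B : 'M[{poly K}]_m) : \adj (mxcoef 0 B) = mxcoef 0 (\adj B).
Proof. by rewrite !mxcoef0E map_mx_adj. Qed.

Lemma adj_invmx m (B : 'M[K]_m) : \det B != 0 -> \adj B = \det B *: invmx B.
Proof.
move=> dB; have Bu : B \in unitmx by rewrite unitmxE unitfE.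
by rewrite /invmx Bu scalerA divff // scale1r.
Qed.

(** First-order coefficient of the identity between [B *m \adj B] and [(\det B)%:M], multiplied on
    the left by [G]. Working with the adjugate keeps every quantity polynomial along the line. *)
Lemma mxcoef1_adj m (B : 'M[{poly K}]_m) : (\det B)`_0 != 0 ->
  let M := mxcoef 0 B in let G := invmx M in
  mxcoef 1 (\adj B) =
    (\det B)`_1 *: G - (\det B)`_0 *: (G *m mxcoef 1 B *m G).
Proof.
move=> dB M G; have dM : \det M != 0 by rewrite det_mxcoef0.
have Mu : M \in unitmx by rewrite unitmxE unitfE.
have := congr1 (mxcoef 1) (mul_mx_adj B).
rewrite mxcoef1M -adj_mxcoef0 -/M adj_invmx // -/G det_mxcoef0.
have -> : mxcoef 1 ((\det B)%:M : 'M[{poly K}]_m) = ((\det B)`_1)%:M.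
  apply/matrixP => i j; rewrite !mxE /coefp /=; case: (i == j) => //=.
  by rewrite !mulr0n coef0.
move=> /(congr1 (mulmx G)); rewrite mulmxDr mulmxA mulVmx // mul1mx.
rewrite -scalemxAr -scalemxAr mulmxA mul_mx_scalar => <-.
by rewrite addrK.
Qed.

End FirstOrder.

(** * Logarithmic derivatives of the entries of an inverse *)

Section EntrywiseDerivative.
Variables (R : rcfType) (N : nat).
Local Notation nrm := (@ComplexField.Normc.normc R).

(** An entry of the inverse is [\adj B a b / \det B], so its logarithmic derivative is a difference
    of two that are at most [L], while its derivative is an entry of [- (G *m mxcoef 1 B *m G)].
    Written as products, the bounds also cover vanishing entries. *)
Lemma resolvent_derivative (L : R) (B : 'M[{poly R[i]}]_N) :
  (\det B)`_0 != 0 -> nrm (\det B)`_1 <= L * nrm (\det B)`_0 ->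
  (forall a b, nrm (\adj B a b)`_1 <= L * nrm (\adj B a b)`_0) ->
  let G := invmx (mxcoef 0 B) in
  forall a b, nrm ((G *m mxcoef 1 B *m G) a b) <= 2 * L * nrm (G a b).
Proof.
move=> d0 hd hadj G a b.
have dM : \det (mxcoef 0 B) != 0 by rewrite det_mxcoef0.
have d0p : 0 < nrm (\det B)`_0 by rewrite nrm_gt0.
pose T := G *m mxcoef 1 B *m G; rewrite -/T.
have E1 : (\adj B a b)`_1 = (\det B)`_1 * G a b - (\det B)`_0 * T a b.
  transitivity (mxcoef 1 (\adj B) a b); first by rewrite [RHS]mxE.
  by rewrite mxcoef1_adj // -/G -/T; clearbody T G; rewrite !mxE.
have E0 : (\adj B a b)`_0 = (\det B)`_0 * G a b.
  transitivity (mxcoef 0 (\adj B) a b); first by rewrite [RHS]mxE.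
  by rewrite -adj_mxcoef0 adj_invmx // det_mxcoef0 -/G mxE.
have := hadj a b; rewrite E1 E0 nrmM => h.
have e : (\det B)`_0 * T a b = (\det B)`_1 * G a b -
   ((\det B)`_1 * G a b - (\det B)`_0 * T a b) by rewrite opprB addrC subrK.
rewrite -(ler_pM2l d0p) -nrmM e (le_trans (nrmB _ _)) // nrmM.
have := ler_wpM2r (nrm_ge0 (G a b)) hd.
lra.
Qed.

(** The middle factor has the shape of the derivative of a quadratic polynomial in one entry; the
    matrix unit splits each triple product into a product of two entries. *)
Lemma delta_sandwich (G P Q : 'M[R[i]]_N) k l a b :
  (G *m (delta_mx k l *m P + Q *m delta_mx k l) *m G) a b =
  G a k * (P *m G) l b + (G *m Q) a k * G l b.
Proof.
have h (B C : 'M[R[i]]_N) : (B *m delta_mx k l *m C) a b = B a k * C l b.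
  rewrite -mulmxA mxE (bigD1 k) //= big1 ?addr0 => [|i ik].
    congr (_ * _); rewrite mxE (bigD1 l) //= big1 ?addr0 => [|i il].
      by rewrite mxE !eqxx mul1r.
    by rewrite mxE (negPf il) andbF mul0r.
  rewrite [X in _ * X]mxE big1 ?mulr0 // => j _.
  by rewrite mxE (negPf ik) mul0r.
rewrite mulmxDr mulmxDl mxE.
have -> : G *m (delta_mx k l *m P) *m G = G *m delta_mx k l *m (P *m G).
  by rewrite !mulmxA.
have -> : G *m (Q *m delta_mx k l) *m G = (G *m Q) *m delta_mx k l *m G.
  by rewrite !mulmxA.
by rewrite !h.
Qed.

Lemma argmax_nrm (G : 'M[R[i]]_N.+1) :
  exists al be, forall a b, nrm (G a b) <= nrm (G al be).
Proof.
have [[al be] _ h] := @arg_maxP _ R _ (ord0 : 'I_N.+1, ord0 : 'I_N.+1) xpredT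
  (fun x : 'I_N.+1 * 'I_N.+1 => nrm (G x.1 x.2)) erefl.
by exists al, be => a b; apply: (h (a, b)).
Qed.

End EntrywiseDerivative.

(** * Quadratic matrix polynomials and their restrictions to lines *)

Section Quadratic.
Variables (K : comNzRingType) (n N : nat).
Implicit Types (A : 'I_n -> 'I_n -> K) (b : 'I_n -> K) (X : 'I_n -> 'M[K]_N).

(** Defined over a commutative ring, because it is evaluated both over the complex numbers and over
    polynomials in one variable. *)
Definition quad A b (c : K) X : 'M[K]_N :=
  \sum_i \sum_j A i j *: (X i *m X j) + \sum_i b i *: X i + c%:M.

(* The derivative of [quad A b c] at [X] in the direction [H] of the [j]-th
   matrix is [H *m lfac A b X j + rfac A X j *m H]. *)
Definition lfac A b X i : 'M[K]_N := \sum_j A i j *: X j + (b i)%:M.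
Definition rfac A X i : 'M[K]_N := \sum_j A j i *: X j.

Definition lin (v : 'I_n -> K) (c : K) X : 'M[K]_N := \sum_j v j *: X j - c%:M.

End Quadratic.

Section Line.
Variables (K : fieldType) (n N : nat).
Implicit Types (A : 'I_n -> 'I_n -> K) (b : 'I_n -> K) (X : 'I_n -> 'M[K]_N).

Definition line X (j : 'I_n) (k l : 'I_N) : 'I_n -> 'M[{poly K}]_N :=
  fun i => map_mx polyC (X i) + (if i == j then 'X *: delta_mx k l else 0).

Definition quadP A b c X j k l : 'M[{poly K}]_N :=
  quad (fun i j => (A i j)%:P) (fun i => (b i)%:P) c%:P (line X j k l).
Definition lfacP A b X j k l i : 'M[{poly K}]_N :=
  lfac (fun i j => (A i j)%:P) (fun i => (b i)%:P) (line X j k l) i.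
Definition linP v c X j k l : 'M[{poly K}]_N :=
  lin (fun i => (v i)%:P) c%:P (line X j k l).

Lemma line0 X j k l i : mxcoef 0 (line X j k l i) = X i.
Proof.
rewrite /line mxcoefD mxcoef0_map; case: eqP => _; last first.
  by rewrite /mxcoef map_mx0 addr0.
by apply/matrixP => r s; rewrite !mxE /coefp /= coefXM addr0.
Qed.

Lemma line1 X j k l i :
  mxcoef 1 (line X j k l i) = if i == j then delta_mx k l else 0.
Proof.
rewrite /line mxcoefD mxcoef1_map add0r; case: eqP => _; last first.
  by rewrite /mxcoef map_mx0.
apply/matrixP => r s; rewrite !mxE /coefp /= coefXM /=.
by case: (_ && _); rewrite ?coef1 ?coef0.
Qed.

Lemma mxcoef0_scalar (c : K) : mxcoef 0 ((c%:P)%:M : 'M[{poly K}]_N) = c%:M.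
Proof. by rewrite -map_scalar_mx mxcoef0_map. Qed.

Lemma mxcoef1_scalar (c : K) : mxcoef 1 ((c%:P)%:M : 'M[{poly K}]_N) = 0.
Proof. by rewrite -map_scalar_mx mxcoef1_map. Qed.

Lemma sum_if_delta (v : 'I_n -> K) j (E : 'M[K]_N) :
  \sum_i v i *: (if i == j then E else 0) = v j *: E.
Proof.
rewrite (bigD1 j) //= eqxx big1 ?addr0 // => i /negPf ->.
by rewrite scaler0.
Qed.

Lemma quadP0 A b c X j k l : mxcoef 0 (quadP A b c X j k l) = quad A b c X.
Proof.
rewrite /quadP /quad !mxcoefD !mxcoef_sum mxcoef0_scalar.
congr (_ + _ + _); apply: eq_bigr => i _; last by rewrite mxcoefZ line0.
by rewrite mxcoef_sum; apply: eq_bigr => i' _; rewrite mxcoefZ mxcoef0M !line0.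
Qed.

Lemma quadP1 A b c X j k l : mxcoef 1 (quadP A b c X j k l) =
  delta_mx k l *m lfac A b X j + rfac A X j *m delta_mx k l.
Proof.
rewrite /quadP /quad !mxcoefD !mxcoef_sum mxcoef1_scalar addr0.
set E := delta_mx k l.
have -> : \sum_i mxcoef 1 ((b i)%:P *: line X j k l i) = b j *: E.
  by rewrite -sum_if_delta; apply: eq_bigr => i _; rewrite mxcoefZ line1.
have -> : \sum_i mxcoef 1 (\sum_i' (A i i')%:P *:
      (line X j k l i *m line X j k l i')) =
    \sum_i A i j *: (X i *m E) +
    \sum_i (if i == j then E else 0) *m \sum_i' A i i' *: X i'.
  rewrite -big_split; apply: eq_bigr => i _ /=.
  rewrite mxcoef_sum mulmx_sumr.
  have -> : A i j *: (X i *m E) =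
      \sum_i' A i i' *: (X i *m (if i' == j then E else 0)).
    rewrite (bigD1 j) //= eqxx big1 ?addr0 // => i' /negPf ->.
    by rewrite mulmx0 scaler0.
  rewrite -big_split; apply: eq_bigr => i' _ /=.
  by rewrite mxcoefZ mxcoef1M !line0 !line1 scalerDr -scalemxAr.
rewrite [X in _ + X + _](bigD1 j) //= eqxx [X in _ + (_ + X) + _]big1 ?addr0; last first.
  by move=> i /negPf ->; rewrite mul0mx.
rewrite /lfac mulmxDr mul_mx_scalar /rfac mulmx_suml.
rewrite -addrA addrC; congr (_ + _).
by apply: eq_bigr => i _; rewrite scalemxAl.
Qed.

Lemma lfacP0 A b X j k l i : mxcoef 0 (lfacP A b X j k l i) = lfac A b X i.
Proof.
rewrite /lfacP /lfac mxcoefD mxcoef_sum mxcoef0_scalar; congr (_ + _).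
by apply: eq_bigr => i' _; rewrite mxcoefZ line0.
Qed.

Lemma lfacP1 A b X j k l i :
  mxcoef 1 (lfacP A b X j k l i) = A i j *: delta_mx k l.
Proof.
rewrite /lfacP /lfac mxcoefD mxcoef_sum mxcoef1_scalar addr0 -sum_if_delta.
by apply: eq_bigr => i' _; rewrite mxcoefZ line1.
Qed.

Lemma linP0 v c X j k l : mxcoef 0 (linP v c X j k l) = lin v c X.
Proof.
rewrite /linP /lin -raddfN /= mxcoefD mxcoef_sum -polyCN mxcoef0_scalar -raddfN.
by congr (_ + _); apply: eq_bigr => i _; rewrite mxcoefZ line0.
Qed.

Lemma linP1 v c X j k l : mxcoef 1 (linP v c X j k l) = v j *: delta_mx k l.
Proof.
rewrite /linP /lin -raddfN /= mxcoefD mxcoef_sum -polyCN mxcoef1_scalar addr0.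
by rewrite -sum_if_delta; apply: eq_bigr => i _; rewrite mxcoefZ line1.
Qed.

End Line.

(** * Approximate eigenvector relations for the inverse *)

Section AlmostIntertwining.
Variables (R : rcfType) (n N : nat).
Local Notation nrm := (@ComplexField.Normc.normc R).
Variables (A : 'I_n -> 'I_n -> R[i]) (b : 'I_n -> R[i]) (X : 'I_n -> 'M[R[i]]_N).
Variables (G : 'M[R[i]]_N) (L : R) (al be : 'I_N).
Hypothesis L_ge0 : 0 <= L.
Hypothesis maxG : forall a b, nrm (G a b) <= nrm (G al be).
Hypothesis G_neq0 : G al be != 0.
Local Notation Rl := (lfac A b X).
Local Notation Rr := (rfac A X).
Local Notation g := (nrm (G al be)).
Hypothesis first_order : forall j k l a b',
  nrm (G a k * (Rl j *m G) l b' + (G *m Rr j) a k * G l b') <= 2 * L * nrm (G a b').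

(** The approximate eigenvalue, read off at the entry of largest modulus so that dividing by this
    entry keeps the errors of order [L]. *)
Definition lam i := - ((G *m Rr i) al be / G al be).

Let g_gt0 : 0 < g. Proof. by rewrite nrm_gt0. Qed.

(** In row [al], with [k = be], [first_order] contains the factor [G al be], and its right-hand side
    is at most [2 * L] times the modulus of that factor, which cancels. *)
Lemma lfac_almost_eigen i l b' :
  nrm ((Rl i *m G - lam i *: G) l b') <= 2 * L.
Proof.
rewrite -(ler_pM2l g_gt0) -nrmM.
have -> : G al be * (Rl i *m G - lam i *: G) l b' =
    G al be * (Rl i *m G) l b' + (G *m Rr i) al be * G l b'.
  rewrite /lam [X in _ * X]mxE [X in _ + X]mxE [X in _ - X]mxE.
  by field.
rewrite (le_trans (first_order _ _ _ _ _)) // mulrC ler_wpM2r //.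
by rewrite mulr_ge0.
Qed.

(** Now [first_order] is read at [l = al], [b' = be], which puts the factor [G al be] next to the
    right partial derivative. Replacing [(Rl i *m G) al be] by [lam i * G al be] costs another
    [2 * L], so the same [lam] appears with the opposite sign. *)
Lemma rfac_almost_eigen i a k :
  nrm ((G *m Rr i + lam i *: G) a k) <= 4 * L.
Proof.
set Dl := (Rl i *m G - lam i *: G) al be.
have hD : nrm Dl <= 2 * L by exact: lfac_almost_eigen.
rewrite -(ler_pM2l g_gt0) -nrmM.
have -> : G al be * (G *m Rr i + lam i *: G) a k =
    (G a k * (Rl i *m G) al be + (G *m Rr i) a k * G al be) - Dl * G a k.
  rewrite /Dl [X in _ * X]mxE [X in _ = _ - X * _]mxE [X in _ = _ - (_ + X) * _]mxE.
  rewrite [(lam i *: G) al be]mxE [(lam i *: G) a k]mxE.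
  ring.
rewrite (le_trans (nrmB _ _)) // nrmM.
have h1 := first_order i k al a be.
have h2 : 2 * L * nrm (G a be) <= 2 * L * g by rewrite ler_wpM2l // mulr_ge0.
have h3 : nrm Dl * nrm (G a k) <= 2 * L * g by rewrite ler_pM // nrm_ge0.
lra.
Qed.

End AlmostIntertwining.

(* [colpairP i r al be] measures how far the column [be] of the adjugate is from
   an eigenvector of [lfac i]: it is a 2x2 minor of the pair formed by that
   column and its image. *)
Definition colpairP (K : fieldType) n N (A : 'I_n -> 'I_n -> K) b c
    (X : 'I_n -> 'M[K]_N) j k l i (r al be : 'I_N) : {poly K} :=
  let Rp := lfacP A b X j k l i in let Np := \adj (quadP A b c X j k l) in
  (Rp *m Np) r be * Np al be - (Rp *m Np) al be * Np r be.

(** * Differentiating the eigenvector relation once more *)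

Section SecondOrder.
Variables (R : rcfType) (n N : nat).
Local Notation nrm := (@ComplexField.Normc.normc R).
Variables (A : 'I_n -> 'I_n -> R[i]) (b : 'I_n -> R[i]) (c : R[i]).
Variables (X : 'I_n -> 'M[R[i]]_N) (L : R).
Hypothesis L_ge0 : 0 <= L.
Local Notation M := (quad A b c X).
Local Notation G := (invmx M).
Local Notation Rl := (lfac A b X).
Local Notation Rr := (rfac A X).
Variables (al be : 'I_N).
Hypothesis detM : \det M != 0.
Hypothesis maxG : forall a b, nrm (G a b) <= nrm (G al be).
Hypothesis G_neq0 : G al be != 0.
Hypothesis first_order : forall j k l a b',
  nrm (G a k * (Rl j *m G) l b' + (G *m Rr j) a k * G l b') <= 2 * L * nrm (G a b').
Hypothesis det_order : forall j k l,
  nrm (\det (quadP A b c X j k l))`_1 <= L * nrm (\det (quadP A b c X j k l))`_0.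
Hypothesis pair_order : forall j k l i r,
  nrm (colpairP A b c X j k l i r al be)`_1 <=
    L * nrm (colpairP A b c X j k l i r al be)`_0.
Local Notation lam := (lam A X G al be).

Definition defect i := Rl i *m G - lam i *: G.
Definition shifted_rfac j := (lam j)%:M + Rr j.
(** Column [k] times [G al be] is what remains of the derivative of column [be] of [defect i] along
    entry [(k, al)] of the [j]-th matrix, apart from the derivative of [lam i] and a term of order
    [L ^+ 2]. *)
Definition defect_prod i j := (A i j)%:M - defect i *m shifted_rfac j.

Let defect_le i l b' : nrm (defect i l b') <= 2 * L.
Proof. exact: lfac_almost_eigen. Qed.

Lemma coef1M (p q : {poly R[i]}) : (p * q)`_1 = p`_0 * q`_1 + p`_1 * q`_0.
Proof. by rewrite coefM !big_ord_recl big_ord0 addr0. Qed.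

(** The unknown derivative of [lam i] contributes a multiple of column [be] of [G]; the 2x2 minor
    with row [al] removes it. The constant is 28 = 4 + 8 + 8 + 8, one summand for each error term of
    [key]. *)
Lemma defect_prod_rank1 i j l k :
  nrm (G al be) * nrm (defect_prod i j l k - G l be / G al be * defect_prod i j al k)
    <= 28 * L ^+ 2.
Proof.
set gam := G al be.
have gp : 0 < nrm gam by rewrite nrm_gt0.
pose MP := quadP A b c X j k al; pose NP := \adj MP.
pose RP := lfacP A b X j k al i.
(* With second index [al], column [be] of [E *m G] is the large entry [gam] times the [k]-th basis
   vector. *)
pose E : 'M[R[i]]_N := delta_mx k al.
pose M' := E *m Rl j + Rr j *m E; pose T := G *m M' *m G.
pose d0 := (\det MP)`_0; pose d1 := (\det MP)`_1.
have d0E : d0 = \det M by rewrite /d0 -det_mxcoef0 quadP0.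
have d0n : d0 != 0 by rewrite d0E.
have N0 : mxcoef 0 NP = d0 *: G.
  by rewrite /NP -adj_mxcoef0 quadP0 adj_invmx // -d0E.
have N1 : mxcoef 1 NP = d1 *: G - d0 *: T.
  by rewrite /NP (mxcoef1_adj d0n) /MP quadP0 quadP1.
have NP0 x : (NP x be)`_0 = d0 * G x be.
  by transitivity (mxcoef 0 NP x be); [rewrite [RHS]mxE | rewrite N0 [LHS]mxE].
have NP1 x : (NP x be)`_1 = d1 * G x be - d0 * T x be.
  transitivity (mxcoef 1 NP x be); first by rewrite [RHS]mxE.
  by rewrite N1; clearbody T; rewrite !mxE.
have R0 : mxcoef 0 RP = Rl i by exact: lfacP0.
have R1 : mxcoef 1 RP = A i j *: E by exact: lfacP1.
pose u x := (Rl i *m G) x be; pose w x := (Rl i *m T) x be.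
pose e x := (E *m G) x be.
have RN0 x : ((RP *m NP) x be)`_0 = d0 * u x.
  transitivity (mxcoef 0 (RP *m NP) x be); first by rewrite [RHS]mxE.
  by rewrite mxcoef0M R0 N0 -scalemxAr mxE.
have RN1 x : ((RP *m NP) x be)`_1 = d1 * u x - d0 * w x + d0 * A i j * e x.
  transitivity (mxcoef 1 (RP *m NP) x be); first by rewrite [RHS]mxE.
  rewrite mxcoef1M R0 R1 N0 N1 mulmxBr -!scalemxAr -scalemxAl.
  rewrite [LHS]mxE; congr (_ + _); last by rewrite mxE mxE mulrA.
  by rewrite [LHS]mxE [X in X + _ = _]mxE [X in _ + X = _]mxE [X in _ - X = _]mxE.
pose D := defect i; pose del x := D x be; pose dj := defect j al be.
have uE x : u x = lam i * G x be + del x.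
  by rewrite /u /del /D /defect [X in _ = _ + X]mxE [X in _ = _ + (_ + X)]mxE
    [X in _ = _ + (_ - X)]mxE addrC subrK.
have eE x : e x = (x == k)%:R * gam.
  rewrite /e mxE (bigD1 al) //= big1 ?addr0 => [|y yl].
    by rewrite mxE eqxx andbT.
  by rewrite mxE (negPf yl) andbF mul0r.
have M'G x : (M' *m G) x be = gam * shifted_rfac j x k + (x == k)%:R * dj.
  rewrite /M' mulmxDl -!mulmxA [LHS]mxE.
  have -> : (E *m (Rl j *m G)) x be = (x == k)%:R * (lam j * gam + dj).
    rewrite mxE (bigD1 al) //= big1 ?addr0 => [|y yl]; last first.
      by rewrite mxE (negPf yl) andbF mul0r.
    rewrite mxE eqxx andbT; congr (_ * _).
    by rewrite /dj /defect [X in _ = _ + X]mxE [X in _ = _ + (_ + X)]mxE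
      [X in _ = _ + (_ - X)]mxE addrC subrK.
  have -> : (Rr j *m (E *m G)) x be = Rr j x k * gam.
    rewrite mxE (bigD1 k) //= big1 ?addr0 => [|y yl].
      by rewrite -/(e k) eE eqxx mul1r.
    by rewrite -/(e y) eE (negPf yl) mul0r mulr0.
  rewrite /shifted_rfac [X in _ = _ * X + _]mxE [X in _ = _ * (X + _) + _]mxE.
  by rewrite -mulr_natr; ring.
have wE x : w x = lam i * T x be + (gam * (D *m shifted_rfac j) x k + dj * D x k).
  have -> : w x = (lam i *: T + D *m (M' *m G)) x be.
    rewrite /w; congr (fun_of_matrix _ x be).
    rewrite /D /defect mulmxBl -scalemxAl /T !mulmxA.
    by rewrite addrC subrK.
  rewrite [LHS]mxE [X in X + _ = _]mxE; congr (_ + _).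
  rewrite mxE [X in _ = _ * X + _]mxE mulr_sumr.
  have -> : dj * D x k = \sum_y D x y * ((y == k)%:R * dj).
    rewrite (bigD1 k) //= eqxx mul1r big1 ?addr0 1?mulrC // => y /negPf ->.
    by rewrite mul0r mulr0.
  rewrite -big_split; apply: eq_bigr => y _ /=.
  by rewrite M'G; ring.
have BE x : defect_prod i j x k = A i j * (x == k)%:R - (D *m shifted_rfac j) x k.
  by rewrite /defect_prod [LHS]mxE [X in X + _ = _]mxE [X in _ + X = _]mxE mulr_natr.
pose f := colpairP A b c X j k al i l al be.
have f0E : f`_0 = d0 ^+ 2 * (u l * gam - u al * G l be).
  rewrite /f /colpairP -/MP -/NP -/RP coefB !coef0M !RN0 !NP0 -/gam.
  ring.
have f1E : f`_1 = (d1 * u l - d0 * w l + d0 * A i j * e l) * (d0 * gam)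
   + d0 * u l * (d1 * gam - d0 * T al be)
   - (d1 * u al - d0 * w al + d0 * A i j * e al) * (d0 * G l be)
   - d0 * u al * (d1 * G l be - d0 * T l be).
  rewrite /f /colpairP -/MP -/NP -/RP coefB !coef1M !RN0 !RN1 !NP0 !NP1 -/gam.
  ring.
(* Dividing [f] by the square of the determinant gives the same minor formed with the inverse
   instead of the adjugate. The first two terms are its derivative by the quotient rule; the others
   come from the [dj] part of [M' *m G] and from the derivative [- T] of [G]. *)
have key : gam * (defect_prod i j l k - G l be / gam * defect_prod i j al k) * gam =
   f`_1 / d0 ^+ 2 - 2 * (d1 / d0) * (f`_0 / d0 ^+ 2)
   + dj * (D l k * gam - D al k * G l be) + (del l * T al be - del al * T l be).
  rewrite f0E f1E !BE !eE !wE !uE -/gam; field.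
  by rewrite d0n G_neq0.
have T_le x : nrm (T x be) <= 2 * L * nrm gam.
  rewrite /T /M' delta_sandwich (le_trans (first_order _ _ _ _ _)) //.
  by rewrite ler_wpM2l ?mulr_ge0 // maxG.
have fd0 : nrm (f`_0 / d0 ^+ 2) <= 4 * L * nrm gam.
  have -> : f`_0 / d0 ^+ 2 = del l * gam - del al * G l be.
    by rewrite f0E !uE -/gam; field.
  rewrite (le_trans (nrmB _ _)) // !nrmM.
  have h1 : nrm (del l) * nrm gam <= 2 * L * nrm gam.
    by rewrite ler_pM ?nrm_ge0 // defect_le.
  have h2 : nrm (del al) * nrm (G l be) <= 2 * L * nrm gam.
    by rewrite ler_pM ?nrm_ge0 // defect_le.
  lra.
have fd1 : nrm (f`_1 / d0 ^+ 2) <= L * (4 * L * nrm gam).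
  have h := ler_wpM2r (nrm_ge0 (d0 ^+ 2)^-1) (pair_order j k al i l).
  rewrite nrmM; apply: (le_trans h).
  have -> : L * nrm f`_0 * nrm (d0 ^+ 2)^-1 = L * nrm (f`_0 / d0 ^+ 2).
    by rewrite nrmM mulrA.
  by rewrite ler_wpM2l.
have dd : nrm (2 * (d1 / d0) * (f`_0 / d0 ^+ 2)) <= 2 * (L * (4 * L * nrm gam)).
  have -> : 2 * (d1 / d0) * (f`_0 / d0 ^+ 2) =
     (d1 / d0) * (f`_0 / d0 ^+ 2) + (d1 / d0) * (f`_0 / d0 ^+ 2) by ring.
  have : nrm (d1 / d0 * (f`_0 / d0 ^+ 2)) <= L * (4 * L * nrm gam).
    rewrite nrmM ler_pM ?nrm_ge0 // nrmM ComplexField.Normc.normcV ler_pdivrMr ?nrm_gt0 //.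
    exact: det_order.
  move=> h; rewrite (le_trans (nrmD _ _)) //; lra.
have t3 : nrm (dj * (D l k * gam - D al k * G l be)) <= 2 * L * (4 * L * nrm gam).
  rewrite nrmM ler_pM ?nrm_ge0 ?defect_le // (le_trans (nrmB _ _)) // !nrmM.
  have h1 : nrm (D l k) * nrm gam <= 2 * L * nrm gam.
    by rewrite ler_pM ?nrm_ge0 // defect_le.
  have h2 : nrm (D al k) * nrm (G l be) <= 2 * L * nrm gam.
    by rewrite ler_pM ?nrm_ge0 // defect_le.
  lra.
have t4 : nrm (del l * T al be - del al * T l be) <= 2 * (2 * L * (2 * L * nrm gam)).
  rewrite (le_trans (nrmB _ _)) // !nrmM.
  have h1 : nrm (del l) * nrm (T al be) <= 2 * L * (2 * L * nrm gam).
    by rewrite ler_pM ?nrm_ge0 // defect_le.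
  have h2 : nrm (del al) * nrm (T l be) <= 2 * L * (2 * L * nrm gam).
    by rewrite ler_pM ?nrm_ge0 // defect_le.
  lra.
rewrite -(ler_pM2r gp) -!nrmM key.
apply: (le_trans (nrmD _ _)); apply: (le_trans (lerD (nrmD _ _) t4)).
have := nrmB (f`_1 / d0 ^+ 2) (2 * (d1 / d0) * (f`_0 / d0 ^+ 2)).
have -> : 28 * L ^+ 2 * nrm gam =
   L * (4 * L * nrm gam) + 2 * (L * (4 * L * nrm gam)) +
   2 * L * (4 * L * nrm gam) + 2 * (2 * L * (2 * L * nrm gam)) by ring.
lra.
Qed.

End SecondOrder.

(** * Quadratic part of rank at least two *)

Section RankTwo.
Variables (R : rcfType) (n N : nat).
Local Notation nrm := (@ComplexField.Normc.normc R).
Variables (A : 'I_n -> 'I_n -> R[i]).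

(** There are 2 N unknowns against N + 2 equations. Coordinate [al] is made to vanish because the
    rank one correction is measured at that row. *)
Lemma common_kernel (Q1 Q2 : 'M[R[i]]_N) (al : 'I_N) : (2 < N)%N ->
  exists v1 v2 : 'cV[R[i]]_N,
    [/\ Q1 *m v1 + Q2 *m v2 = 0, v1 al 0 = 0, v2 al 0 = 0 & (v1 != 0) || (v2 != 0)].
Proof.
move=> N3.
pose e : 'cV[R[i]]_N := delta_mx al ord0.
(* [kermx] acts on row vectors, hence the transposes; the last two columns read coordinate [al] of
   each half. *)
pose K : 'M[R[i]]_(N + N, N + (1 + 1)) :=
  col_mx (row_mx Q1^T (row_mx e 0)) (row_mx Q2^T (row_mx 0 e)).
have : kermx K != 0.
  rewrite kermx_eq0 /row_free; apply/eqP => h.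
  have := rank_leq_col K; rewrite h leq_add2l addn1 => h2.
  by move: (leq_ltn_trans h2 N3); rewrite ltnn.
case/rowV0Pn => v /sub_kermxP; rewrite -[v]hsubmxK.
set w1 := lsubmx v; set w2 := rsubmx v; rewrite /K mul_row_col.
rewrite !mul_mx_row !mulmx0 !add_row_mx addr0 add0r -[X in _ = X]hsubmxK.
case/eq_row_mx; rewrite linear0 => h1; rewrite -[X in _ = X]hsubmxK.
case/eq_row_mx; rewrite !linear0 => h2 h3 nz.
have we (w : 'rV[R[i]]_N) : w *m e = 0 -> w 0 al = 0.
  move/matrixP/(_ 0 0); rewrite !mxE (bigD1 al) //= big1 ?addr0.
    by rewrite mxE !eqxx mulr1.
  by move=> j /negPf jl; rewrite mxE jl mulr0.
exists w1^T, w2^T; split; last 1 first.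
- apply: contraNT nz; rewrite negb_or !negbK !trmx_eq0 => /andP[/eqP-> /eqP->].
  by rewrite row_mx0.
- by apply: trmx_inj; rewrite linearD /= !trmx_mul !trmxK trmx0.
- by rewrite [LHS]mxE (we _ h2).
- by rewrite [LHS]mxE (we _ h3).
Qed.

(* If [A i j * I - D_i Q_j] had rank one for all [i, j], then the block matrix
   [A (x) I] would have rank at most [N + 2], against [2 N] for a nonzero minor
   of [A]. *)
Lemma rank_two_obstruction (al : 'I_N) (ph : 'I_N -> R[i]) (Df Qf : 'I_n -> 'M[R[i]]_N)
    (tau a : R) i1 i2 j1 j2 :
  (2 < N)%N ->
  (forall i j l k, let B := (A i j)%:M - Df i *m Qf j in
     nrm (B l k - ph l * B al k) <= tau) ->
  (forall i j, nrm (A i j) <= a) ->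
  let minor := A i1 j1 * A i2 j2 - A i1 j2 * A i2 j1 in
  minor != 0 -> nrm minor <= 4 * a * N%:R * tau.
Proof.
move=> N3 hB ha minor mn0.
have [v1 [v2 [hQ v1a v2a nz]]] := common_kernel (Qf j1) (Qf j2) al N3.
pose v (t : bool * 'I_N) := if t.1 then v1 t.2 0 else v2 t.2 0.
have [[ts ls] _ hmax] := @arg_maxP _ R _ (true, al) xpredT (fun t => nrm (v t)) erefl.
set mu := nrm (v (ts, ls)) in hmax.
have v1m k : nrm (v1 k 0) <= mu by have := hmax (true, k) erefl.
have v2m k : nrm (v2 k 0) <= mu by have := hmax (false, k) erefl.
have mu0 : 0 < mu.
  rewrite lt_def nrm_ge0 andbT; apply: contraTneq nz => mu0.
  rewrite negb_or !negbK; apply/andP; split; apply/eqP/matrixP => k z;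
    rewrite (ord1 z) mxE; apply/eqP; rewrite -nrm_eq0 eq_le nrm_ge0 andbT -mu0 //.
have tau0 : 0 <= tau by exact: le_trans (nrm_ge0 _) (hB i1 j1 al al).
pose E i l := A i j1 * v1 l 0 + A i j2 * v2 l 0.
have BE i l : \sum_k ((A i j1)%:M - Df i *m Qf j1) l k * v1 k 0 +
     \sum_k ((A i j2)%:M - Df i *m Qf j2) l k * v2 k 0 = E i l.
  transitivity ((((A i j1)%:M - Df i *m Qf j1) *m v1 +
     ((A i j2)%:M - Df i *m Qf j2) *m v2) l 0).
    by rewrite [RHS]mxE; congr (_ + _); rewrite [RHS]mxE.
  have -> : ((A i j1)%:M - Df i *m Qf j1) *m v1 + ((A i j2)%:M - Df i *m Qf j2) *m v2
     = A i j1 *: v1 + A i j2 *: v2 - Df i *m (Qf j1 *m v1 + Qf j2 *m v2).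
    rewrite (mulmxDr (Df i)) (mulmxBl (A i j1)%:M) (mulmxBl (A i j2)%:M).
    by rewrite !mul_scalar_mx -!(mulmxA (Df i)) opprD addrACA.
  by rewrite hQ mulmx0 subr0 !mxE.
have E_le i l : nrm (E i l) <= 2 * (N%:R * (tau * mu)).
  (* The rank one correction [ph l * E i al] vanishes, so the hypothesis bounds [E i l] itself. *)
  have E0 : E i al = 0 by rewrite /E v1a v2a !mulr0 addr0.
  have -> : E i l = E i l - ph l * E i al by rewrite E0 mulr0 subr0.
  rewrite -!BE mulrDr !mulr_sumr opprD addrACA -!sumrB.
  rewrite mulr_natl mulr2n (le_trans (nrmD _ _)) // lerD //; apply: nrm_sum_ord => k;
    by rewrite mulrA -mulrBl nrmM ler_pM ?nrm_ge0 // hB.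
have a0 : 0 <= a by exact: le_trans (nrm_ge0 _) (ha i1 j1).
have comb x y l : nrm (A i2 x * E i1 l - A i1 y * E i2 l) <=
    4 * a * N%:R * tau * mu.
  rewrite (le_trans (nrmB _ _)) // !nrmM.
  have h1 : nrm (A i2 x) * nrm (E i1 l) <= a * (2 * (N%:R * (tau * mu))).
    by rewrite ler_pM ?nrm_ge0.
  have h2 : nrm (A i1 y) * nrm (E i2 l) <= a * (2 * (N%:R * (tau * mu))).
    by rewrite ler_pM ?nrm_ge0.
  have -> : 4 * a * N%:R * tau * mu =
    a * (2 * (N%:R * (tau * mu))) + a * (2 * (N%:R * (tau * mu))) by ring.
  exact: lerD.
(* Cramer's rule recovers from [E i1] and [E i2] the coordinate of largest modulus [mu], which then
   cancels. *)
suff key : nrm (minor * v (ts, ls)) <= 4 * a * N%:R * tau * mu.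
  by rewrite -(ler_pM2r mu0) {1}/mu -nrmM.
rewrite /v /=; case: (ts).
- have -> : minor * v1 ls 0 = A i2 j2 * E i1 ls - A i1 j2 * E i2 ls.
    by rewrite /minor /E; ring.
  exact: comb.
- have -> : minor * v2 ls 0 = - (A i2 j1 * E i1 ls - A i1 j1 * E i2 ls).
    by rewrite /minor /E; ring.
  by rewrite nrmN; exact: comb.
Qed.

End RankTwo.

(** * Quadratic part of rank one *)

Section RankOne.
Variables (R : rcfType) (n N : nat).
Local Notation nrm := (@ComplexField.Normc.normc R).
Variables (u v b : 'I_n -> R[i]) (X : 'I_n -> 'M[R[i]]_N).

Lemma lfac_rank1 i : lfac (fun i j => u i * v j) b X i = u i *: lin v 0 X + (b i)%:M.
Proof.
rewrite /lfac /lin raddf0 subr0 scaler_sumr; congr (_ + _).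
by apply: eq_bigr => j _; rewrite scalerA.
Qed.

Lemma rfac_rank1 i : rfac (fun i j => u i * v j) X i = v i *: lin u 0 X.
Proof.
rewrite /rfac /lin raddf0 subr0 scaler_sumr.
by apply: eq_bigr => j _; rewrite scalerA mulrC.
Qed.

(** The polynomial is then one in the single matrix [\sum_j v j *: X j], and the hypotheses are
    Vieta's formulas for its roots. *)
Lemma quad_rank1 (ka be c r1 r2 : R[i]) :
  ka * (r1 + r2) = - be -> ka * (r1 * r2) = c ->
  quad (fun i j => ka * v i * v j) (fun i => be * v i) c X =
  ka *: (lin v r1 X *m lin v r2 X).
Proof.
move=> h1 h2; rewrite /quad /lin.
set V := \sum_j v j *: X j.
have -> : \sum_i (be * v i) *: X i = be *: V.
  by rewrite scaler_sumr; apply: eq_bigr => i _; rewrite scalerA.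
have -> : \sum_i \sum_j (ka * v i * v j) *: (X i *m X j) = ka *: (V *m V).
  rewrite mulmx_suml scaler_sumr; apply: eq_bigr => i _.
  rewrite mulmx_sumr scaler_sumr; apply: eq_bigr => j _.
  by rewrite -scalemxAl -scalemxAr !scalerA.
rewrite mulmxBl !mulmxBr mul_mx_scalar !mul_scalar_mx scale_scalar_mx -h2.
have -> : be = - (ka * (r1 + r2)) by rewrite h1 opprK.
set W := V *m V; clearbody V W; apply/matrixP => i j; rewrite !mxE.
by case: (i == j); rewrite ?mulr1n ?mulr0n; ring.
Qed.

(** With V = [lin v 0 X] and U = [lin u 0 X], adding the two relations of one index cancels [la] and
    leaves u_i VG + b_i G + v_i GU, of size at most 2 L + 4 L. Cross multiplication between two
    indices eliminates GU. *)
Lemma rank1_combination (G : 'M[R[i]]_N) (la : 'I_n -> R[i]) (L : R) i j l k :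
  let A i j := u i * v j in
  (forall i l k, nrm ((lfac A b X i *m G - la i *: G) l k) <= 2 * L) ->
  (forall i l k, nrm ((G *m rfac A X i + la i *: G) l k) <= 4 * L) ->
  nrm (((u i * v j - u j * v i) *: (lin v 0 X *m G) +
        (b i * v j - b j * v i) *: G) l k) <= (nrm (v i) + nrm (v j)) * (6 * L).
Proof.
move=> A hl hr.
pose D i := lfac A b X i *m G - la i *: G; pose E i := G *m rfac A X i + la i *: G.
have -> : (u i * v j - u j * v i) *: (lin v 0 X *m G) + (b i * v j - b j * v i) *: G
   = v j *: (D i + E i) - v i *: (D j + E j).
  have DE h : D h + E h = u h *: (lin v 0 X *m G) + b h *: G + v h *: (G *m lin u 0 X).
    rewrite /D /E lfac_rank1 rfac_rank1 mulmxDl mul_scalar_mx -scalemxAl -scalemxAr.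
    by rewrite addrACA addNr addr0.
  rewrite !DE; set P := lin v 0 X *m G; set Q := G *m _; clearbody P Q.
  by apply/matrixP => r s; rewrite !mxE; ring.
rewrite [X in nrm X]mxE [X in nrm (X + _)]mxE [X in nrm (_ + X)]mxE [X in nrm (_ - X)]mxE.
rewrite (le_trans (nrmB _ _)) // !nrmM mulrDl addrC.
have h i' : nrm ((D i' + E i') l k) <= 6 * L.
  rewrite [X in nrm X]mxE (le_trans (nrmD _ _)) //.
  have := hl i' l k; have := hr i' l k; rewrite -/(D i') -/(E i'); lra.
by rewrite lerD // ler_wpM2l ?nrm_ge0.
Qed.

End RankOne.

(** * Inverses of affine pencils *)

Section LinearPencil.
Variables (R : rcfType) (n N : nat).
Local Notation nrm := (@ComplexField.Normc.normc R).

(** The derivative along one entry is [v j] times a matrix unit. The unit at [(be, al)] meets the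
    largest entry twice and gives [v j * G al be * G al be], which is at most [2 * L] times
    [G al be] in modulus. *)
Lemma lin_inverse_bound (v : 'I_n -> R[i]) (c : R[i]) (X : 'I_n -> 'M[R[i]]_N)
    (L : R) j : 0 <= L ->
  \det (lin v c X) != 0 ->
  (forall k l, nrm (\det (linP v c X j k l))`_1 <= L * nrm (\det (linP v c X j k l))`_0) ->
  (forall k l a b, nrm (\adj (linP v c X j k l) a b)`_1 <=
     L * nrm (\adj (linP v c X j k l) a b)`_0) ->
  forall a b, nrm (v j) * nrm (invmx (lin v c X) a b) <= 2 * L.
Proof.
move=> L0 dV hd hadj; set G := invmx _.
case: N X dV hd hadj @G => [|N'] X dV hd hadj G; first by case.
have [al [be hm]] := argmax_nrm G.
have h : nrm (v j) * nrm (G al be) * nrm (G al be) <= 2 * L * nrm (G al be).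
  have d0 : (\det (linP v c X j be al))`_0 != 0 by rewrite -det_mxcoef0 linP0.
  have := resolvent_derivative d0 (hd be al) (hadj be al) al be.
  rewrite linP0 linP1 -/G.
  have -> : (G *m (v j *: delta_mx be al) *m G) al be = v j * G al be * G al be.
    have hs := delta_sandwich G (v j)%:M 0 be al al be.
    rewrite mul_mx_scalar mul0mx addr0 mulmx0 mul_scalar_mx in hs.
    by rewrite hs; clearbody G; rewrite !mxE; ring.
  by rewrite !nrmM.
move=> a b'; have [G0|Gn0] := eqVneq (G al be) 0.
  have := hm a b'; rewrite G0 nrm0 => h0.
  have -> : nrm (G a b') = 0 by apply/eqP; rewrite eq_le h0 nrm_ge0.
  by rewrite mulr0 mulr_ge0.
apply: (le_trans (ler_wpM2l (nrm_ge0 _) (hm a b'))).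
by rewrite -(ler_pM2r (_ : 0 < nrm (G al be))) // nrm_gt0.
Qed.

End LinearPencil.

(** * Deterministic bound of the inverse by the logarithmic derivatives *)

Section ResolventBound.
Variables (R : rcfType).
Local Notation nrm := (@ComplexField.Normc.normc R).

(** A bound on the logarithmic derivative at 0, in a form that makes sense when the constant
    coefficient vanishes. *)
Definition tame (L : R) (F : {poly R[i]}) := nrm F`_1 <= L * nrm F`_0.

Definition quad_tame n N (A : 'I_n -> 'I_n -> R[i]) b c (X : 'I_n -> 'M[R[i]]_N) L :=
  forall j k l,
    [/\ tame L (\det (quadP A b c X j k l)),
        forall r s, tame L (\adj (quadP A b c X j k l) r s)
      & forall i r s t, tame L (colpairP A b c X j k l i r s t)].

Definition lin_tame n N (v : 'I_n -> R[i]) c (X : 'I_n -> 'M[R[i]]_N) L :=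
  forall j k l,
    tame L (\det (linP v c X j k l)) /\
    forall r s, tame L (\adj (linP v c X j k l) r s).

Lemma quad_tame_first_order n N (A : 'I_n -> 'I_n -> R[i]) b c (X : 'I_n -> 'M[R[i]]_N) L :
  quad_tame A b c X L -> \det (quad A b c X) != 0 ->
  let G := invmx (quad A b c X) in
  forall j k l r s, nrm (G r k * (lfac A b X j *m G) l s +
     (G *m rfac A X j) r k * G l s) <= 2 * L * nrm (G r s).
Proof.
move=> ht dM G j k l r s; have [h1 h2 _] := ht j k l.
have d0 : (\det (quadP A b c X j k l))`_0 != 0 by rewrite -det_mxcoef0 quadP0.
have := resolvent_derivative d0 h1 h2 r s.
by rewrite quadP0 quadP1 delta_sandwich.
Qed.

(** The obstruction is applied with error [28 * L ^+ 2 / nrm (G al be)], so that a fixed nonzero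
    minor caps the largest entry; 112 = 4 * 28. *)
Lemma rank2_resolvent_bound n N (A : 'I_n -> 'I_n -> R[i]) b c (X : 'I_n -> 'M[R[i]]_N)
    L a i1 i2 j1 j2 :
  (2 < N)%N -> 0 <= L -> quad_tame A b c X L -> \det (quad A b c X) != 0 ->
  (forall i j, nrm (A i j) <= a) ->
  let minor := A i1 j1 * A i2 j2 - A i1 j2 * A i2 j1 in minor != 0 ->
  forall r s, nrm minor * nrm (invmx (quad A b c X) r s) <= 112 * a * N%:R * L ^+ 2.
Proof.
move=> N3 L0 ht dM ha minor mn0; set G := invmx _.
case: N X N3 ht dM @G => // N' X N3 ht dM G.
have [al [be hm]] := argmax_nrm G.
have a0 : 0 <= a by exact: le_trans (nrm_ge0 _) (ha i1 j1).
move=> r s; apply: (le_trans (ler_wpM2l (nrm_ge0 _) (hm r s))).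
have [G0|Gn0] := eqVneq (G al be) 0.
  by rewrite G0 nrm0 mulr0 !mulr_ge0 // exprn_ge0.
have gp : 0 < nrm (G al be) by rewrite nrm_gt0.
have fo := quad_tame_first_order ht dM.
have := @rank_two_obstruction R n N'.+1 A al (fun l => G l be / G al be)
  (defect A b c X al be) (shifted_rfac A b c X al be)
  (28 * L ^+ 2 / nrm (G al be)) a i1 i2 j1 j2 N3.
have -> : 112 * a * N'.+1%:R * L ^+ 2 =
  4 * a * N'.+1%:R * (28 * L ^+ 2 / nrm (G al be)) * nrm (G al be).
  by field; rewrite gt_eqF.
move=> H; rewrite ler_pM2r //; apply: H => // i j l k /=.
rewrite ler_pdivlMr // mulrC.
apply: (@defect_prod_rank1 R n N'.+1 A b c X L L0 al be dM hm Gn0 fo) => j' k' l'.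
  by have [] := ht j' k' l'.
by move=> i' r'; have [_ _] := ht j' k' l'; exact.
Qed.

Lemma rank1_almost_kernel n N (u v b : 'I_n -> R[i]) c (X : 'I_n -> 'M[R[i]]_N) L i j :
  let A i j := u i * v j in
  0 <= L -> quad_tame A b c X L -> \det (quad A b c X) != 0 ->
  let G := invmx (quad A b c X) in
  forall l k, nrm (((u i * v j - u j * v i) *: (lin v 0 X *m G) +
     (b i * v j - b j * v i) *: G) l k) <= (nrm (v i) + nrm (v j)) * (6 * L).
Proof.
move=> A L0 ht dM G.
case: N X ht dM @G => [|N'] X ht dM G; first by case.
have [al [be hm]] := argmax_nrm G.
have fo := quad_tame_first_order ht dM; rewrite -/G in fo.
have [G0|Gn0] := eqVneq (G al be) 0.
  have Gz : G = 0.
    apply/matrixP => r s; rewrite [RHS]mxE; apply/eqP; rewrite -nrm_eq0.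
    by rewrite eq_le nrm_ge0 andbT; have := hm r s; rewrite G0 nrm0.
  move=> l k; rewrite Gz mulmx0 !scaler0 addr0 mxE nrm0.
  by rewrite mulr_ge0 ?addr_ge0 ?nrm_ge0 // mulr_ge0.
move=> l k; apply: (@rank1_combination R n _ u v b X G (lam A X G al be)).
  exact: (lfac_almost_eigen L0 hm Gn0 fo).
exact: (rfac_almost_eigen L0 hm Gn0 fo).
Qed.

Lemma lin_tame_inverse n N (v : 'I_n -> R[i]) c (X : 'I_n -> 'M[R[i]]_N) L j :
  0 <= L -> v j != 0 -> lin_tame v c X L -> \det (lin v c X) != 0 ->
  forall r s, nrm (invmx (lin v c X) r s) <= 2 * L / nrm (v j).
Proof.
move=> L0 vj ht dV r s; rewrite ler_pdivlMr ?nrm_gt0 // mulrC.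
by apply: (lin_inverse_bound L0 dV) => k l; have [] := ht j k l.
Qed.

Lemma quadratic_roots (ka be c : R[i]) : ka != 0 ->
  exists r1 r2 : R[i], ka * (r1 + r2) = - be /\ ka * (r1 * r2) = c.
Proof.
move=> k0; set d := (be ^+ 2 - 4 * ka * c).
have := sqr_sqrtc d; set s := sqrtc d => hs.
exists ((- be + s) / (2 * ka)), ((- be - s) / (2 * ka)).
have two0 : (2 : R[i]) != 0 by rewrite pnatr_eq0.
split; first by field; rewrite ?k0 ?two0.
have -> : ka * ((- be + s) / (2 * ka) * ((- be - s) / (2 * ka))) =
  (be ^+ 2 - s ^+ 2) / (4 * ka) by field; rewrite ?k0 ?two0.
by rewrite hs /d; field; rewrite ?k0 ?pnatr_eq0.
Qed.

(* The pencils [lin v c1] and [lin v c2] matter only when [A] has rank one; the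
   constants must not depend on [c], which will be shifted by the spectral
   parameter. *)
Theorem resolvent_bound n (A : 'I_n -> 'I_n -> R[i]) b i0 j0 : A i0 j0 != 0 ->
  exists (v : 'I_n -> R[i]) j (C : R), [/\ v j != 0, 0 < C &
    forall c, exists c1 c2, forall N (X : 'I_n -> 'M[R[i]]_N) L,
      (2 < N)%N -> 1 <= L -> quad_tame A b c X L ->
      lin_tame v c1 X L -> lin_tame v c2 X L ->
      \det (quad A b c X) != 0 ->
      \det (lin v c1 X) != 0 -> \det (lin v c2 X) != 0 ->
      forall r s, nrm (invmx (quad A b c X) r s) <= C * N%:R * L ^+ 2].
Proof.
(* Row [i0] and the normalised column [j0] are the factors of [A] when it has rank one. *)
move=> A0; pose v j := A i0 j; pose u i := A i j0 / A i0 j0.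
have vp : 0 < nrm (v j0) by rewrite nrm_gt0.
have [|hrank1] := boolP [exists i1, exists i2, exists j1, exists j2,
    A i1 j1 * A i2 j2 - A i1 j2 * A i2 j1 != 0].
  case/existsP => i1 /existsP [i2 /existsP [j1 /existsP [j2 mn0]]].
  set mi := A i1 j1 * _ - _ in mn0.
  have mp : 0 < nrm mi by rewrite nrm_gt0.
  pose a := \sum_i \sum_j nrm (A i j).
  have ha i j : nrm (A i j) <= a.
    rewrite /a (bigD1 i) //= (bigD1 j) //= -addrA lerDl.
    by rewrite addr_ge0 // sumr_ge0 // => *; rewrite ?sumr_ge0 // => *; rewrite nrm_ge0.
  have a0 : 0 < a by rewrite (lt_le_trans vp) // ha.
  exists v, j0, (112 * a / nrm mi); split => //.
    by rewrite divr_gt0 // mulr_gt0.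
  move=> c; exists 0, 0 => N X L N3 L1 ht _ _ dM _ _ r s.
  have L0 : 0 <= L by rewrite (le_trans _ L1).
  have := rank2_resolvent_bound N3 L0 ht dM ha mn0 r s.
  rewrite -ler_pdivlMl // => h; apply: (le_trans h).
  by rewrite le_eqVlt; apply/orP; left; apply/eqP; ring.
have AE : A = fun i j => u i * v j.
  apply/boolp.funext => i; apply/boolp.funext => j; rewrite /u /v.
  move: hrank1; rewrite negb_exists => /forallP /(_ i); rewrite negb_exists.
  move=> /forallP /(_ i0); rewrite negb_exists => /forallP /(_ j).
  rewrite negb_exists => /forallP /(_ j0); rewrite negbK subr_eq0 => /eqP h.
  by rewrite mulrAC -h mulfK.
have ui0 : u i0 = 1 by rewrite /u divff.
have Nge N : (2 < N)%N -> (1 : R) <= N%:R by case: N => // N _; rewrite ler1n.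
(* If [u] and [v] are not proportional, [lin v c0 X *m G] is bounded for the [c0] below, and
   multiplying by the bounded inverse of this pencil recovers [G]. *)
have [|hpar] := boolP [exists i, exists j, u i * v j - u j * v i != 0].
  case/existsP => i /existsP [j]; set de := _ - _ => de0.
  have dp : 0 < nrm de by rewrite nrm_gt0.
  pose c0 := - ((b i * v j - b j * v i) / de).
  pose s := nrm (v i) + nrm (v j) + 1.
  have s0 : 0 < s by rewrite ltr_wpDl // addr_ge0 ?nrm_ge0.
  exists v, j0, (2 / nrm (v j0) * (s * 6 / nrm de)); split => //.
    by rewrite mulr_gt0 ?divr_gt0 // mulr_gt0.
  move=> c; exists c0, c0 => N X L N3 L1 ht hl _ dM dV _ r t.
  have L0 : 0 <= L by rewrite (le_trans _ L1).
  have hG := lin_tame_inverse L0 A0 hl dV.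
  set G := invmx _; set GV := invmx (lin v c0 X) in hG.
  have hW l k : nrm ((lin v c0 X *m G) l k) <= s * (6 * L) / nrm de.
    rewrite ler_pdivlMr // mulrC -nrmM.
    have -> : de * (lin v c0 X *m G) l k = (de *: (lin v 0 X *m G) +
       (b i * v j - b j * v i) *: G) l k.
      transitivity ((de *: (lin v c0 X *m G)) l k); first by rewrite [RHS]mxE.
      congr (fun_of_matrix _ l k); rewrite /lin raddf0 subr0 mulmxBl scalerBr.
      congr (_ + _); rewrite mul_scalar_mx scalerA -scaleNr; congr (_ *: _).
      by rewrite /c0; field.
    have := @rank1_almost_kernel n N u v b c X L i j L0.
    rewrite /G AE => H; apply: (le_trans (H _ _ _ _)).
    - by rewrite -AE.
    - by rewrite -AE.
    - by rewrite ler_wpM2r ?mulr_ge0 // lerDl.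
  have -> : G = GV *m (lin v c0 X *m G).
    by rewrite mulmxA mulVmx ?mul1mx // unitmxE unitfE.
  apply: (le_trans (nrm_mulmx hG hW _ _)).
  by rewrite le_eqVlt; apply/orP; left; apply/eqP; field; rewrite !gt_eqF.
(* If [u] is proportional to [v] but [b] is not, the combination reduces to the nonzero constant
   [de] times [G]. *)
have [|hparb] := boolP [exists i, exists j, b i * v j - b j * v i != 0].
  case/existsP => i /existsP [j]; set de := _ - _ => de0.
  have dp : 0 < nrm de by rewrite nrm_gt0.
  pose s := nrm (v i) + nrm (v j) + 1.
  have s0 : 0 < s by rewrite ltr_wpDl // addr_ge0 ?nrm_ge0.
  exists v, j0, (s * 6 / nrm de); split => //.
    by rewrite divr_gt0 // mulr_gt0.
  move=> c; exists 0, 0 => N X L N3 L1 ht _ _ dM _ _ r t.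
  have L0 : 0 <= L by rewrite (le_trans _ L1).
  set G := invmx _.
  have : nrm (de * G r t) <= s * (6 * L).
    have -> : de * G r t = ((u i * v j - u j * v i) *: (lin v 0 X *m G) +
       (b i * v j - b j * v i) *: G) r t.
      move: hpar; rewrite negb_exists => /forallP /(_ i); rewrite negb_exists.
      move=> /forallP /(_ j); rewrite negbK => /eqP ->.
      by rewrite scale0r add0r [RHS]mxE.
    have := @rank1_almost_kernel n N u v b c X L i j L0.
    rewrite /G AE => H; apply: (le_trans (H _ _ _ _)).
    - by rewrite -AE.
    - by rewrite -AE.
    - by rewrite ler_wpM2r ?mulr_ge0 // lerDl.
  rewrite nrmM -ler_pdivlMl // => h; apply: (le_trans h).
  have -> : (nrm de)^-1 * (s * (6 * L)) = s * 6 / nrm de * 1 * L by ring.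
  rewrite expr2 mulrA; apply: ler_pM => //.
  - by rewrite mulr1 divr_ge0 ?nrm_ge0 // mulr_ge0 // ltW.
  - rewrite -[leLHS]mulr1 ler_pM ?ler_wpM2l ?Nge //.
    + by rewrite mulr1 divr_ge0 ?nrm_ge0 // mulr_ge0 // ltW.
    + by rewrite divr_ge0 ?nrm_ge0 // mulr_ge0 // ltW.
(* Here [u] and [b] are both multiples of [v], and the polynomial splits into two pencils at the
   roots of ka t^2 + be t + c. *)
pose ka := u j0 / v j0; pose be := b j0 / v j0.
have uE i : u i = ka * v i.
  have h : u i * v j0 = u j0 * v i.
    move: hpar; rewrite negb_exists => /forallP /(_ i); rewrite negb_exists.
    by move=> /forallP /(_ j0); rewrite negbK subr_eq0 => /eqP.
  by rewrite /ka mulrAC -h mulfK.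
have bE : b = fun i => be * v i.
  apply/boolp.funext => i.
  have h : b i * v j0 = b j0 * v i.
    move: hparb; rewrite negb_exists => /forallP /(_ i); rewrite negb_exists.
    by move=> /forallP /(_ j0); rewrite negbK subr_eq0 => /eqP.
  by rewrite /be mulrAC -h mulfK.
have ka0 : ka != 0 by apply/eqP => k0; move: ui0; rewrite uE k0 mul0r => /eqP; rewrite eq_sym oner_eq0.
have kp : 0 < nrm ka by rewrite nrm_gt0.
exists v, j0, (4 / nrm (v j0) ^+ 2 / nrm ka); split => //.
  by rewrite !divr_gt0 // exprn_gt0.
move=> c; have [r1 [r2 [h1 h2]]] := quadratic_roots be c ka0.
exists r1, r2 => N X L N3 L1 ht hl1 hl2 dM dV1 dV2 r t.
have L0 : 0 <= L by rewrite (le_trans _ L1).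
have hG1 := lin_tame_inverse L0 A0 hl1 dV1.
have hG2 := lin_tame_inverse L0 A0 hl2 dV2.
set G1 := invmx _ in hG1; set G2 := invmx (lin v r2 X) in hG2.
have -> : invmx (quad A b c X) = ka^-1 *: (G2 *m G1).
  have QE : quad A b c X = ka *: (lin v r1 X *m lin v r2 X).
    rewrite -(quad_rank1 v X h1 h2) {1}AE {1}bE.
    congr (quad _ _ _ _); apply/boolp.funext => i; apply/boolp.funext => j.
    by rewrite uE.
  have Mu : quad A b c X \in unitmx by rewrite unitmxE unitfE; exact: dM.
  have u1 : lin v r1 X \in unitmx by rewrite unitmxE unitfE; exact: dV1.
  have u2 : lin v r2 X \in unitmx by rewrite unitmxE unitfE; exact: dV2.
  have HM : (ka^-1 *: (G2 *m G1)) *m quad A b c X = 1%:M.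
    rewrite QE -scalemxAl -scalemxAr scalerA mulVf // scale1r -mulmxA.
    by rewrite (mulmxA G1) (mulVmx u1) mul1mx (mulVmx u2).
  by rewrite -[LHS]mul1mx -HM -mulmxA (mulmxV Mu) mulmx1.
rewrite mxE nrmM ComplexField.Normc.normcV ler_pdivrMl //.
apply: (le_trans (nrm_mulmx hG2 hG1 _ _)).
by rewrite le_eqVlt; apply/orP; left; apply/eqP; field; rewrite !gt_eqF.
Qed.

End ResolventBound.

(** * Measurability and independence *)

Section ComplexMeasurable.
Context (R : realType) d (T : measurableType d).
Implicit Types f g : T -> R[i].

(** Measurability is expressed in real coordinates, in which the Gaussian entries and the measure on
    the plane are given. *)
Definition cmeas f := measurable_fun setT (fun w => complex.Re (f w)) /\
  measurable_fun setT (fun w => complex.Im (f w)).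

Lemma cmeas_cst c : cmeas (fun=> c).
Proof. by split; apply: measurable_cst. Qed.

Lemma cmeasD f g : cmeas f -> cmeas g -> cmeas (fun w => f w + g w).
Proof.
move=> [f1 f2] [g1 g2]; split.
- rewrite (_ : (fun _ => _) = (fun w => complex.Re (f w)) \+ (fun w => complex.Re (g w))).
    exact: measurable_funD.
  by apply/funext => w /=; case: (f w) => ? ?; case: (g w).
- rewrite (_ : (fun _ => _) = (fun w => complex.Im (f w)) \+ (fun w => complex.Im (g w))).
    exact: measurable_funD.
  by apply/funext => w /=; case: (f w) => ? ?; case: (g w).
Qed.

Lemma cmeasM f g : cmeas f -> cmeas g -> cmeas (fun w => f w * g w).
Proof.
move=> [f1 f2] [g1 g2]; split.
- rewrite (_ : (fun _ => _) =
    ((fun w => complex.Re (f w)) \* (fun w => complex.Re (g w))) \-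
    ((fun w => complex.Im (f w)) \* (fun w => complex.Im (g w)))).
    by apply: measurable_funB; apply: measurable_funM.
  by apply/funext => w /=; case: (f w) => ? ?; case: (g w).
- rewrite (_ : (fun _ => _) =
    ((fun w => complex.Re (f w)) \* (fun w => complex.Im (g w))) \+
    ((fun w => complex.Im (f w)) \* (fun w => complex.Re (g w)))).
    by apply: measurable_funD; apply: measurable_funM.
  by apply/funext => w /=; case: (f w) => ? ?; case: (g w).
Qed.

Lemma cmeasN f : cmeas f -> cmeas (fun w => - f w).
Proof.
move=> h; rewrite (_ : (fun _ => _) = (fun w => -1 * f w)).
  by apply: cmeasM => //; exact: cmeas_cst.
by apply/funext => w; rewrite mulN1r.
Qed.

Lemma cmeas_sum (I : Type) (s : seq I) (Q : pred I) (F : I -> T -> R[i]) :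
  (forall i, cmeas (F i)) -> cmeas (fun w => \sum_(i <- s | Q i) F i w).
Proof.
move=> h; elim: s => [|x s ih].
  rewrite (_ : (fun _ => _) = fun=> 0); first exact: cmeas_cst.
  by apply/funext => w; rewrite big_nil.
rewrite (_ : (fun _ => _) = fun w => (if Q x then F x w else 0) + \sum_(i <- s | Q i) F i w).
  by apply: cmeasD => //; case: (Q x) => //; exact: cmeas_cst.
by apply/funext => w; rewrite big_cons; case: (Q x); rewrite ?add0r.
Qed.

Lemma cmeas_prod (I : Type) (s : seq I) (Q : pred I) (F : I -> T -> R[i]) :
  (forall i, cmeas (F i)) -> cmeas (fun w => \prod_(i <- s | Q i) F i w).
Proof.
move=> h; elim: s => [|x s ih].
  rewrite (_ : (fun _ => _) = fun=> 1); first exact: cmeas_cst.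
  by apply/funext => w; rewrite big_nil.
rewrite (_ : (fun _ => _) = fun w => (if Q x then F x w else 1) * \prod_(i <- s | Q i) F i w).
  by apply: cmeasM => //; case: (Q x) => //; exact: cmeas_cst.
by apply/funext => w; rewrite big_cons; case: (Q x); rewrite ?mul1r.
Qed.

Lemma cmeas_nrm f : cmeas f ->
  measurable_fun setT (fun w => ComplexField.Normc.normc (f w)).
Proof.
move=> [f1 f2].
rewrite (_ : (fun _ => _) = (@Num.sqrt R) \o ((fun w => complex.Re (f w) ^+ 2) \+
   (fun w => complex.Im (f w) ^+ 2))).
  apply: measurableT_comp; first by apply: continuous_measurable_fun; exact: sqrt_continuous.
  by apply: measurable_funD; apply: measurable_funX.
by apply/funext => w /=; case: (f w).
Qed.

End ComplexMeasurable.

Section IndependentSplit.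
Context d (T : measurableType d) (R : realType) (P : probability T R).
Local Open Scope ereal_scope.

Lemma indep_split (I : finType) (F : I -> set_system T) i0 (A0 : set T) (E : I -> set T) :
  mutually_independent P F -> F i0 A0 -> (forall i, i != i0 -> F i (E i)) ->
  P (A0 `&` \bigcap_(i in [set i | i != i0]) E i) =
  P A0 * P (\bigcap_(i in [set i | i != i0]) E i).
Proof.
move=> hI h0 hE; pose E' i := if i == i0 then A0 else E i.
have hE' i : F i (E' i) by rewrite /E'; have [->|/hE] := eqVneq i i0.
have := hI [set: I]%SET E' (fun i _ => hE' i).
have := hI [set~ i0]%SET E' (fun i _ => hE' i).
have -> : \bigcap_(i in [set` [set~ i0]%SET]) E' i = \bigcap_(i in [set i | i != i0]) E i.
  apply/seteqP; split => w h i /= hi.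
    by have := h i; rewrite /E' /= !inE (negPf hi); exact.
  by move: hi; rewrite !inE => hi; rewrite /E' (negPf hi); exact: h.
have -> : \bigcap_(i in [set` [set: I]%SET]) E' i =
    A0 `&` \bigcap_(i in [set i | i != i0]) E i.
  apply/seteqP; split => w /=.
    move=> h; split; first by have := h i0; rewrite /E' eqxx /= inE; exact.
    by move=> i /= ii0; have := h i; rewrite /E' /= inE (negPf ii0); exact.
  move=> [h1 h2] i _; rewrite /E'; case: eqVneq => // ii0; exact: h2.
move=> -> ->; rewrite (bigD1 i0) ?inE //= {1}/E' eqxx; congr (_ * _).
by apply: eq_bigl => i; rewrite !inE.
Qed.

End IndependentSplit.

(** * Independence of one real coordinate from all the others *)

Section OneEntry.
Context d (T : measurableType d) (R : realType) (P : probability T R).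
Variables (n N : nat) (X : 'I_n -> T -> 'M[R[i]]_N).
Hypotheses (N_gt0 : (0 < N)%N) (hX : independent_ginibre P X).
Local Notation rtN := (Num.sqrt (N%:R : R)).
Local Notation coord := ('I_n * (bool * ('I_N * 'I_N)))%type.
Local Notation part := (fun c : coord => entry_part (X c.1) c.2.1 c.2.2).
Local Notation scaled i b := (fun ij w => rtN * entry_part (X i) b ij w).

Lemma rtN_gt0 : 0 < rtN.
Proof. by rewrite sqrtr_gt0 ltr0n. Qed.

Lemma measurable_scaled i b ij : measurable_fun setT (scaled i b ij).
Proof. by have [/(_ i)[/(_ b)[h _ _] _] _] := hX; exact: h. Qed.

Lemma measurable_part c : measurable_fun setT (part c).
Proof.
have -> : entry_part (X c.1) c.2.1 c.2.2 =
    (fun w => rtN^-1 * (rtN * entry_part (X c.1) c.2.1 c.2.2 w)).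
  by apply/funext => w; rewrite mulKf // gt_eqF ?rtN_gt0.
by apply: measurable_funM; [exact: measurable_cst|exact: measurable_scaled].
Qed.

Lemma sigma_mx_measurable i : sigma_mx (X i) `<=` measurable.
Proof.
apply: smallest_sub; first exact: sigma_algebra_measurable.
move=> A [/= c _ [B mB <-]]; exact: (measurable_part (i, c)).
Qed.

Lemma sigma_mx_I i A B : sigma_mx (X i) A -> sigma_mx (X i) B -> sigma_mx (X i) (A `&` B).
Proof.
exact: (@measurableI _ (g_sigma_algebraType
  (\bigcup_k g_sigma_algebra_preimage (entry_part (X i) k.1 k.2)))).
Qed.

Lemma sigma_mx_T i : sigma_mx (X i) setT.
Proof.
exact: (@measurableT _ (g_sigma_algebraType
  (\bigcup_k g_sigma_algebra_preimage (entry_part (X i) k.1 k.2)))).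
Qed.

Lemma sigma_mx_scaled i b ij (B : set R) : measurable B ->
  sigma_mx (X i) (scaled i b ij @^-1` B).
Proof.
move=> mB; apply: sub_sigma_algebra; exists (b, ij) => //.
exists ((fun x => rtN * x) @^-1` B); last by rewrite setTI.
rewrite -[X in measurable X]setTI; exact: measurable_funM.
Qed.

Lemma sigma_family_I i b A B : sigma_family (scaled i b) A ->
  sigma_family (scaled i b) B -> sigma_family (scaled i b) (A `&` B).
Proof.
exact: (@measurableI _ (g_sigma_algebraType
  (\bigcup_k g_sigma_algebra_preimage (scaled i b k)))).
Qed.

Lemma sigma_family_T i b : sigma_family (scaled i b) setT.
Proof.
exact: (@measurableT _ (g_sigma_algebraType
  (\bigcup_k g_sigma_algebra_preimage (scaled i b k)))).
Qed.

Lemma sigma_family_preimage i b ij (B : set R) : measurable B ->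
  sigma_family (scaled i b) (scaled i b ij @^-1` B).
Proof.
by move=> mB; apply: sub_sigma_algebra; exists ij => //; exists B => //; rewrite setTI.
Qed.

Lemma sigma_family_sub i b : sigma_family (scaled i b) `<=` sigma_mx (X i).
Proof.
apply: smallest_sub; first exact: (sigma_algebra_measurable (g_sigma_algebraType
  (\bigcup_k g_sigma_algebra_preimage (entry_part (X i) k.1 k.2)))).
by move=> A [ij _ [B mB <-]]; rewrite setTI; exact: sigma_mx_scaled.
Qed.

Variables (j : 'I_n) (k l : 'I_N).
Local Notation kappa := ((j, (true, (k, l))) : coord).

Definition others : set_system T :=
  \bigcup_(c in [set c | c != kappa]) g_sigma_algebra_preimage (part c).

(* A pi-system generating the sigma-algebra of all the real coordinates other
   than the real part of the entry (k, l) of [X j]. *)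
Definition others_pi : set_system T := [set A | exists B A2 E,
  [/\ forall ij, measurable (B ij), sigma_family (scaled j false) A2,
      forall i, sigma_mx (X i) (E i) &
      A = \bigcap_(ij in [set ij | ij != (k, l)]) (scaled j true ij @^-1` B ij)
          `&` A2 `&` \bigcap_(i in [set i | i != j]) E i]].

Lemma others_pi_I : setI_closed others_pi.
Proof.
move=> _ _ [B [A2 [E [mB mA mE ->]]]] [B' [A2' [E' [mB' mA' mE' ->]]]].
exists (fun ij => B ij `&` B' ij), (A2 `&` A2'), (fun i => E i `&` E' i); split.
- by move=> ij; apply: measurableI.
- exact: sigma_family_I.
- by move=> i; exact: sigma_mx_I.
- apply/seteqP; split => w.
    move=> [[[h1 h2] h3] [[h1' h2'] h3']]; split; first split.
    + by move=> ij hij; split; [exact: h1|exact: h1'].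
    + by [].
    + by move=> i hi; split; [exact: h3|exact: h3'].
  move=> [[h1 [h2 h2']] h3]; split; split; try split; try done.
  + by move=> ij /h1[].
  + by move=> ij /h3[].
  + by move=> ij /h1[].
  + by move=> ij /h3[].
Qed.

Lemma bigcap_true_family (B : 'I_N * 'I_N -> set R) : (forall ij, measurable (B ij)) ->
  sigma_family (scaled j true)
   (\bigcap_(ij in [set ij | ij != (k, l)]) (scaled j true ij @^-1` B ij)).
Proof.
move=> mB; apply: (@fin_bigcap_measurable _ (g_sigma_algebraType
  (\bigcup_k g_sigma_algebra_preimage (scaled j true k)))).
  exact: finite_finset.
by move=> ij _; exact: sigma_family_preimage.
Qed.

Lemma others_pi_measurable : others_pi `<=` measurable.
Proof.
move=> _ [B [A2 [E [mB mA mE ->]]]]; apply: measurableI; first apply: measurableI.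
- exact: (sigma_mx_measurable (sigma_family_sub (bigcap_true_family mB))).
- exact: (sigma_mx_measurable (sigma_family_sub mA)).
- by apply: fin_bigcap_measurable => [|i _]; [exact: finite_finset|exact: sigma_mx_measurable (mE i)].
Qed.

Lemma others_sub : others `<=` others_pi.
Proof.
move=> _ [[i [b ij]] /= hc [B mB <-]]; rewrite setTI.
have [ij0|ijn] := eqVneq i j; last first.
  exists (fun=> setT), setT, (fun i' => if i' == i then entry_part (X i) b ij @^-1` B else setT).
  split => //.
  - exact: sigma_family_T.
  - move=> i'; case: eqVneq => [->|_]; last exact: sigma_mx_T.
    apply: sub_sigma_algebra; exists (b, ij) => //.
    by exists B => //; rewrite setTI.
  - apply/seteqP; split => w /=.
      by move=> h; split => // i' /= _; case: eqVneq.
    by move=> [_ /(_ i ijn)]; rewrite /= eqxx.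
subst i; have mB' : measurable ((fun x => rtN^-1 * x) @^-1` B).
  rewrite -[X in measurable X]setTI; exact: measurable_funM.
have e w : rtN^-1 * (rtN * entry_part (X j) b ij w) = entry_part (X j) b ij w.
  by rewrite mulKf // gt_eqF // rtN_gt0.
case: b hc e => hc e; last first.
  exists (fun=> setT), (scaled j false ij @^-1` ((fun x => rtN^-1 * x) @^-1` B)), (fun=> setT).
  split => //.
  - exact: sigma_family_preimage.
  - by move=> i; exact: sigma_mx_T.
  - apply/seteqP; split => w /=; rewrite e //.
    by move=> [[]].
exists (fun ij' => if ij' == ij then (fun x => rtN^-1 * x) @^-1` B else setT), setT, (fun=> setT).
split => //.
- by move=> ij'; case: eqVneq.
- exact: sigma_family_T.
- by move=> i; exact: sigma_mx_T.
- apply/seteqP; split => w /=.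
    move=> h; split => //; split => // ij' /= _; case: eqVneq => //= ->.
    by rewrite e.
  move=> [[/(_ ij)]]; rewrite /= eqxx /= e => h _ _; apply: h.
  by apply: contraNneq hc => ->.
Qed.

Local Notation sx := (fun w => rtN * entry_part (X j) true (k, l) w).
Local Open Scope ereal_scope.

(** The model gives independence at three levels: entries of one real part, real against imaginary
    part, different matrices. The three components of a generator are split off one level at a time,
    starting with the other matrices. *)
Lemma indep_others_pi (B : set R) A : measurable B -> others_pi A ->
  P (sx @^-1` B `&` A) = P (sx @^-1` B) * P A.
Proof.
move=> mB [B1 [A2 [E [mB1 mA2 mE ->]]]].
set S := sx @^-1` B; set A1 := \bigcap_(ij in _) _; set A3 := \bigcap_(i in _) _.
have fA1 : sigma_family (scaled j true) A1 by exact: bigcap_true_family.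
have fS : sigma_family (scaled j true) S by exact: (@sigma_family_preimage j true (k, l)).
have [hG hI] := hX; have [iid bI] := hG j.
have e3 C : sigma_mx (X j) C -> P (C `&` A3) = P C * P A3.
  by move=> hC; apply: (indep_split (i0 := j) hI hC) => i _; exact: mE.
have e2 C : sigma_family (scaled j true) C -> P (C `&` A2) = P C * P A2.
  move=> hC; have := @indep_split _ _ _ P bool _ true C (fun=> A2) bI hC.
  have -> : \bigcap_(i in [set i | i != true]) A2 = A2.
    by apply/seteqP; split => w; [move=> /(_ false) h; exact: h|move=> h i _].
  by apply; case.
have e1 : P (S `&` A1) = P S * P A1.
  have [_ _ mI] := iid true; apply: (indep_split (i0 := (k, l)) mI).
    by exists B => //; rewrite setTI.
  by move=> ij _; exists (B1 ij) => //; rewrite setTI.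
have mA2' := sigma_family_sub mA2.
have mA1' := sigma_family_sub fA1.
have mS' := sigma_family_sub fS.
rewrite !setIA e3; last by do 2 apply: sigma_mx_I => //.
rewrite e2; last exact: sigma_family_I.
rewrite e3; last exact: sigma_mx_I.
by rewrite e2 // e1 !muleA.
Qed.

(** For fixed [B] both sides are finite measures in [A] that agree on the pi-system [others_pi],
    hence on the sigma-algebra it generates. *)
Lemma indep_others (B : set R) A : measurable B -> <<s others >> A ->
  P (sx @^-1` B `&` A) = P (sx @^-1` B) * P A.
Proof.
move=> mB hA; have mS : measurable (sx @^-1` B).
  by rewrite -[X in measurable X]setTI; exact: measurable_scaled.
have hA' : <<s others_pi >> A by apply: (sub_smallest2r _ others_sub) hA; exact: smallest_sigma_algebra.
have PS : P (sx @^-1` B) \is a fin_num by exact: fin_num_measure.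
pose r := NngNum (fine_ge0 (measure_ge0 P (sx @^-1` B))).
pose H := [set Y | others_pi Y /\ Y `<=` setT].
have HE : H = others_pi by apply/seteqP; split => Y; [case|split].
have PT : others_pi setT.
  exists (fun=> setT), setT, (fun=> setT); split => //.
  - exact: sigma_family_T.
  - by move=> i; exact: sigma_mx_T.
  - by apply/seteqP; split.
have rE : r%:num%:E = P (sx @^-1` B) by rewrite /r /= fineK.
have U := @g_sigma_algebra_measure_unique_trace _ R T others_pi setT measurableT.
rewrite -/H HE in U.
rewrite setIC -rE.
apply: (U others_pi_measurable others_pi_I (mrestr P mS) (mscale r P) _ _ _ _ A hA').
- change (P (setT `&` sx @^-1` B) = r%:num%:E * P setT).
  by rewrite setTI probability_setT mule1 rE.
- move=> Y hY; change (P (Y `&` sx @^-1` B) = r%:num%:E * P Y).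
  by rewrite setIC indep_others_pi // rE.
- change (P (setT `&` sx @^-1` B) < +oo).
  by rewrite setTI ltey_eq fin_num_measure.
- by move=> ? _.
Qed.

End OneEntry.

(** * Random variation of one entry *)

Section TuplePredicates.
Variables (R : realType) (n N : nat).
Local Notation tup := ('I_n -> 'M[R[i]]_N).

Definition shift_entry (j : 'I_n) (k l : 'I_N) (s : R[i]) (X : tup) : tup :=
  fun i => X i + (if i == j then s *: delta_mx k l else 0).

Definition cmeas_tuple d (T : measurableType d) (X : T -> tup) :=
  forall i r s, cmeas (fun w => X w i r s).

(** Quantifying over all measurable tuples lets one predicate be pulled back both to the probability
    space and to a product in which one real coordinate is split off. *)
Definition measurable_tuple_pred (S : tup -> Prop) :=
  forall d (T : measurableType d) (X : T -> tup), cmeas_tuple X ->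
    measurable [set w | S (X w)].

End TuplePredicates.

Section Density.
Variable R : realType.
Local Open Scope ereal_scope.

(** With variance 1/2 the density is at most 1 / sqrt pi, hence at most 1. *)
Lemma normal_prob_le (B : set R) : measurable B ->
  normal_prob 0 (Num.sqrt (2^-1 : R)) B <= lebesgue_measure B.
Proof.
move=> mB; have s0 : Num.sqrt (2^-1 : R) != 0%R.
  by rewrite gt_eqF // sqrtr_gt0 invr_gt0 ltr0n.
have peak1 : (normal_peak (Num.sqrt (2^-1 : R)) <= 1)%R.
  rewrite /normal_peak sqr_sqrtr ?invr_ge0 //.
  rewrite -mulr_natr mulrAC mulVf ?mul1r //.
  rewrite invf_le1 ?sqrtr_gt0 ?pi_gt0 //.
  rewrite -[X in (X <= _)%R]sqrtr1 ler_wsqrtr //.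
  by rewrite (le_trans _ (pi_ge2 R)) // ler1n.
rewrite /normal_prob.
apply: (@le_trans _ _ (\int[lebesgue_measure]_(x in B) 1%:E)).
  apply: ge0_le_integral => //.
  - by move=> x _; rewrite lee_fin normal_pdf_ge0.
  - by apply/measurable_EFinP; apply: measurable_funTS; exact: measurable_normal_pdf.
  - by move=> x _; rewrite lee_fin (le_trans (normal_pdf_ub _ _ s0)).
by rewrite integral_cst // mul1e.
Qed.

End Density.

(** * Freezing all coordinates but one *)

Section SectionBound.
Context d (T : measurableType d) (R : realType) (P : probability T R).
Variables (n N : nat) (X : 'I_n -> T -> 'M[R[i]]_N).
Hypotheses (N_gt0 : (0 < N)%N) (hX : independent_ginibre P X).
Local Notation rtN := (Num.sqrt (N%:R : R)).
Local Notation tup := ('I_n -> 'M[R[i]]_N).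
Variables (j : 'I_n) (k l : 'I_N).
Local Notation TO := (g_sigma_algebraType (others X j k l)).

Local Notation MR := (measurableTypeR R).

(** The real part of entry [(k, l)] of the [j]-th matrix is set to 0, so that only the other
    coordinates matter; [Xs] puts a free real value back. *)
Let X0 (w : T) : tup :=
  shift_entry j k l (- (complex.Re (X j w k l))%:C%C) (fun i => X i w).
Let sx (w : T) : R := (rtN * complex.Re (X j w k l))%R.
Let Xs (x : T * R) : tup := shift_entry j k l ((rtN^-1 * x.2)%R%:C%C) (X0 x.1).

Lemma others_part_measurable i b r s : (i, (b, (r, s))) != (j, (true, (k, l))) ->
  measurable_fun setT (fun w : TO => (entry_part (X i) b (r, s) w : R)).
Proof.
move=> h _ B mB; apply: sub_sigma_algebra.
by exists (i, (b, (r, s))) => //=; exists B.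
Qed.

Lemma cmeas_X0 : cmeas_tuple (fun w : TO => X0 w).
Proof.
move=> i r s; split; last first.
  rewrite (_ : (fun _ => _) = (fun w : TO => entry_part (X i) false (r, s) w)).
    by apply: others_part_measurable; apply/eqP => -[].
  apply/funext => w; rewrite /X0 /shift_entry mxE /entry_part /=.
  case: (i == j); last by rewrite mxE; case: (X i w r s) => ? ? /=; rewrite addr0.
  rewrite !mxE; case: (X i w r s) => ? ? /=; case: (_ && _) => /=;
    by rewrite ?mulr0 ?mulr1 ?mul0r ?oppr0 ?addr0.
have [/eqP e|e] := boolP ((i, (true, (r, s))) == (j, (true, (k, l)))).
  case: e => -> -> ->; rewrite (_ : (fun _ => _) = (fun w : TO => 0%R)).
    exact: measurable_cst.
  apply/funext => w; rewrite /X0 /shift_entry eqxx !mxE !eqxx /=.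
  by case: (X j w k l) => ? ? /=; rewrite mulr1 mulr0 subr0 subrr.
rewrite (_ : (fun _ => _) = (fun w : TO => entry_part (X i) true (r, s) w)).
  exact: others_part_measurable.
apply/funext => w; rewrite /X0 /shift_entry mxE /entry_part /=.
have [ij|ij] := eqVneq i j; last by rewrite mxE; case: (X i w r s) => ? ? /=; rewrite addr0.
rewrite !mxE; have -> : (r == k) && (s == l) = false.
  by apply/negbTE/negP => /andP[/eqP rk /eqP sl]; move: e; rewrite ij rk sl eqxx.
by rewrite mulr0; case: (X i w r s) => ? ? /=; rewrite addr0.
Qed.

Lemma cmeas_shift d' (T' : measurableType d') (Y : T' -> tup) (f : T' -> R[i]) :
  cmeas_tuple Y -> cmeas f -> cmeas_tuple (fun w => shift_entry j k l (f w) (Y w)).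
Proof.
move=> hY hf i r s; rewrite /shift_entry.
rewrite (_ : (fun _ => _) = (fun w => Y w i r s + (if i == j then f w * @delta_mx _ N N k l r s else 0))%R).
  apply: cmeasD => //; case: (i == j); last exact: cmeas_cst.
  by apply: cmeasM => //; exact: cmeas_cst.
by apply/funext => w; rewrite mxE; case: (i == j); rewrite !mxE.
Qed.

Lemma cmeas_comp d1 d2 (T1 : measurableType d1) (T2 : measurableType d2)
    (f : T2 -> R[i]) (g : T1 -> T2) :
  cmeas f -> measurable_fun setT g -> cmeas (f \o g).
Proof.
move=> [h1 h2] hg; split.
- exact: (measurableT_comp h1 hg).
- exact: (measurableT_comp h2 hg).
Qed.

Lemma cmeas_real d' (T' : measurableType d') (f : T' -> R) :
  measurable_fun setT f -> cmeas (fun w => (f w)%:C%C).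
Proof. by move=> hf; split => //=; exact: measurable_cst. Qed.

Lemma cmeas_Xs : cmeas_tuple (fun x : TO * MR => Xs x).
Proof.
apply: cmeas_shift.
  by move=> i r s; apply: (cmeas_comp (cmeas_X0 i r s)); exact: measurable_fst.
apply: cmeas_real; apply: measurable_funM; first exact: measurable_cst.
exact: measurable_snd.
Qed.

Lemma Xs_sx w : Xs (w, sx w) = (fun i => X i w).
Proof.
have r0 : rtN != 0 by rewrite gt_eqF // rtN_gt0.
apply/funext => i; rewrite /Xs /X0 /shift_entry /sx [(_, _).1]/= [(_, _).2]/= mulKf //.
case: (i == j); last by rewrite !addr0.
by rewrite scaleNr subrK.
Qed.

(* Fubini over the real part of one entry, the other coordinates being frozen. *)
Lemma section_bound (S : tup -> Prop) (be : R) : measurable_tuple_pred S ->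
  (forall Y : tup, (lebesgue_measure
     [set s : R | S (shift_entry j k l ((rtN^-1 * s)%R%:C%C) Y)] <= be%:E)%E) ->
  (P [set w | S (fun i => X i w)] <= be%:E)%E.
Proof.
move=> mS hS.
(* [TO] is the same space with the smaller sigma-algebra of the other coordinates. *)
have mid : measurable_fun setT (idfun : T -> TO).
  move=> _ B mB; rewrite setTI; change (@measurable d T B).
  have hs := smallest_sub (@sigma_algebra_measurable _ T)
    (@others_pi_measurable _ _ _ _ _ _ _ N_gt0 hX j k l).
  apply: hs.
  have mB' : <<s others X j k l >> B by exact: mB.
  have ho := @others_sub _ _ _ _ _ X N_gt0 j k l.
  by apply: (sub_smallest2r _ ho) mB'; exact: smallest_sigma_algebra.
pose fid : {mfun T >-> TO} := HB.pack (idfun : T -> TO)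
  (isMeasurableFun.Build _ _ _ _ (idfun : T -> TO) mid).
have msx : measurable_fun setT sx by exact: (measurable_scaled hX j true (k, l)).
have mphi : measurable_fun setT (fun w : T => (idfun w, sx w) : TO * MR).
  by apply/measurable_fun_pairP; split.
pose phi : {mfun T >-> (TO * MR)%type} := HB.pack (fun w : T => (idfun w, sx w) : TO * MR)
  (isMeasurableFun.Build _ _ _ _ (fun w : T => (idfun w, sx w) : TO * MR) mphi).
pose E : set (TO * MR) := [set x | S (Xs x)].
have mE : measurable E by exact: (mS _ _ _ cmeas_Xs).
have sg0 : Num.sqrt (2^-1 : R) != 0 by rewrite gt_eqF // sqrtr_gt0 invr_gt0 ltr0n.
have U := @product_measure_unique _ _ TO MR R (distribution P fid)
   (normal_prob 0 (Num.sqrt 2^-1)) (distribution P phi).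
have -> : P [set w | S (fun i => X i w)] = distribution P phi E.
  rewrite /distribution /pushforward; congr (P _); apply/seteqP.
  by split => w /=; rewrite /E /= Xs_sx.
rewrite -U //; last first.
  move=> A B mA mB; have [/(_ j)[/(_ true)[_ hl _] _] _] := hX.
  have e : P (sx @^-1` B) = normal_prob 0 (Num.sqrt 2^-1) B by exact: (hl (k, l) B mB).
  transitivity (P A * P (sx @^-1` B))%E; last by rewrite e.
  rewrite muleC -(@indep_others _ _ _ _ _ _ _ N_gt0 hX j k l B A mB mA).
  rewrite /distribution /pushforward; congr (P _); apply/seteqP.
  by split => w /= [].
rewrite /product_measure1.
apply: (@le_trans _ _ (\int[distribution P fid]_x (cst be%:E x))%E); last first.
  rewrite integral_cst //.
  change (be%:E * P setT <= be%:E)%E.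
  by rewrite probability_setT mule1.
apply: ge0_le_integral => //.
- exact: measurable_fun_xsection.
- move=> x _ /=; apply: (le_trans (normal_prob_le _)).
    exact: measurable_xsection.
  rewrite (_ : xsection E x = [set s | S (shift_entry j k l ((rtN^-1 * s)%R%:C%C) (X0 x))]) //.
  by apply/seteqP; split => s; rewrite /xsection /= ?inE.
Qed.

End SectionBound.

(** * Polynomial dependence on one entry *)

Section LinePolynomials.
Variables (R : realType) (n N : nat) (j : 'I_n) (k l : 'I_N).
Local Notation tup := ('I_n -> 'M[R[i]]_N).
Implicit Types F G : tup -> {poly R[i]}.

(* [F X] stands for the restriction to the line through [X] in the direction of
   the entry (k, l) of the j-th matrix of a function that is polynomial of degree
   at most [m] along that line. *)
Definition linepoly m F :=
  [/\ forall X, (size (F X) <= m.+1)%N,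
      forall X s, F (shift_entry j k l s X) = F X \Po ('X + s%:P)
    & forall d (T : measurableType d) (X : T -> tup), cmeas_tuple X ->
        forall r, cmeas (fun w => (F (X w))`_r)].

Lemma linepoly_weak m m' F : (m <= m')%N -> linepoly m F -> linepoly m' F.
Proof.
by move=> mm [h1 h2 h3]; split => // X; rewrite (leq_trans (h1 X)).
Qed.

Lemma linepoly_cst c : linepoly 0 (fun=> c%:P).
Proof.
split => [X|X s|d T X _ r]; first exact: size_polyC_leq1.
  by rewrite comp_polyC.
exact: cmeas_cst.
Qed.

Lemma linepolyD m F G : linepoly m F -> linepoly m G -> linepoly m (fun X => F X + G X).
Proof.
move=> [f1 f2 f3] [g1 g2 g3]; split => [X|X s|d T X hX r].
- by rewrite (leq_trans (size_polyD _ _)) // geq_max f1 g1.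
- by rewrite f2 g2 comp_polyD.
- rewrite (_ : (fun _ => _) = fun w => (F (X w))`_r + (G (X w))`_r).
    by apply: cmeasD; [exact: f3|exact: g3].
  by apply/funext => w; rewrite coefD.
Qed.

Lemma linepolyM m1 m2 F G : linepoly m1 F -> linepoly m2 G ->
  linepoly (m1 + m2) (fun X => F X * G X).
Proof.
move=> [f1 f2 f3] [g1 g2 g3]; split => [X|X s|d T X hX r].
- rewrite (leq_trans (size_polyMleq _ _)) //.
  have := leq_add (f1 X) (g1 X); rewrite addSn addnS.
  by case: (_ + _)%N => // q; rewrite ltnS => /leq_trans -> //.
- by rewrite f2 g2 comp_polyM.
- rewrite (_ : (fun _ => _) = fun w => \sum_(i < r.+1) (F (X w))`_i * (G (X w))`_(r - i)).
    by apply: cmeas_sum => i; apply: cmeasM; [exact: f3|exact: g3].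
  by apply/funext => w; rewrite coefM.
Qed.

Lemma linepolyN m F : linepoly m F -> linepoly m (fun X => - F X).
Proof.
move=> hF; rewrite (_ : (fun _ => _) = fun X => (-1)%:P * F X).
  by rewrite -[m]add0n; apply: linepolyM => //; exact: linepoly_cst.
by apply/funext => X; rewrite polyCN mulN1r.
Qed.

Lemma linepolyB m F G : linepoly m F -> linepoly m G -> linepoly m (fun X => F X - G X).
Proof. by move=> hF hG; apply: linepolyD => //; exact: linepolyN. Qed.

Lemma linepoly_sum m (I : Type) (r : seq I) (F : I -> tup -> {poly R[i]}) :
  (forall i, linepoly m (F i)) -> linepoly m (fun X => \sum_(i <- r) F i X).
Proof.
move=> hF; elim: r => [|x r ih].
  rewrite (_ : (fun _ => _) = fun=> 0%:P).
    by apply: linepoly_weak (linepoly_cst 0).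
  by apply/funext => X; rewrite big_nil.
rewrite (_ : (fun _ => _) = fun X => F x X + \sum_(i <- r) F i X).
  exact: linepolyD.
by apply/funext => X; rewrite big_cons.
Qed.

Lemma linepoly_prod m (I : Type) (r : seq I) (F : I -> tup -> {poly R[i]}) :
  (forall i, linepoly m (F i)) -> linepoly (size r * m) (fun X => \prod_(i <- r) F i X).
Proof.
move=> hF; elim: r => [|x r ih].
  rewrite (_ : (fun _ => _) = fun=> 1%:P); first exact: linepoly_cst.
  by apply/funext => X; rewrite big_nil.
rewrite (_ : (fun _ => _) = fun X => F x X * \prod_(i <- r) F i X).
  by rewrite mulSn; apply: linepolyM.
by apply/funext => X; rewrite big_cons.
Qed.

Lemma linepoly_line i r s : linepoly 1 (fun X => line X j k l i r s).
Proof.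
pose c : R[i] := if i == j then ((r == k) && (s == l))%:R else 0.
have E X : line X j k l i r s = (X i r s)%:P + c%:P * 'X.
  rewrite /line /c !mxE; case: (i == j); rewrite !mxE ?mul0r //.
  by rewrite mulrC rmorph_nat.
split => [X|X t|d T X hX q].
- rewrite E (leq_trans (size_polyD _ _)) // geq_max.
  rewrite (leq_trans (size_polyC_leq1 _)) //.
  by rewrite mul_polyC (leq_trans (size_scale_leq _ _)) // size_polyX.
- have e : shift_entry j k l t X i r s = X i r s + c * t.
    rewrite /shift_entry mxE /c; case: (i == j); rewrite !mxE ?mul0r //.
    by rewrite mulrC.
  rewrite !E e comp_polyD comp_polyM !comp_polyC comp_polyX polyCD polyCM.
  by ring.
- rewrite (_ : (fun _ => _) = fun w => (if q == 0%N then X w i r s else 0) +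
      (c%:P * 'X : {poly R[i]})`_q).
    apply: cmeasD; last exact: cmeas_cst.
    by case: (q == 0%N); [exact: hX|exact: cmeas_cst].
  by apply/funext => w; rewrite E coefD coefC.
Qed.

Lemma linepoly_det p m (M : tup -> 'M[{poly R[i]}]_p) :
  (forall r s, linepoly m (fun X => M X r s)) -> linepoly (p * m) (fun X => \det (M X)).
Proof.
move=> hM; rewrite /determinant; apply: linepoly_sum => s.
rewrite (_ : (fun _ => _) = fun X => ((-1) ^+ perm.odd_perm s)%:P * \prod_i M X i (s i)).
  rewrite -[(p * m)%N]add0n; apply: linepolyM; first exact: linepoly_cst.
  have := @linepoly_prod m 'I_p (index_enum _) (fun i X => M X i (s i)) (fun i => hM _ _).
  by rewrite -[index_enum _]enumT size_enum_ord.
by apply/funext => X; rewrite rmorphXn /= rmorphN1.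
Qed.

Lemma linepoly_adj p m (M : tup -> 'M[{poly R[i]}]_p) r s :
  (forall r s, linepoly m (fun X => M X r s)) ->
  linepoly (p * m) (fun X => \adj (M X) r s).
Proof.
move=> hM.
rewrite (_ : (fun _ => _) = fun X => ((-1) ^+ (s + r))%:P * \det (row' s (col' r (M X)))).
  apply: (@linepoly_weak (0 + p.-1 * m)).
    by rewrite add0n leq_mul2r leq_pred orbT.
  apply: linepolyM; first exact: linepoly_cst.
  apply: linepoly_det => u v.
  rewrite (_ : (fun _ => _) = fun X => M X (lift s u) (lift r v)); first exact: hM.
  by apply/funext => X; rewrite !mxE.
by apply/funext => X; rewrite mxE /cofactor rmorphXn /= rmorphN1.
Qed.

End LinePolynomials.

(** * Logarithmic derivatives and roots *)

Section LogDerivative.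
Variable R : realType.
Local Notation nrm := (@ComplexField.Normc.normc R).

Lemma log_derivative_bound (rs : seq R[i]) (x : R[i]) (rho : R) : 0 < rho ->
  (forall r, r \in rs -> rho <= nrm (x - r)) ->
  let q := \prod_(r <- rs) ('X - r%:P) in
  nrm q^`().[x] <= (size rs)%:R / rho * nrm q.[x].
Proof.
move=> rho0; elim: rs => [|r rs ih] h /=.
  by rewrite big_nil derivC horner0 nrm0 mul0r mul0r.
rewrite big_cons derivM derivXsubC mul1r hornerD !hornerM hornerXsubC.
set q := \prod_(i <- rs) _ in ih *.
rewrite (le_trans (nrmD _ _)) // !nrmM.
have h1 : nrm q^`().[x] <= (size rs)%:R / rho * nrm q.[x].
  by apply: ih => r' hr'; apply: h; rewrite inE hr' orbT.
have h2 : rho <= nrm (x - r) by apply: h; rewrite inE eqxx.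
have h3 : nrm q.[x] <= rho^-1 * (nrm (x - r) * nrm q.[x]).
  by rewrite -ler_pdivrMl ?invr_gt0 // invrK ler_wpM2r ?nrm_ge0.
have h4 := ler_wpM2l (nrm_ge0 (x - r)) h1.
rewrite -natr1 mulrDl mul1r mulrDl addrC.
by rewrite lerD // (le_trans h4) // mulrCA.
Qed.

Lemma nrm_ge_Re (x : R[i]) : `|complex.Re x| <= nrm x.
Proof.
by case: x => a b /=; rewrite -sqrtr_sqr ler_wsqrtr // lerDl sqr_ge0.
Qed.

(** If all roots were at distance at least [m.+1%:R / L], the logarithmic derivative would be at
    most L m / (m + 1) <= L. Using [m.+1] keeps the radius positive for [m = 0]. *)
Lemma steep_near_root (q : {poly R[i]}) m (L : R) (x : R[i]) : 0 < L ->
  (size q <= m.+1)%N -> L * nrm q.[x] < nrm q^`().[x] ->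
  exists rs : seq R[i], [/\ (size rs <= m)%N, q = lead_coef q *: \prod_(r <- rs) ('X - r%:P)
    & exists2 r, r \in rs & nrm (x - r) < m.+1%:R / L].
Proof.
move=> L0 hs hq; have q0 : q != 0.
  by apply: contraTneq hq => ->; rewrite derivC !horner0 nrm0 mulr0 ltxx.
have [rs E] := closed_field_poly_normal q.
have sz : (size rs <= m)%N.
  move: hs; rewrite {1}E size_scale ?lead_coef_eq0 //.
  by rewrite size_prod_XsubC.
exists rs; split => //; apply: contrapT => hn.
move: hq; rewrite ltNge => /negP; apply.
have h r : r \in rs -> m.+1%:R / L <= nrm (x - r).
  by move=> hr; rewrite leNgt; apply/negP => hlt; apply: hn; exists r.
have := log_derivative_bound (divr_gt0 (ltr0Sn _ m) L0) h.
rewrite E derivZ !hornerZ !nrmM mulrCA => h'.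
rewrite ler_wpM2l ?nrm_ge0 // (le_trans h') // ler_wpM2r ?nrm_ge0 //.
rewrite invf_div mulrCA ger_pMr // ler_pdivrMr ?ltr0Sn // mul1r ler_nat.
by rewrite leqW.
Qed.

End LogDerivative.

Section OffProbability.
Context d (T : measurableType d) (R : realType) (P : probability T R).
Implicit Types (Q : T -> Prop) (e : R).

(* [Q] holds outside of a measurable event of probability at most [e]. *)
Definition offprob Q e :=
  exists B, [/\ measurable B, (P B <= e%:E)%E & forall w, ~ B w -> Q w].

Lemma offprob_and Q1 Q2 e1 e2 : offprob Q1 e1 -> offprob Q2 e2 ->
  offprob (fun w => Q1 w /\ Q2 w) (e1 + e2).
Proof.
move=> [B1 [mB1 h1 q1]] [B2 [mB2 h2 q2]]; exists (B1 `|` B2); split.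
- exact: measurableU.
- apply: (le_trans (measureU2 _ mB1 mB2)).
  by rewrite EFinD leeD.
- by move=> w /= /not_orP [nb1 nb2]; split; [exact: q1|exact: q2].
Qed.

Lemma offprob_weak Q1 Q2 e1 e2 : (forall w, Q1 w -> Q2 w) -> e1 <= e2 ->
  offprob Q1 e1 -> offprob Q2 e2.
Proof.
move=> h he [B [mB hB q]]; exists B; split => //.
  by rewrite (le_trans hB) // lee_fin.
by move=> w nB; apply: h; exact: q.
Qed.

Lemma offprob_seq (I : eqType) (r : seq I) (Q : I -> T -> Prop) e :
  (forall i, offprob (Q i) e) ->
  offprob (fun w => forall i, i \in r -> Q i w) ((size r)%:R * e).
Proof.
move=> h; elim: r => [|x r ih].
  by exists set0; split => //; rewrite measure0 mul0r.
have := offprob_and (h x) ih; apply: offprob_weak.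
  move=> w [h1 h2] i; rewrite inE => /orP[/eqP ->//|]; exact: h2.
by rewrite /= -natr1 mulrDl mul1r addrC.
Qed.

Lemma offprob_ord p (Q : 'I_p -> T -> Prop) e :
  (forall i, offprob (Q i) e) -> offprob (fun w => forall i, Q i w) (p%:R * e).
Proof.
move=> /(offprob_seq (enum 'I_p)); rewrite size_enum_ord; apply: offprob_weak => //.
by move=> w h i; apply: h; rewrite mem_enum.
Qed.

End OffProbability.

(** * Probability of a large logarithmic derivative *)

Section TameProbability.
Variable R : realType.
Local Notation nrm := (@ComplexField.Normc.normc R).

Lemma coef0_comp_shift (q : {poly R[i]}) s : (q \Po ('X + s%:P))`_0 = q.[s].
Proof. by rewrite -horner_coef0 horner_comp !hornerE. Qed.

Lemma coef1_comp_shift (q : {poly R[i]}) s : (q \Po ('X + s%:P))`_1 = q^`().[s].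
Proof.
have -> (p : {poly R[i]}) : p`_1 = (p^`())`_0 by rewrite coef_deriv mulr1n.
rewrite deriv_comp derivD derivX derivC addr0 mulr1.
exact: coef0_comp_shift.
Qed.

Lemma measurable_bigsetU_ball (cs : seq R) (r : R) :
  measurable (\big[setU/set0]_(c <- cs) ball c r : set (measurableTypeR R)).
Proof.
elim: cs => [|c cs ih]; first by rewrite big_nil.
by rewrite big_cons; apply: measurableU => //; exact: measurable_ball.
Qed.

Lemma lebesgue_bigsetU_ball (cs : seq R) (r : R) : 0 <= r ->
  (lebesgue_measure (\big[setU/set0]_(c <- cs) ball c r) <=
    ((size cs)%:R * (r *+ 2))%:E)%E.
Proof.
move=> r0; elim: cs => [|c cs ih].
  by rewrite big_nil measure0 mul0r.
rewrite big_cons (le_trans (measureU2 _ _ _)) //.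
- exact: measurable_ball.
- exact: measurable_bigsetU_ball.
- rewrite /= -natr1 mulrDl mul1r addrC EFinD leeD //.
  by rewrite lebesgue_measure_ball.
Qed.

Lemma mem_bigsetU_ball (cs : seq R) (r : R) c x : c \in cs -> ball c r x ->
  (\big[setU/set0]_(c <- cs) ball c r) x.
Proof.
elim: cs => // c' cs ih; rewrite inE big_cons => /orP[/eqP -> ?|h1 h2]; first by left.
by right; apply: ih.
Qed.

(** A real point is at least as near to the real part of a complex root as to the root, so at most
    [m] intervals of radius [m.+1%:R / L / a] around the rescaled real parts cover the set. *)
Lemma steep_set_small (q : {poly R[i]}) m (L a : R) : 0 < L -> 0 < a ->
  (size q <= m.+1)%N ->
  let S := [set s : R | L * nrm q.[(a * s)%:C%C] < nrm q^`().[(a * s)%:C%C]] in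
  measurable S -> (lebesgue_measure S <= (m%:R * (m.+1%:R / L / a *+ 2))%:E)%E.
Proof.
move=> L0 a0 hs S mS.
have r0 : 0 <= m.+1%:R / L / a by rewrite !divr_ge0 // ltW.
have [[s0 hs0]|hn] := pselect (exists s, S s); last first.
  have -> : S = set0 by rewrite -subset0 => s hS; apply: hn; exists s.
  by rewrite measure0 lee_fin mulr_ge0 // mulrn_wge0.
have [rs [szr E _]] := steep_near_root L0 hs hs0.
have lq : lead_coef q != 0.
  rewrite lead_coef_eq0; apply: contraTneq hs0 => q0.
  by rewrite /S /= q0 derivC !horner0 nrm0 mulr0 ltxx.
pose cs := [seq complex.Re r / a | r <- rs].
apply: (@le_trans _ _ (lebesgue_measure (\big[setU/set0]_(c <- cs) ball c (m.+1%:R / L / a)))).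
  apply: le_measure; rewrite ?inE //; first exact: measurable_bigsetU_ball.
  move=> s hS; have [rs' [_ E' [r hr hlt]]] := steep_near_root L0 hs hS.
  (* Each point brings its own list of roots; both lists factor the same [q], so membership
     transfers. *)
  have rr : r \in rs.
    rewrite -root_prod_XsubC -(rootZ _ _ lq) -E E' rootZ //.
    by rewrite root_prod_XsubC.
  apply: (@mem_bigsetU_ball _ _ (complex.Re r / a)); first by apply/mapP; exists r.
  rewrite /ball /= -(ltr_pM2r a0) divfK ?gt_eqF // -{2}(gtr0_norm a0) -normrM mulrBl.
  rewrite divfK ?gt_eqF // distrC mulrC; apply: le_lt_trans hlt.
  apply: le_trans (nrm_ge_Re _).
  by case: (r) => ? ? /=.
apply: (le_trans (lebesgue_bigsetU_ball _ r0)).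
by rewrite lee_fin size_map ler_wpM2r ?mulrn_wge0 // ler_nat.
Qed.

Lemma measurable_lt_pred d (T : measurableType d) (f g : T -> R) :
  measurable_fun setT f -> measurable_fun setT g -> measurable [set w | f w < g w].
Proof.
move=> mf mg; have mh := measurable_fun_ltr mf mg.
by have := mh measurableT [set true] I; rewrite setTI.
Qed.

Variables (n N : nat).
Local Notation tup := ('I_n -> 'M[R[i]]_N).

Lemma measurable_steep j k l m (F : tup -> {poly R[i]}) (L : R) : linepoly j k l m F ->
  measurable_tuple_pred (fun X => L * nrm (F X)`_0 < nrm (F X)`_1).
Proof.
move=> [_ _ hm] d T X hX; apply: measurable_lt_pred.
  apply: measurable_funM; first exact: measurable_cst.
  exact/cmeas_nrm/hm.
exact/cmeas_nrm/hm.
Qed.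

Context d (T : measurableType d) (P : probability T R).
Variable X : 'I_n -> T -> 'M[R[i]]_N.
Hypotheses (N_gt0 : (0 < N)%N) (hX : independent_ginibre P X).
Local Notation rtN := (Num.sqrt (N%:R : R)).

Lemma cmeas_tuple_X : cmeas_tuple (fun w i => X i w).
Proof.
move=> i r s; split; first exact: (@measurable_part _ _ _ _ _ _ _ N_gt0 hX (i, (true, (r, s)))).
exact: (@measurable_part _ _ _ _ _ _ _ N_gt0 hX (i, (false, (r, s)))).
Qed.

(** In the scaled coordinate there are at most m intervals of length 2 (m + 1) sqrt N / L, and sqrt
    N is bounded by N. *)
Lemma tame_prob j k l m F (L : R) : linepoly j k l m F -> 0 < L ->
  offprob P (fun w => tame L (F (fun i => X i w))) (2 * N%:R * m.+1%:R ^+ 2 / L).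
Proof.
move=> hF L0; have hS := measurable_steep L hF.
exists [set w | L * nrm (F (fun i => X i w))`_0 < nrm (F (fun i => X i w))`_1]; split.
- exact: (hS _ _ _ cmeas_tuple_X).
- apply: (section_bound N_gt0 hX (S := fun Y => L * nrm (F Y)`_0 < nrm (F Y)`_1)
    (j := j) (k := k) (l := l)) => // Y.
  have [h1 h2 _] := hF.
  have E : [set s : R | L * nrm (F (shift_entry j k l (rtN^-1 * s)%:C%C Y))`_0 <
       nrm (F (shift_entry j k l (rtN^-1 * s)%:C%C Y))`_1] =
    [set s : R | L * nrm (F Y).[(rtN^-1 * s)%:C%C] < nrm (F Y)^`().[(rtN^-1 * s)%:C%C]].
    by apply/seteqP; split => s /=; rewrite h2 coef0_comp_shift coef1_comp_shift.
  have rt0 : 0 < rtN by rewrite rtN_gt0.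
  have mE : measurable [set s : R | L * nrm (F (shift_entry j k l (rtN^-1 * s)%:C%C Y))`_0 <
       nrm (F (shift_entry j k l (rtN^-1 * s)%:C%C Y))`_1].
    apply: (hS _ R (fun s => shift_entry j k l (rtN^-1 * s)%:C%C Y)).
    apply: cmeas_shift; first by move=> i r s; exact: cmeas_cst.
    by apply: cmeas_real; apply: measurable_funM; [exact: measurable_cst|exact: measurable_id].
  rewrite E; rewrite E in mE.
  have ri : 0 < rtN^-1 by rewrite invr_gt0.
  apply: (le_trans (steep_set_small L0 ri (h1 Y) mE)).
  have rtle : rtN <= N%:R.
    rewrite -[leRHS]ger0_norm // -sqrtr_sqr ler_wsqrtr // -natrX ler_nat.
    by rewrite expnS expn1 leq_pmull.
  rewrite lee_fin invrK -[_ *+ 2]mulr_natr.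
  have -> : m%:R * (m.+1%:R / L * rtN * 2) = (2 * rtN) * (m%:R * m.+1%:R) / L by ring.
  rewrite ler_wpM2r ?invr_ge0 ?(ltW L0) // ler_pM ?mulr_ge0 //.
  by rewrite ler_wpM2l.
  by rewrite expr2 ler_wpM2r // ler_nat.
- by move=> w /= /negP; rewrite -leNgt.
Qed.

End TameProbability.

Section TamePencils.
Variables (R : realType) (n N : nat) (j : 'I_n) (k l : 'I_N).
Local Notation tup := ('I_n -> 'M[R[i]]_N).
Variables (A : 'I_n -> 'I_n -> R[i]) (b : 'I_n -> R[i]) (c : R[i]).
Local Notation linepoly := (linepoly j k l).

Lemma linepoly_scale m a (F : tup -> {poly R[i]}) : linepoly m F ->
  linepoly m (fun X => a%:P * F X).
Proof. by move=> hF; rewrite -[m]add0n; apply: linepolyM => //; exact: linepoly_cst. Qed.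

Lemma linepoly_scalar m (a : R[i]) r s :
  linepoly m (fun=> (a%:P%:M : 'M[{poly R[i]}]_N) r s).
Proof.
rewrite (_ : (fun _ => _) = fun=> (if r == s then a else 0)%:P).
  by apply: (@linepoly_weak _ _ _ _ _ _ 0) => //; exact: linepoly_cst.
by apply/funext => X; rewrite mxE; case: (r == s).
Qed.

Lemma linepoly_quadP r s : linepoly 2 (fun X => quadP A b c X j k l r s).
Proof.
rewrite (_ : (fun _ => _) = fun X : tup =>
   \sum_i \sum_i' (A i i')%:P * (\sum_t line X j k l i r t * line X j k l i' t s) +
   \sum_i (b i)%:P * line X j k l i r s + (c%:P%:M : 'M[{poly R[i]}]_N) r s).
  apply: linepolyD; last exact: linepoly_scalar.
  apply: linepolyD; apply: linepoly_sum => i.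
    apply: linepoly_sum => i'; apply: linepoly_scale; apply: linepoly_sum => t.
    by apply: (@linepolyM _ _ _ _ _ _ 1 1); exact: linepoly_line.
  apply: (@linepoly_weak _ _ _ _ _ _ 1) => //; apply: linepoly_scale.
  exact: linepoly_line.
apply/funext => X; rewrite /quadP /quad mxE [X in X + _]mxE; congr (_ + _ + _).
  rewrite summxE; apply: eq_bigr => i _; rewrite summxE; apply: eq_bigr => i' _.
  by rewrite mxE mxE.
by rewrite summxE; apply: eq_bigr => i _; rewrite mxE.
Qed.

Lemma linepoly_lfacP i r s : linepoly 1 (fun X => lfacP A b X j k l i r s).
Proof.
rewrite (_ : (fun _ => _) = fun X : tup =>
   \sum_i' (A i i')%:P * line X j k l i' r s + ((b i)%:P%:M : 'M[{poly R[i]}]_N) r s).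
  apply: linepolyD; last exact: linepoly_scalar.
  apply: linepoly_sum => i'; apply: linepoly_scale; exact: linepoly_line.
apply/funext => X; rewrite /lfacP /lfac mxE; congr (_ + _).
by rewrite summxE; apply: eq_bigr => i' _; rewrite mxE.
Qed.

Lemma linepoly_linP v r s : linepoly 1 (fun X => linP v c X j k l r s).
Proof.
rewrite (_ : (fun _ => _) = fun X : tup =>
   \sum_i (v i)%:P * line X j k l i r s - (c%:P%:M : 'M[{poly R[i]}]_N) r s).
  apply: linepolyB; last exact: linepoly_scalar.
  apply: linepoly_sum => i'; apply: linepoly_scale; exact: linepoly_line.
apply/funext => X; rewrite /linP /lin mxE [X in _ + X]mxE; congr (_ - _).
by rewrite summxE; apply: eq_bigr => i' _; rewrite mxE.
Qed.

Lemma linepoly_colpairP i r s t : (0 < N)%N ->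
  linepoly (4 * N + 1) (fun X => colpairP A b c X j k l i r s t).
Proof.
move=> N0.
have hadj u v : linepoly (N * 2) (fun X => \adj (quadP A b c X j k l) u v).
  by apply: linepoly_adj => *; exact: linepoly_quadP.
have hmul u v : linepoly (1 + N * 2)
    (fun X => (lfacP A b X j k l i *m \adj (quadP A b c X j k l)) u v).
  rewrite (_ : (fun _ => _) = fun X : tup =>
     \sum_w lfacP A b X j k l i u w * \adj (quadP A b c X j k l) w v).
    by apply: linepoly_sum => w; apply: linepolyM => //; exact: linepoly_lfacP.
  by apply/funext => X; rewrite mxE.
have -> : (4 * N + 1 = (1 + N * 2) + N * 2)%N by ring.
by apply: linepolyB; apply: linepolyM.
Qed.

End TamePencils.

(** * Union bounds over all the polynomials *)

Section TameEvents.
Context d (T : measurableType d) (R : realType) (P : probability T R).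
Variables (n N : nat) (X : 'I_n -> T -> 'M[R[i]]_N).
Hypotheses (N_gt0 : (0 < N)%N) (hX : independent_ginibre P X).
Local Notation Xw w := (fun i => X i w).

(** The largest degree, 4 N + 1, is that of [colpairP]; 72 = 2 * 6^2 because 4 N + 2 <= 6 N. *)
Lemma tame_prob_unif j k l m F (L : R) : linepoly j k l m F -> (m <= 4 * N + 1)%N ->
  0 < L -> offprob P (fun w => tame L (F (Xw w))) (72 * N%:R ^+ 3 / L).
Proof.
move=> hF hm L0; apply: offprob_weak (tame_prob N_gt0 hX hF L0) => //.
rewrite ler_wpM2r ?invr_ge0 ?(ltW L0) //.
have -> : 72 * N%:R ^+ 3 = 2 * N%:R * (6 * N)%:R ^+ 2 :> R by rewrite natrM; ring.
rewrite ler_wpM2l ?mulr_ge0 // -!natrX ler_nat leq_exp2r //.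
by rewrite (leq_trans (_ : _ <= (4 * N + 1).+1)%N) //; lia.
Qed.

(** There are n N^2 directions [(j, k, l)] and, for each, 1 + N^2 + n N^3 <= 3 n N^3 polynomials;
    216 = 3 * 72. *)
Lemma quad_tame_prob A b c (L : R) : (0 < n)%N -> 0 < L ->
  offprob P (fun w => quad_tame A b c (Xw w) L) (216 * n%:R ^+ 2 * N%:R ^+ 8 / L).
Proof.
move=> n0 L0; pose e0 : R := 72 * N%:R ^+ 3 / L.
have h j k l : offprob P (fun w =>
    [/\ tame L (\det (quadP A b c (Xw w) j k l)),
        forall r s, tame L (\adj (quadP A b c (Xw w) j k l) r s)
      & forall i r s t, tame L (colpairP A b c (Xw w) j k l i r s t)])
    (e0 + (N%:R * (N%:R * e0) + n%:R * (N%:R * (N%:R * (N%:R * e0))))).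
  have h1 : offprob P (fun w => tame L (\det (quadP A b c (Xw w) j k l))) e0.
    apply: (@tame_prob_unif j k l (N * 2) (fun Y => \det (quadP A b c Y j k l))) => //.
      by apply: linepoly_det => *; exact: linepoly_quadP.
    by lia.
  have h2 r s : offprob P (fun w => tame L (\adj (quadP A b c (Xw w) j k l) r s)) e0.
    apply: (@tame_prob_unif j k l (N * 2) (fun Y => \adj (quadP A b c Y j k l) r s)) => //.
      by apply: linepoly_adj => *; exact: linepoly_quadP.
    by lia.
  have h3 i r s t : offprob P (fun w => tame L (colpairP A b c (Xw w) j k l i r s t)) e0.
    apply: (@tame_prob_unif j k l (4 * N + 1) (fun Y => colpairP A b c Y j k l i r s t)) => //.
    exact: linepoly_colpairP.
  have h2' := offprob_ord (fun r => offprob_ord (h2 r)).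
  have h3' := offprob_ord (fun i => offprob_ord (fun r => offprob_ord (fun s =>
    offprob_ord (h3 i r s)))).
  apply: offprob_weak (offprob_and h1 (offprob_and h2' h3')) => //.
  by move=> w [? [? ?]].
have := offprob_ord (fun j => offprob_ord (fun k => offprob_ord (h j k))).
apply: offprob_weak => //.
have n1 : (1 : R) <= n%:R by rewrite ler1n.
have N1 : (1 : R) <= N%:R by rewrite ler1n.
have e00 : 0 <= e0 by rewrite /e0 divr_ge0 ?(ltW L0) // mulr_ge0 // exprn_ge0.
have -> : 216 * n%:R ^+ 2 * N%:R ^+ 8 / L = 3 * n%:R ^+ 2 * N%:R ^+ 5 * e0.
  by rewrite /e0; field; rewrite gt_eqF.
have -> : n%:R * (N%:R * (N%:R * (e0 + (N%:R * (N%:R * e0) +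
    n%:R * (N%:R * (N%:R * (N%:R * e0))))))) =
  (n%:R * N%:R ^+ 2 * (1 + N%:R ^+ 2 + n%:R * N%:R ^+ 3)) * e0 by ring.
rewrite ler_wpM2r //.
have -> : 3 * n%:R ^+ 2 * N%:R ^+ 5 = n%:R * N%:R ^+ 2 * (3 * (n%:R * N%:R ^+ 3)) :> R.
  by ring.
rewrite ler_wpM2l ?mulr_ge0 ?exprn_ge0 //.
have a1 : 1 <= N%:R ^+ 2 :> R by rewrite exprn_ege1.
have a2 : N%:R ^+ 2 <= N%:R ^+ 3 :> R by rewrite ler_weXn2l.
have a3 : N%:R ^+ 3 <= n%:R * N%:R ^+ 3 :> R by rewrite ler_peMl ?exprn_ge0.
lra.
Qed.

(** Each direction involves 1 + N^2 polynomials; the estimate is rounded up to the powers of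
    [quad_tame_prob], to which it is added later. *)
Lemma lin_tame_prob v c (L : R) : (0 < n)%N -> 0 < L ->
  offprob P (fun w => lin_tame v c (Xw w) L) (144 * n%:R ^+ 2 * N%:R ^+ 8 / L).
Proof.
move=> n0 L0; pose e0 : R := 72 * N%:R ^+ 3 / L.
have h j k l : offprob P (fun w =>
    tame L (\det (linP v c (Xw w) j k l)) /\
    forall r s, tame L (\adj (linP v c (Xw w) j k l) r s))
    (e0 + N%:R * (N%:R * e0)).
  have h1 : offprob P (fun w => tame L (\det (linP v c (Xw w) j k l))) e0.
    apply: (@tame_prob_unif j k l (N * 1) (fun Y => \det (linP v c Y j k l))) => //.
      by apply: linepoly_det => *; exact: linepoly_linP.
    by lia.
  have h2 r s : offprob P (fun w => tame L (\adj (linP v c (Xw w) j k l) r s)) e0.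
    apply: (@tame_prob_unif j k l (N * 1) (fun Y => \adj (linP v c Y j k l) r s)) => //.
      by apply: linepoly_adj => *; exact: linepoly_linP.
    by lia.
  exact: offprob_and h1 (offprob_ord (fun r => offprob_ord (h2 r))).
have := offprob_ord (fun j => offprob_ord (fun k => offprob_ord (h j k))).
apply: offprob_weak => //.
have n1 : (1 : R) <= n%:R by rewrite ler1n.
have N1 : (1 : R) <= N%:R by rewrite ler1n.
have e00 : 0 <= e0 by rewrite /e0 divr_ge0 ?(ltW L0) // mulr_ge0 // exprn_ge0.
have -> : 144 * n%:R ^+ 2 * N%:R ^+ 8 / L = 2 * n%:R ^+ 2 * N%:R ^+ 5 * e0.
  by rewrite /e0; field; rewrite gt_eqF.
have -> : n%:R * (N%:R * (N%:R * (e0 + N%:R * (N%:R * e0)))) =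
  (n%:R * N%:R ^+ 2 * (1 + N%:R ^+ 2)) * e0 by ring.
rewrite ler_wpM2r //.
have -> : 2 * n%:R ^+ 2 * N%:R ^+ 5 = n%:R * N%:R ^+ 2 * (2 * (n%:R * N%:R ^+ 3)) :> R.
  by ring.
rewrite ler_wpM2l ?mulr_ge0 ?exprn_ge0 //.
have a1 : 1 <= N%:R ^+ 2 :> R by rewrite exprn_ege1.
have a2 : N%:R ^+ 2 <= N%:R ^+ 3 :> R by rewrite ler_weXn2l.
have a3 : N%:R ^+ 3 <= n%:R * N%:R ^+ 3 :> R by rewrite ler_peMl ?exprn_ge0.
lra.
Qed.

End TameEvents.

(** * Almost sure nonvanishing of polynomials *)

Section Nonvanishing.
Context d (T : measurableType d) (R : realType) (P : probability T R).
Variables (n N : nat) (X : 'I_n -> T -> 'M[R[i]]_N).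
Hypotheses (N_gt0 : (0 < N)%N) (hX : independent_ginibre P X).
Local Notation Xw w := (fun i => X i w).
Local Notation tup := ('I_n -> 'M[R[i]]_N).
Local Notation nrm := (@ComplexField.Normc.normc R).
Variables (f : tup -> R[i]) (Y : tup) (fY : f Y != 0).
Hypothesis f_line : forall j k l, exists m F,
  linepoly j k l m F /\ forall Z, (F Z)`_0 = f Z.

(** Interpolates between [Z] and the point [Y] where [f] does not vanish, one matrix entry at a
    time. *)
Definition replace (c : seq ('I_n * ('I_N * 'I_N))) (Z : tup) : tup :=
  fun i => \matrix_(r, s) if (i, (r, s)) \in c then Y i r s else Z i r s.

Lemma replace_cons j k l c Z : replace ((j, (k, l)) :: c) Z =
  shift_entry j k l (Y j k l - replace c Z j k l) (replace c Z).
Proof.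
apply/funext => i; apply/matrixP => r s; rewrite /shift_entry [RHS]mxE.
rewrite [LHS]mxE inE; have [/eqP[-> -> ->]|h] := boolP ((i, (r, s)) == (j, (k, l))).
  by rewrite eqxx !mxE !eqxx /= mulr1 addrC subrK.
rewrite /= [replace c Z i r s]mxE; have [ij|] := eqVneq i j; last by rewrite mxE addr0.
rewrite !mxE; have -> : (r == k) && (s == l) = false.
  by apply/negbTE/negP => /andP[/eqP rk /eqP sl]; move: h; rewrite ij rk sl eqxx.
by rewrite mulr0 addr0.
Qed.

Lemma replace_shift j k l c t Z : (j, (k, l)) \notin c ->
  replace c (shift_entry j k l t Z) = shift_entry j k l t (replace c Z).
Proof.
move=> h; apply/funext => i; apply/matrixP => r s; rewrite /shift_entry !mxE.
case: ifP => // hc; have [ij|] := eqVneq i j; last by rewrite mxE addr0.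
rewrite !mxE; have -> : (r == k) && (s == l) = false.
  by apply/negbTE/negP => /andP[/eqP rk /eqP sl]; move: h; rewrite -ij -rk -sl hc.
by rewrite mulr0 addr0.
Qed.

Lemma replace_cons_shift j k l c t Z :
  replace ((j, (k, l)) :: c) (shift_entry j k l t Z) = replace ((j, (k, l)) :: c) Z.
Proof.
apply/funext => i; apply/matrixP => r s; rewrite !mxE inE.
have [//|h] := boolP ((i, (r, s)) == (j, (k, l))).
rewrite /=; case: ifP => // _.
have [ij|] := eqVneq i j; last by rewrite mxE addr0.
rewrite !mxE; have -> : (r == k) && (s == l) = false.
  by apply/negbTE/negP => /andP[/eqP rk /eqP sl]; move: h; rewrite ij rk sl eqxx.
by rewrite mulr0 addr0.
Qed.

Lemma cmeas_replace c d' (T' : measurableType d') (Z : T' -> tup) :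
  cmeas_tuple Z -> cmeas_tuple (fun w => replace c (Z w)).
Proof.
move=> hZ i r s.
have -> : (fun w => replace c (Z w) i r s) =
    (fun w => if (i, (r, s)) \in c then Y i r s else Z w i r s).
  by apply: funext => w; rewrite mxE.
by case: (_ \in c); [exact: cmeas_cst|exact: hZ].
Qed.

Lemma cmeas_f : (0 < n)%N -> forall d' (T' : measurableType d') (Z : T' -> tup),
  cmeas_tuple Z -> cmeas (fun w => f (Z w)).
Proof.
move=> n0 d' T' Z hZ.
have [m [F [[_ _ h] E]]] := f_line (Ordinal n0) (Ordinal N_gt0) (Ordinal N_gt0).
rewrite (_ : (fun _ => _) = fun w => (F (Z w))`_0); first exact: h.
by apply/funext => w; rewrite E.
Qed.

Lemma measurable_cmeas_eq0 d' (T' : measurableType d') (g : T' -> R[i]) :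
  cmeas g -> measurable [set w | g w = 0].
Proof.
move=> /cmeas_nrm hg.
have : measurable (~` [set w | 0 < nrm (g w)]).
  apply: measurableC; apply: measurable_lt_pred => //; exact: measurable_cst.
congr (measurable _); apply/seteqP; split => w /=.
  by move=> /negP; rewrite nrm_gt0 negbK => /eqP.
by move=> ->; rewrite nrm0 ltxx.
Qed.

(** The value after the replacement is constant along the varying entry. If it is nonzero, the
    polynomial describing the value before the replacement takes it at some complex point, hence is
    nonzero and has finitely many roots on the real line. *)
Lemma replace_step j k l c : (0 < n)%N ->
  P [set w | f (replace c (Xw w)) = 0 /\ f (replace ((j, (k, l)) :: c) (Xw w)) != 0] = 0%E.
Proof.
move=> n0; have [hin|hout] := boolP ((j, (k, l)) \in c).
  rewrite (_ : [set w | _] = set0) ?measure0 //; rewrite -subset0 => w /= [h1 h2].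
  have E : replace ((j, (k, l)) :: c) (Xw w) = replace c (Xw w).
    apply/funext => i; apply/matrixP => r s; rewrite !mxE inE.
    by have [->|//] := eqVneq (i, (r, s)) (j, (k, l)); rewrite hin.
  by move: h2; rewrite E h1 eqxx.
apply/eqP; rewrite eq_le measure_ge0 andbT.
apply: (section_bound N_gt0 hX (j := j) (k := k) (l := l)
  (S := fun Z => f (replace c Z) = 0 /\ f (replace ((j, (k, l)) :: c) Z) != 0)).
  move=> d' T' Z hZ.
  rewrite (_ : [set w | _] = [set w | f (replace c (Z w)) = 0] `&`
     ~` [set w | f (replace ((j, (k, l)) :: c) (Z w)) = 0]).
    apply: measurableI; last apply: measurableC; apply: measurable_cmeas_eq0;
      by apply: cmeas_f => //; exact: cmeas_replace.
  by apply/seteqP; split => w /= [h1 /eqP h2].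
move=> Z; have [m [F [[_ hF _] hf]]] := f_line j k l.
have [h0|hn] := eqVneq (f (replace ((j, (k, l)) :: c) Z)) 0.
  rewrite (_ : [set s | _] = set0) ?measure0 //; rewrite -subset0 => s /= [_].
  by rewrite replace_cons_shift h0 eqxx.
have q0 : F (replace c Z) != 0.
  apply: contraNneq hn => q0; rewrite replace_cons -hf hF q0 comp_poly0.
  by rewrite coef0.
have [rs E] := closed_field_poly_normal (F (replace c Z)).
pose a : R := (Num.sqrt N%:R)^-1; have a0 : a != 0 by rewrite invr_eq0 gt_eqF // rtN_gt0.
rewrite countable_lebesgue_measure0 //; apply: finite_set_countable.
apply: (@sub_finite_set _ _ [set` [seq complex.Re r / a | r <- rs]]); last first.
  exact: finite_seq.
move=> s /= [h _]; apply/mapP; exists ((a * s)%:C%C); last first.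
  by rewrite /= mulrAC divff // mul1r.
rewrite -root_prod_XsubC -(rootZ _ _ (_ : lead_coef (F (replace c Z)) != 0)).
  by rewrite -E /root -coef0_comp_shift -hF hf -replace_shift // h.
by rewrite lead_coef_eq0.
Qed.

(** By [replace_step], replacing an entry cannot decrease the probability that [f] vanishes; once
    all entries are replaced the value is [f Y]. *)
Lemma polynomial_neq0 : (0 < n)%N -> offprob P (fun w => f (Xw w) != 0) 0.
Proof.
move=> n0; pose Z c : set T := [set w | f (replace c (Xw w)) = 0].
have mZ c : measurable (Z c).
  apply: measurable_cmeas_eq0; apply: cmeas_f => //; apply: cmeas_replace.
  exact: (cmeas_tuple_X N_gt0 hX).
have rep0 Y' : replace [::] Y' = Y'.
  by apply/funext => i; apply/matrixP => r s; rewrite mxE.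
exists (Z [::]); split => //; last by move=> w h; apply/eqP => h'; apply: h; rewrite /Z /= rep0.
have H c : (P (Z [::]) <= P (Z c))%E.
  elim: c => [//|[j [k l]] c ih]; apply: (le_trans ih).
  pose D := Z c `&` ~` Z ((j, (k, l)) :: c).
  have mD : measurable D by apply: measurableI => //; exact: measurableC.
  have PD : P D = 0%E.
    rewrite -(replace_step j k l c n0); congr (P _).
    by apply/seteqP; split => w /= [h1 /eqP h2].
  apply: (@le_trans _ _ (P (D `|` Z ((j, (k, l)) :: c)))).
    apply: le_measure; rewrite ?inE //; first exact: measurableU.
    by move=> w h; have [h'|h'] := pselect (Z ((j, (k, l)) :: c) w); [right|left].
  apply: (@le_trans _ _ (P D + P (Z ((j, (k, l)) :: c)))%E).
    exact: measureU2.
  by rewrite PD add0e.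
apply: (le_trans (H (enum {: 'I_n * ('I_N * 'I_N)}))).
rewrite (_ : Z _ = set0) ?measure0 //; rewrite -subset0 => w; rewrite /Z /= => h.
move/eqP: fY; apply; rewrite -h; congr f.
by apply/funext => i; apply/matrixP => r s; rewrite mxE mem_enum.
Qed.

End Nonvanishing.

(** * The smallest singular value *)

Section SigmaMin.
Local Open Scope sesquilinear_scope.
Variables (R : realType) (N : nat).
Local Notation nrm := (@ComplexField.Normc.normc R).
Implicit Types A : 'M[R[i]]_N.

Lemma normr_nrm (x : R[i]) : `|x| = (nrm x)%:C%C.
Proof. by rewrite normc_def; case: x. Qed.

Lemma mulmx_adjoint_self m (v : 'rV[R[i]]_m) :
  (v *m v ^t*) 0 0 = (\sum_k nrm (v 0 k) ^+ 2)%:C%C.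
Proof.
rewrite mxE rmorph_sum; apply: eq_bigr => k _.
by rewrite !mxE -normCK normr_nrm rmorphXn.
Qed.

(** [eigenvalue] refers to row vectors, so the squared norms compared are those of [v] and of [v]
    times the adjoint of [A]. *)
Lemma gram_eigen A (v : 'rV[R[i]]_N) (x : R[i]) : v *m (A ^t* *m A) = x *: v ->
  (\sum_k nrm ((v *m A ^t*) 0 k) ^+ 2)%:C%C = x * (\sum_k nrm (v 0 k) ^+ 2)%:C%C.
Proof.
move=> h; rewrite -!mulmx_adjoint_self.
have -> : x * (v *m v ^t*) 0 0 = ((x *: v) *m v ^t*) 0 0 by rewrite -scalemxAl [RHS]mxE.
rewrite -h; congr (fun_of_matrix _ 0 0).
rewrite -!mulmxA; congr (_ *m (_ *m _)).
apply/matrixP => r s; rewrite !mxE rmorph_sum; apply: eq_bigr => k _.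
by rewrite !mxE rmorphM /= conjCK mulrC.
Qed.

Lemma sumsq_gt0 (v : 'rV[R[i]]_N) : v != 0 -> 0 < \sum_k nrm (v 0 k) ^+ 2.
Proof.
move=> v0; have [k hk] : exists k, v 0 k != 0.
  apply/existsP; apply: contraNT v0; rewrite negb_exists => /forallP h.
  apply/eqP/matrixP => r s; rewrite (ord1 r) mxE; apply/eqP.
  by have := h s; rewrite negbK.
rewrite (bigD1 k) //= ltr_pwDl ?exprn_gt0 ?nrm_gt0 // sumr_ge0 // => *.
by rewrite exprn_ge0 // nrm_ge0.
Qed.

(* The Gram matrix has finitely many eigenvalues, all nonnegative, so the infimum
   defining [sigma_min] is attained. *)
Lemma sigma_min_attained A : (0 < N)%N -> singular_values A (sigma_min A).
Proof.
move=> N0; set B := A ^t* *m A.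
have [rs E] := closed_field_poly_normal (char_poly B).
have lB : lead_coef (char_poly B) = 1 by exact/monicP/char_poly_monic.
rewrite lB scale1r in E.
have rsP x : (x \in rs) = eigenvalue B x.
  by rewrite eigenvalue_root_char E root_prod_XsubC.
have rs_ge0 x : x \in rs -> exists2 s, 0 <= s & x = (s ^+ 2)%:C%C.
  rewrite rsP => /eigenvalueP [v hv v0].
  have h := gram_eigen hv; have hp := sumsq_gt0 v0.
  set p := \sum_k nrm (v 0 k) ^+ 2 in h hp; set q := \sum_k _ in h.
  have pn : (p%:C%C : R[i]) != 0 by rewrite eq_complex /= gt_eqF.
  have q0 : 0 <= q / p by rewrite divr_ge0 // ?(ltW hp) // sumr_ge0 // => *; rewrite exprn_ge0 // nrm_ge0.
  exists (Num.sqrt (q / p)); first exact: sqrtr_ge0.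
  by rewrite sqr_sqrtr // rmorphM fmorphV /= h mulfK.
pose ss := [seq Num.sqrt (complex.Re x) | x <- rs].
have SE : singular_values A = [set` ss].
  apply/seteqP; split => s /=.
    move=> [s0 hs]; apply/mapP; exists (s ^+ 2)%:C%C; first by rewrite rsP.
    by rewrite /= sqrtr_sqr ger0_norm.
  move=> /mapP [x hx ->]; have [t t0 xt] := rs_ge0 x hx.
  split; first exact: sqrtr_ge0.
  rewrite -/B -rsP; suff -> : (Num.sqrt (complex.Re x) ^+ 2)%:C%C = x by [].
  by rewrite xt /= sqrtr_sqr ger0_norm.
have ss0 : ss != [::].
  have : size rs != 0%N.
    have := size_char_poly B; rewrite E size_prod_XsubC => -[->].
    by rewrite -lt0n.
  by rewrite /ss; case: (rs).
have [m mss hm] : exists2 m, m \in ss & forall x, x \in ss -> m <= x.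
  elim: (ss) ss0 => // x s ih _; have [->|/ih [m ms hm]] := eqVneq s [::].
    by exists x => [|y]; rewrite inE // => /eqP ->.
  have [xm|mx] := leP x m.
    exists x; first by rewrite inE eqxx.
    by move=> y; rewrite inE => /orP[/eqP ->//|/hm]; exact: le_trans.
  exists m; first by rewrite inE ms orbT.
  by move=> y; rewrite inE => /orP[/eqP ->|/hm //]; exact: ltW.
rewrite /sigma_min SE; have -> : inf [set` ss] = m; last by [].
apply/eqP; rewrite eq_le; apply/andP; split.
  by apply: ge_inf => //; exists m => y /= /hm.
by apply: lb_le_inf; [exists m|move=> y /= /hm].
Qed.

(** Trades the infimum for a root of a polynomial in a compact interval, the form from which
    measurability is derived. *)
Lemma sigma_min_le_iff A (e : R) : (0 < N)%N -> 0 <= e ->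
  sigma_min A <= e <->
  exists2 t : R, t \in `[0, e ^+ 2] & (char_poly (A ^t* *m A)).[t%:C%C] = 0.
Proof.
move=> N0 e0; split=> [h|[t]].
  have [s0] := sigma_min_attained A N0; rewrite eigenvalue_root_char => /eqP hs.
  exists (sigma_min A ^+ 2) => //.
  by rewrite in_itv /= exprn_ge0 //= ler_pXn2r.
rewrite in_itv /= => /andP[t0 te] ht.
apply: (@le_trans _ _ (Num.sqrt t)); last first.
  by rewrite -(ger0_norm e0) -sqrtr_sqr ler_wsqrtr.
apply: ge_inf; first by exists 0 => x [].
split; first exact: sqrtr_ge0.
by rewrite sqr_sqrtr // eigenvalue_root_char; apply/eqP.
Qed.

(** For an eigenvector [v] of the Gram matrix, [w] has norm [sigma_min A] times that of [v], and the
    adjoint of [invmx A] maps it back to [v]. Comparing largest coordinates costs N for this product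
    and N, a rounding of sqrt N, for the change of norm. *)
Lemma sigma_min_resolvent A (e g : R) : (0 < N)%N -> 0 <= e -> sigma_min A <= e ->
  \det A != 0 -> (forall r s, nrm (invmx A r s) <= g) -> 1 <= g * N%:R ^+ 2 * e.
Proof.
move=> N0 e0 he dA hg.
have [s0 /eigenvalueP [v hv v0]] := sigma_min_attained A N0.
have Au : A \in unitmx by rewrite unitmxE unitfE; exact: dA.
have h := gram_eigen hv; set s := sigma_min A in he s0 h hv.
set w := v *m A ^t* in h.
have hR : \sum_k nrm (w 0 k) ^+ 2 = s ^+ 2 * \sum_k nrm (v 0 k) ^+ 2.
  by apply: (@complexI R); rewrite rmorphM.
have [k0 _ hk] := @arg_maxP _ R _ (Ordinal N0) xpredT (fun k => nrm (v 0 k)) erefl.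
set m := nrm (v 0 k0) in hk.
have m0 : 0 < m.
  rewrite lt_def nrm_ge0 andbT; apply: contraNneq v0 => m0.
  apply/eqP/matrixP => r k; rewrite (ord1 r) mxE; apply/eqP; rewrite -nrm_eq0 eq_le.
  by rewrite nrm_ge0 andbT -m0 -/m; exact: (hk k erefl).
have g0 : 0 <= g by exact: le_trans (nrm_ge0 _) (hg k0 k0).
have N1 : (1 : R) <= N%:R by rewrite ler1n.
have hw k : nrm (w 0 k) <= s * (N%:R * m).
  rewrite -(@ler_pXn2r _ 2) ?nnegrE ?nrm_ge0 ?mulr_ge0 ?(ltW m0) //.
  apply: (@le_trans _ _ (\sum_k nrm (w 0 k) ^+ 2)).
    by rewrite (bigD1 k) //= lerDl sumr_ge0 // => *; rewrite exprn_ge0 // nrm_ge0.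
  rewrite hR exprMn ler_wpM2l ?exprn_ge0 // exprMn.
  apply: (@le_trans _ _ (N%:R * m ^+ 2)).
    have -> : N%:R * m ^+ 2 = \sum_(k < N) m ^+ 2 by rewrite sumr_const card_ord mulr_natl.
    apply: ler_sum => i _; rewrite ler_pXn2r ?nnegrE ?nrm_ge0 ?(ltW m0) //.
    exact: (hk i erefl).
  by rewrite ler_wpM2r ?exprn_ge0 ?(ltW m0) // expr2 ler_peMl.
have vE : v = w *m (invmx A) ^t*.
  rewrite /w -mulmxA; have -> : A ^t* *m (invmx A) ^t* = 1%:M.
    have -> : A ^t* *m (invmx A) ^t* = (invmx A *m A) ^t*.
      apply/matrixP => r t; rewrite !mxE rmorph_sum; apply: eq_bigr => k _.
      by rewrite !mxE rmorphM mulrC.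
    by rewrite mulVmx // trmx1 map_mx1.
  by rewrite mulmx1.
have : m <= N%:R * (s * (N%:R * m) * g).
  rewrite /m {1}vE; apply: nrm_mulmx => [r k|r k]; first by rewrite (ord1 r).
  rewrite !mxE; have := hg k r; suff -> : nrm (invmx A k r)^* = nrm (invmx A k r) by [].
  apply: (@complexI R); rewrite -!normr_nrm; exact: norm_conjC.
have -> : N%:R * (s * (N%:R * m) * g) = m * (g * N%:R ^+ 2 * s) by ring.
rewrite -[leLHS]mulr1 ler_pM2l // => h1; rewrite (le_trans h1) //.
by rewrite ler_wpM2l // mulr_ge0 // exprn_ge0.
Qed.

End SigmaMin.

(** * Measurability of the smallest singular value *)

Section SigmaMinMeasurable.
Local Open Scope sesquilinear_scope.
Variable R : realType.
Local Notation nrm := (@ComplexField.Normc.normc R).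

Lemma cmeas_det N d (T : measurableType d) (B : T -> 'M[R[i]]_N) :
  (forall r s, cmeas (fun w => B w r s)) -> cmeas (fun w => \det (B w)).
Proof.
move=> hB; rewrite /determinant; apply: cmeas_sum => s.
by apply: cmeasM; [exact: cmeas_cst|apply: cmeas_prod => i; exact: hB].
Qed.

Lemma cmeas_conj d (T : measurableType d) (f : T -> R[i]) :
  cmeas f -> cmeas (fun w => (f w)^*).
Proof.
move=> [h1 h2]; split.
  rewrite (_ : (fun _ => _) = fun w => complex.Re (f w)) //.
  by apply/funext => w; case: (f w).
rewrite (_ : (fun _ => _) = \- (fun w => complex.Im (f w))).
  exact: measurable_funN.
by apply/funext => w /=; case: (f w).
Qed.

Lemma char_poly_horner N (B : 'M[R[i]]_N) x : (char_poly B).[x] = \det (x%:M - B).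
Proof.
rewrite /char_poly -[LHS]/(horner_eval x _) -det_map_mx; congr (\det _).
apply/matrixP => r s; rewrite !mxE.
by case: (r == s); rewrite ?mulr1n ?mulr0n /= /horner_eval !hornerE.
Qed.

Lemma nrm_sqE (x : R[i]) : nrm x ^+ 2 = complex.Re x ^+ 2 + complex.Im x ^+ 2.
Proof. by case: x => a b /=; rewrite sqr_sqrtr // addr_ge0 // sqr_ge0. Qed.

(** A real polynomial is continuous and attains its minimum on a compact interval. *)
Lemma nrm_horner_sq (p : {poly R[i]}) :
  exists q : {poly R}, forall t : R, q.[t] = nrm p.[t%:C%C] ^+ 2.
Proof.
pose pr := \poly_(i < size p) complex.Re p`_i.
pose pi := \poly_(i < size p) complex.Im p`_i.
exists (pr ^+ 2 + pi ^+ 2) => t; rewrite nrm_sqE !hornerE.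
have e i : p`_i * (t%:C%C) ^+ i = Complex (complex.Re p`_i * t ^+ i) (complex.Im p`_i * t ^+ i).
  rewrite -rmorphXn /=; case: (p`_i) => a b.
  by apply/eqP; rewrite eq_complex /= !mulr0 subr0 add0r !eqxx.
suff [-> ->] : complex.Re p.[t%:C%C] = pr.[t] /\ complex.Im p.[t%:C%C] = pi.[t] by [].
rewrite horner_coef !horner_poly; split.
  rewrite (raddf_sum (@complex.Re R)); apply: eq_bigr => i _; by rewrite e.
rewrite (raddf_sum (@complex.Im R)); apply: eq_bigr => i _; by rewrite e.
Qed.

(* A root in a compact interval is detected by small values at rational points. *)
Lemma root_rational_approx (p : {poly R[i]}) (e : R) : 0 < e ->
  (exists2 t : R, t \in `[0, e] & p.[t%:C%C] = 0) <->
  (forall k : nat, exists q : rat,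
     ratr q \in `[0, e] /\ nrm p.[(ratr q : R)%:C%C] ^+ 2 < k.+1%:R^-1).
Proof.
move=> e0; have [f hf] := nrm_horner_sq p.
have fc : continuous (horner f) by exact: continuous_horner.
split=> [[t + ht] k|h].
  rewrite in_itv /= => /andP[t0 te].
  have ft : f.[t] = 0 by rewrite hf ht nrm0 expr0n.
  have k0 : 0 < k.+1%:R^-1 :> R by rewrite invr_gt0.
  have /cvgrPdist_lt /(_ _ k0) := fc t.
  move=> /nbhs_ballP [dl /= dl0 hd].
  (* Thanks to [0 < e] this open interval is nonempty even when [t] is an endpoint. *)
  have [q hq] : exists q : rat, ratr q \in `](Num.max 0 (t - dl)), (Num.min e (t + dl))[.
    apply: rat_in_itvoo; rewrite gt_max !lt_min.
    by apply/andP; split; apply/andP; split; lra.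
  exists q; move: hq; rewrite !in_itv /= gt_max lt_min => /andP[/andP[q0 q1] /andP[q2 q3]].
  rewrite (ltW q0) (ltW q2); split => //; rewrite -hf.
  have := hd (ratr q); rewrite /ball /= ft sub0r normrN => hh.
  apply: le_lt_trans (ler_norm _) _; apply: hh.
  by rewrite ltr_norml; lra.
have [c hc hmin] := @EVT_min R (horner f) 0 e (ltW e0) (continuous_subspaceT fc).
exists c => //; have fc0 : 0 <= f.[c] by rewrite hf exprn_ge0 // nrm_ge0.
suff : f.[c] = 0 by rewrite hf => /eqP; rewrite expf_eq0 /= nrm_eq0 => /eqP.
apply/eqP; rewrite eq_le fc0 andbT leNgt; apply/negP => fcp.
have [k hk] : exists k : nat, k.+1%:R^-1 < f.[c].
  exists (Num.truncn (f.[c]^-1)).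
  rewrite invf_plt ?posrE //; exact: truncnS_gt.
have [q [hq hlt]] := h k.
by have := hmin _ hq; rewrite [f.[ratr q]]hf leNgt (lt_trans hlt hk).
Qed.

Lemma measurable_sigma_min_le N d (T : measurableType d) (B : T -> 'M[R[i]]_N) (e : R) :
  (0 < N)%N -> 0 < e -> (forall r s, cmeas (fun w => B w r s)) ->
  measurable [set w | sigma_min (B w) <= e].
Proof.
move=> N0 e0 hB.
pose p w := char_poly ((B w) ^t* *m B w).
have e20 : 0 < e ^+ 2 by rewrite exprn_gt0.
rewrite (_ : [set w | _] = \bigcap_k \bigcup_(q : rat)
   [set w | ratr q \in `[0, e ^+ 2] /\ nrm (p w).[(ratr q : R)%:C%C] ^+ 2 < k.+1%:R^-1]).
  apply: bigcapT_measurable => k; apply: bigcupT_measurable_rat => q.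
  have [hq|/negP hq] := boolP ((ratr q : R) \in `[0, e ^+ 2]); last first.
    by rewrite (_ : [set w | _] = set0) //; rewrite -subset0 => w /= [].
  rewrite (_ : [set w | _] = [set w | nrm (p w).[(ratr q : R)%:C%C] ^+ 2 < k.+1%:R^-1]); last first.
    by apply/seteqP; split => w /= [].
  apply: measurable_lt_pred; last exact: measurable_cst.
  apply: measurable_funX; apply: cmeas_nrm.
  rewrite (_ : (fun _ => _) = fun w => \det ((ratr q : R)%:C%C%:M - (B w) ^t* *m B w)).
    apply: cmeas_det => r s.
    rewrite (_ : (fun _ => _) = fun w => (ratr q : R)%:C%C *+ (r == s) -
        \sum_i (B w i r)^* * B w i s).
      apply: cmeasD; first exact: cmeas_cst.
      apply: cmeasN; apply: cmeas_sum => i; apply: cmeasM => //.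
      exact: cmeas_conj.
    apply/funext => w; rewrite !mxE; congr (_ - _); apply: eq_bigr => i _.
    by rewrite !mxE.
  by apply/funext => w; rewrite /p char_poly_horner.
apply/seteqP; split => w /=.
  move=> /(sigma_min_le_iff _ N0 (ltW e0)) /(root_rational_approx _ e20) h k _.
  by have [q hq] := h k; exists q.
move=> h; apply/(sigma_min_le_iff _ N0 (ltW e0)); apply/(root_rational_approx _ e20) => k.
by have [q _ hq] := h k I; exists q.
Qed.

End SigmaMinMeasurable.

(** * Quadratic noncommutative polynomials *)

Section NoncommutativeQuadratic.
Variables (K : comNzRingType) (n : nat) (p : ncpoly K n).
Local Notation word := (monalg.FMonom (I := 'I_n)).
Local Notation co := (fun s : seq 'I_n => monalg.mcoeff (word s) p).

Definition short_words : seq (monalg.fmonom 'I_n) :=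
  word [::] :: [seq word [:: i] | i <- enum 'I_n] ++
  [seq word [:: i; j] | i <- enum 'I_n, j <- enum 'I_n].

Lemma short_words_uniq : uniq short_words.
Proof.
rewrite /short_words cons_uniq mem_cat negb_or cat_uniq; apply/and4P; split.
- apply/andP; split; first by apply/mapP => -[i _ /(congr1 (@monalg.fmonom_val _))].
  by apply/allpairsP => -[[i j] [_ _ /(congr1 (@monalg.fmonom_val _))]].
- rewrite map_inj_uniq ?enum_uniq // => i j /(congr1 (@monalg.fmonom_val _)) /=.
  by case.
- apply/hasPn => w /allpairsP [[i j] /= [_ _ ->]].
  by apply/negP => /mapP [k _ /(congr1 (@monalg.fmonom_val _))].
- apply: allpairs_uniq; rewrite ?enum_uniq //.
  move=> [i j] [i' j'] _ _ /(congr1 (@monalg.fmonom_val _)) /=.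
  by case=> -> ->.
Qed.

Lemma mem_short_words (w : monalg.fmonom 'I_n) : (size (w : seq 'I_n) <= 2)%N -> w \in short_words.
Proof.
case: w => -[|i [|j [|//]]] _; rewrite /short_words inE mem_cat.
- by rewrite eqxx.
- by apply/orP; right; apply/orP; left; apply: map_f; rewrite mem_enum.
- apply/orP; right; apply/orP; right; apply/allpairsP; exists (i, j).
  by rewrite !mem_enum.
Qed.

Hypothesis p2 : ncdegree p = 2%N.

Lemma msupp_short (w : monalg.fmonom 'I_n) : w \in monalg.msupp p -> (size (w : seq 'I_n) <= 2)%N.
Proof.
move=> hw; have := monalg.mmeasure_mnm_lt (@monalg.fdeg 'I_n) hw.
by move: p2; rewrite /ncdegree; case: (monalg.mmeasure _ _) => // m /= ->.
Qed.

(** Degree two confines the support to the short words, and the words added have coefficient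
    zero. *)
Lemma nceval_short N (X : 'I_n -> 'M[K]_N) :
  nceval p X = \sum_(w <- short_words) monalg.mcoeff w p *: \prod_(i <- (w : seq _)) X i.
Proof.
rewrite [RHS](bigID (fun w => w \in monalg.msupp p)) /= [X in _ + X]big1 ?addr0; last first.
  by move=> w hw; rewrite monalg.mcoeff_outdom // scale0r.
rewrite /nceval -[RHS]big_filter; apply: perm_big; apply: uniq_perm.
- exact: fset_uniq.
- by rewrite filter_uniq // short_words_uniq.
- move=> w; rewrite mem_filter; case hw : (w \in monalg.msupp p) => //=.
  by rewrite mem_short_words // msupp_short.
Qed.

Lemma nceval_quad N (X : 'I_n -> 'M[K]_N) :
  nceval p X = quad (fun i j => co [:: i; j]) (fun i => co [:: i]) (co [::]) X.
Proof.
rewrite nceval_short /short_words big_cons big_cat /= big_nil.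
rewrite big_map big_allpairs_dep /= /quad.
have -> : co [::] *: (1 : 'M[K]_N) = (co [::])%:M by exact: scalemx1.
rewrite [LHS]addrC; congr (_ + _); rewrite addrC; congr (_ + _).
  rewrite big_enum; apply: eq_bigr => i _; rewrite big_enum; apply: eq_bigr => j _.
  by rewrite !big_cons big_nil mulr1.
by rewrite big_enum; apply: eq_bigr => i _; rewrite big_cons big_nil mulr1.
Qed.

Lemma ncdegree2_neq0 : exists i j, co [:: i; j] != 0.
Proof.
apply: contrapT => h.
(* [mmeasure] is the degree plus one, so 2 here means degree at most one. *)
have : (monalg.mmeasure (@monalg.fdeg 'I_n) p <= 2)%N.
  rewrite monalg.mmeasureE; apply/bigmax_leqP_seq => w hw _.
  have := msupp_short hw; rewrite leq_eqVlt => /orP[|]; last by [].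
  case: w hw => -[|i [|j [|//]]] // hw _; case: h; exists i, j.
  by rewrite monalg.mcoeff_neq0.
by move: p2; rewrite /ncdegree; case: (monalg.mmeasure _ _) => [|[|[]]].
Qed.

End NoncommutativeQuadratic.

(** * Small ball probability *)

Section SmallBall.
Variable R : realType.
Local Notation nrm := (@ComplexField.Normc.normc R).

Section Events.
Context d (T : measurableType d) (P : probability T R).
Variables (n N : nat) (X : 'I_n -> T -> 'M[R[i]]_N).
Hypotheses (n_gt0 : (0 < n)%N) (N_gt0 : (0 < N)%N) (hX : independent_ginibre P X).
Local Notation Xw w := (fun i => X i w).

(** At the zero tuple the polynomial equals [c%:M]; this is why the spectral parameter must differ
    from the constant term. *)
Lemma quad_det_neq0 A b c : c != 0 ->
  offprob P (fun w => \det (quad A b c (Xw w)) != 0) 0.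
Proof.
move=> c0; apply: (polynomial_neq0 N_gt0 hX (Y := fun=> 0)
  (f := fun Y => \det (quad A b c Y))) => //.
  rewrite (_ : quad A b c _ = c%:M) ?det_scalar ?expf_neq0 //.
  rewrite /quad [X in X + _ + _]big1 => [|i _]; last first.
    by rewrite big1 // => j _; rewrite mulmx0 scaler0.
  by rewrite [X in _ + X + _]big1 ?add0r // => i _; rewrite scaler0.
move=> j k l; exists (N * 2)%N, (fun Z => \det (quadP A b c Z j k l)); split.
  by apply: linepoly_det => *; exact: linepoly_quadP.
by move=> Z; rewrite -det_mxcoef0 quadP0.
Qed.

(** The pencil is the identity at the tuple with [((c + 1) / v j)%:M] in place [j] and 0
    elsewhere. *)
Lemma lin_det_neq0 v c j : v j != 0 ->
  offprob P (fun w => \det (lin v c (Xw w)) != 0) 0.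
Proof.
move=> vj; apply: (polynomial_neq0 N_gt0 hX
  (Y := fun i => if i == j then ((c + 1) / v j)%:M else 0)
  (f := fun Y => \det (lin v c Y))) => //.
  rewrite (_ : lin v c _ = 1%:M) ?det1 ?oner_neq0 //.
  rewrite /lin (bigD1 j) //= eqxx big1 ?addr0 => [|i /negPf ->]; last by rewrite scaler0.
  by rewrite scale_scalar_mx mulrC divfK // -raddfB addrC addKr.
move=> j' k l; exists (N * 1)%N, (fun Z => \det (linP v c Z j' k l)); split.
  by apply: linepoly_det => *; exact: linepoly_linP.
by move=> Z; rewrite -det_mxcoef0 linP0.
Qed.

Lemma cmeas_quad A b c d' (T' : measurableType d') (Z : T' -> 'I_n -> 'M[R[i]]_N) r s :
  cmeas_tuple Z -> cmeas (fun w => quad A b c (Z w) r s).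
Proof.
move=> hZ; have [_ _ h] := linepoly_quadP (Ordinal n_gt0) (Ordinal N_gt0) (Ordinal N_gt0) A b c r s.
rewrite (_ : (fun _ => _) = fun w =>
  (quadP A b c (Z w) (Ordinal n_gt0) (Ordinal N_gt0) (Ordinal N_gt0) r s)`_0); first exact: h.
apply/funext => w.
by rewrite -(quadP0 A b c (Z w) (Ordinal n_gt0) (Ordinal N_gt0) (Ordinal N_gt0)) mxE.
Qed.

End Events.

Theorem small_ball n (A : 'I_n -> 'I_n -> R[i]) b i0 j0 : A i0 j0 != 0 ->
  exists2 K : R, 0 < K &
  forall c, c != 0 -> forall N, (2 < N)%N ->
  forall d (T : measurableType d) (P : probability T R) (X : 'I_n -> T -> 'M[R[i]]_N),
    independent_ginibre P X -> forall eps : R, 0 < eps ->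
    (P [set w | sigma_min (quad A b c (fun i => X i w)) <= eps]%R <=
      (K * N%:R ^+ 10 * Num.sqrt eps)%:E)%E.
Proof.
move=> A0; have [v [j [C [vj C0 HC]]]] := resolvent_bound b A0.
have n0 : (0 < n)%N by apply: leq_ltn_trans (ltn_ord i0).
have n1 : (1 : R) <= n%:R by rewrite ler1n.
(* 504 = 216 + 144 + 144 collects one quadratic and two linear tameness events; the square root
   comes from 1 / L. *)
pose K := 504 * n%:R ^+ 2 * Num.sqrt (2 * C).
have sC0 : 0 < Num.sqrt (2 * C) by rewrite sqrtr_gt0 mulr_gt0.
have K0 : 0 < K.
  apply: mulr_gt0; last exact: sC0.
  by apply: mulr_gt0; [rewrite ltr0n|apply: exprn_gt0; rewrite ltr0n].
exists K => // c c0 N N3 d T P X hX eps eps0.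
have N0 : (0 < N)%N by lia.
have N1 : (1 : R) <= N%:R by rewrite ler1n.
have Np : (0 : R) < N%:R by rewrite ltr0n.
set E := [set w | _].
have mE : measurable E.
  apply: measurable_sigma_min_le => // r s; apply: cmeas_quad => //.
  exact: (cmeas_tuple_X N0 hX).
(* With [L ^+ 2 = y^-1], the bound [C * N%:R * L ^+ 2] on the inverse turns [sigma_min_resolvent]
   into the contradiction 1 <= 1/2. *)
pose y := 2 * C * N%:R ^+ 3 * eps.
have y0 : 0 < y by rewrite /y !mulr_gt0 // exprn_gt0.
have sy : Num.sqrt y <= Num.sqrt (2 * C) * N%:R ^+ 2 * Num.sqrt eps.
  rewrite /y sqrtrM ?mulr_ge0 ?exprn_ge0 ?(ltW C0) // ler_wpM2r ?sqrtr_ge0 //.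
  rewrite sqrtrM ?mulr_ge0 ?(ltW C0) // ler_wpM2l ?sqrtr_ge0 //.
  rewrite -[leRHS]ger0_norm ?exprn_ge0 // -sqrtr_sqr ler_wsqrtr //.
  by rewrite -exprM ler_weXn2l.
have se0 : 0 <= Num.sqrt eps by exact: sqrtr_ge0.
(* For [y > 1] one would have [L < 1], but then the claimed bound is at least 1. *)
have [y1|y1] := leP y 1; last first.
  apply: (le_trans (probability_le1 P mE)); rewrite lee_fin.
  apply: (@le_trans _ _ (Num.sqrt y)).
    by rewrite -[leLHS]sqrtr1 ler_wsqrtr // ltW.
  apply: (le_trans sy); rewrite ler_wpM2r //.
  apply: ler_pM; rewrite ?exprn_ge0 ?(ltW sC0) //; last by rewrite ler_weXn2l.
  rewrite /K ler_peMl ?(ltW sC0) //.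
  have n21 : 1 <= n%:R ^+ 2 :> R by rewrite exprn_ege1.
  by rewrite -[leLHS]mulr1; apply: ler_pM => //; rewrite ler1n.
pose L := (Num.sqrt y)^-1.
have sy0 : 0 < Num.sqrt y by rewrite sqrtr_gt0.
have L0 : 0 < L by rewrite invr_gt0.
have L1 : 1 <= L by rewrite /L invf_ge1 // -[leRHS]sqrtr1 ler_wsqrtr.
have L2 : L ^+ 2 = y^-1 by rewrite /L exprVn sqr_sqrtr // ltW.
have [c1 [c2 Hc]] := HC c.
have := offprob_and (quad_tame_prob N0 hX A b c n0 L0)
  (offprob_and (lin_tame_prob N0 hX v c1 n0 L0)
  (offprob_and (lin_tame_prob N0 hX v c2 n0 L0)
  (offprob_and (quad_det_neq0 n0 N0 hX A b c0)
  (offprob_and (lin_det_neq0 n0 N0 hX c1 vj) (lin_det_neq0 n0 N0 hX c2 vj))))).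
move=> [B [mB hB hgood]].
have EB : E `<=` B.
  move=> w hw; apply: contrapT => /hgood [h1 [h2 [h3 [h4 [h5 h6]]]]].
  have hg := Hc N _ L N3 L1 h1 h2 h3 h4 h5 h6.
  have := sigma_min_resolvent N0 (ltW eps0) hw h4 hg.
  rewrite L2 /y.
  have -> : C * N%:R / (2 * C * N%:R ^+ 3 * eps) * N%:R ^+ 2 * eps = 2^-1 :> R.
    by field; rewrite ?(gt_eqF C0) ?(gt_eqF Np) ?(gt_eqF eps0).
  by rewrite leNgt invf_lt1 ?ltr1n.
apply: (@le_trans _ _ (P B)); first by apply: le_measure; rewrite ?inE.
apply: (le_trans hB); rewrite lee_fin !addr0 /L invrK.
have -> : 216 * n%:R ^+ 2 * N%:R ^+ 8 * Num.sqrt y +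
  (144 * n%:R ^+ 2 * N%:R ^+ 8 * Num.sqrt y + 144 * n%:R ^+ 2 * N%:R ^+ 8 * Num.sqrt y)
  = 504 * n%:R ^+ 2 * N%:R ^+ 8 * Num.sqrt y by ring.
have -> : K * N%:R ^+ 10 * Num.sqrt eps =
  504 * n%:R ^+ 2 * N%:R ^+ 8 * (Num.sqrt (2 * C) * N%:R ^+ 2 * Num.sqrt eps).
  by rewrite /K; ring.
apply: ler_wpM2l; last exact: sy.
apply: mulr_ge0; last by rewrite exprn_ge0.
by apply: mulr_ge0; [rewrite ler0n|rewrite exprn_ge0].
Qed.

End SmallBall.

(** * Mean area of the pseudospectrum *)

Section ComplexBorel.
Variable R : realType.
Local Notation nrm := (@ComplexField.Normc.normc R).
Local Notation MR := (measurableTypeR R).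
Definition toC (q : MR * MR) : R[i] := Complex q.1 q.2.

Lemma nrm_le_sum (a b : R) : nrm (Complex a b) <= `|a| + `|b|.
Proof.
have -> : Complex a b = a%:C%C + (Complex 0 b) by rewrite /real_complex_def; apply/eqP; rewrite eq_complex /= addr0 add0r !eqxx.
apply: (le_trans (nrmD _ _)) => /=.
by rewrite !expr0n /= addr0 add0r !sqrtr_sqr.
Qed.

Lemma open_toC_measurable (U : set R[i]) : open (U : set (R[i])^o) ->
  measurable (toC @^-1` U).
Proof.
move=> oU.
pose box (a b e : rat) : set (MR * MR) :=
  (ball (ratr a : R) (ratr e)) `*` (ball (ratr b : R) (ratr e)).
rewrite (_ : toC @^-1` U = \bigcup_(a : rat) \bigcup_(b : rat) \bigcup_(e : rat)
   (if pselect (box a b e `<=` toC @^-1` U) then box a b e else set0)).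
  apply: bigcupT_measurable_rat => a; apply: bigcupT_measurable_rat => b.
  apply: bigcupT_measurable_rat => e; case: pselect => h; last exact: measurable0.
  by apply: measurableX; exact: measurable_ball.
apply/seteqP; split => q /=; last first.
  by move=> [a _ [b _ [e _]]]; case: pselect => // h; exact: h.
move=> hq; have /nbhs_ballP [e /= e0 he] : nbhs (toC q : (R[i])^o) (U : set (R[i])^o).
  exact: open_nbhs_nbhs.
(* Radii of balls in [(R[i])^o] are elements of [R[i]]; a positive one is real. *)
have e1 : 0 < complex.Re e by move: e0; rewrite ltcE /= => /andP[].
have eE : e = (complex.Re e)%:C%C by move: e0; case: (e) => x y; rewrite ltcE /= => /andP[/eqP -> _].
(* Two points of a box of radius r differ by less than 2 r in each coordinate, hence by less than 4
   r in modulus. *)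
have e4 : 0 < complex.Re e / 4 by rewrite divr_gt0.
have [r hr] := rat_in_itvoo e4.
move: hr; rewrite in_itv /= => /andP[r0 r1].
have near (x : R) : exists a : rat, `|x - ratr a| < ratr r.
  have hx : x - ratr r < x + ratr r by lra.
  have [a ha] := rat_in_itvoo hx.
  exists a; move: ha; rewrite in_itv /= ltr_norml => /andP[? ?]; lra.
have [a ha] := near q.1; have [b hb] := near q.2.
exists a => //; exists b => //; exists r => //; case: pselect => /= [_|[]].
  by split; rewrite /ball /= distrC.
move=> p [/= pa pb]; apply: he; rewrite /ball /= normr_nrm eE ltcR.
rewrite /ball /= in pa pb.
have -> : toC q - toC p = Complex (q.1 - p.1) (q.2 - p.2) by [].
apply: le_lt_trans (nrm_le_sum _ _) _.
have ha' := ler_distD (ratr a : R) q.1 p.1; have hb' := ler_distD (ratr b : R) q.2 p.2.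
lra.
Qed.

Lemma borelC_measurable (Omega : set R[i]) : borelC Omega -> measurable (toC @^-1` Omega).
Proof.
move=> hO.
have : [set A | measurable (toC @^-1` A)] Omega; last by [].
apply: (smallest_sub _ _ hO); last by move=> U; exact: open_toC_measurable.
split => /=.
- by rewrite preimage_set0.
- by move=> A mA; rewrite setTD preimage_setC; exact: measurableC.
- move=> F mF; rewrite preimage_bigcup; exact: bigcupT_measurable.
Qed.

End ComplexBorel.

Section PlaneLebesgue.
Variable R : realType.
Local Notation MR := (measurableTypeR R).

(* An alias of the product measure, whose own sigma-finiteness instance is not
   found: inference stops at the one for sub-probabilities. *)
Definition lebesgue_plane : set (MR * MR) -> \bar R :=
  (@lebesgue_measure R \x @lebesgue_measure R)%E.

HB.instance Definition _ := Measure.copy lebesgue_plane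
  (@lebesgue_measure R \x @lebesgue_measure R)%E.

Lemma lebesgue_plane_sigma_finite : sigma_finite setT lebesgue_plane.
Proof.
have /sigma_finiteP[F [TF ndF Foo]] := sigma_finiteT (@lebesgue_measure R).
exists (fun n => F n `*` F n) => [|k].
  rewrite -setXTT TF; apply/seteqP; split => -[x y].
    move=> [/= [n _ Fnx] [k _ Gky]]; exists (maxn n k) => //; split.
    - by move: x Fnx; exact/subsetPset/ndF/leq_maxl.
    - by move: y Gky; exact/subsetPset/ndF/leq_maxr.
  by move=> [n _ []/= ? ?]; split; exists n.
have [? ?] := Foo k; split; first exact: measurableX.
by rewrite /lebesgue_plane product_measure1E// lte_mul_pinfty// ge0_fin_numE.
Qed.

HB.instance Definition _ := Measure_isSigmaFinite.Build _ _ _ lebesgue_plane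
  lebesgue_plane_sigma_finite.

Let set1_pair (a b : MR) : [set (a, b)] = [set a] `*` [set b].
Proof. by apply/seteqP; split => -[x y] /= => [[-> ->]|[-> ->]]. Qed.

Lemma measurable_plane_set1 (a b : MR) : measurable [set (a, b)].
Proof. by rewrite set1_pair; apply: measurableX. Qed.

Lemma lebesgue_plane_set1 (a b : MR) : lebesgue_plane [set (a, b)] = 0%E.
Proof.
by rewrite set1_pair /lebesgue_plane product_measure1E //= lebesgue_measure_set1 mul0e.
Qed.

End PlaneLebesgue.

(** * Averaging over the spectral parameter *)

Section MeanArea.
Context d (T : measurableType d) (R : realType) (P : probability T R).
Variables (n N : nat) (X : 'I_n -> T -> 'M[R[i]]_N).
Hypotheses (n_gt0 : (0 < n)%N) (N_gt0 : (0 < N)%N) (hX : independent_ginibre P X).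
Variables (A : 'I_n -> 'I_n -> R[i]) (b : 'I_n -> R[i]) (c0 : R[i]).
Variables (Omega : set R[i]) (hO : borelC Omega) (eps : R) (eps0 : 0 < eps).
Local Notation Xw w := (fun i => X i w).
Local Notation MR := (measurableTypeR R).
Local Notation mu2 := (@lebesgue_plane R).
Local Notation area w :=
  (lebesgueC (pseudospectrum eps (quad A b c0 (Xw w)) `&` Omega)).

(** The spectral parameter only shifts the constant coefficient, in which the small ball bound is
    uniform. *)
Lemma quad_sub_scalar (Y : 'I_n -> 'M[R[i]]_N) z :
  quad A b c0 Y - z%:M = quad A b (c0 - z) Y.
Proof. by rewrite /quad -addrA -raddfB. Qed.

Definition pspec : set (T * (MR * MR)) :=
  [set x | sigma_min (quad A b (c0 - toC x.2) (Xw x.1)) <= eps /\ Omega (toC x.2)].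

Lemma measurable_pspec : measurable pspec.
Proof.
rewrite (_ : pspec =
   [set x : T * (MR * MR) | sigma_min (quad A b (c0 - toC x.2) (Xw x.1)) <= eps] `&`
   snd @^-1` (@toC R @^-1` Omega)); last by apply/seteqP; split => x [].
apply: measurableI; last first.
  rewrite -[X in measurable X]setTI; apply: measurable_snd => //.
  exact: borelC_measurable.
apply: measurable_sigma_min_le => // r s.
rewrite (_ : (fun _ => _) = fun x : T * (MR * MR) =>
    quad A b c0 (Xw x.1) r s - (if r == s then toC x.2 else 0)).
  apply: cmeasD.
    apply: (@cmeas_quad _ _ _ n_gt0 N_gt0 A b c0 _ (T * (MR * MR))%type (fun x => Xw x.1)).
    move=> i r' s'; apply: (cmeas_comp (cmeas_tuple_X N_gt0 hX i r' s')).
    exact: measurable_fst.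
  apply: cmeasN; case: (r == s); last exact: cmeas_cst.
  split; rewrite /toC /=.
    apply: (measurableT_comp (f := (fst : MR * MR -> MR))) => //; exact: measurable_snd.
  apply: (measurableT_comp (f := (snd : MR * MR -> MR))) => //; exact: measurable_snd.
apply/funext => x; rewrite -quad_sub_scalar mxE [X in _ + X = _]mxE [X in _ - X = _]mxE.
by case: (r == s); rewrite ?mulr1n ?mulr0n.
Qed.

Lemma area_xsection w : area w = mu2 (xsection pspec w).
Proof.
rewrite /lebesgueC; congr (mu2 _); apply/seteqP; split => q.
  by rewrite /xsection /pseudospectrum /= inE /pspec /= -quad_sub_scalar.
by rewrite /xsection /pseudospectrum /= inE /pspec /= -quad_sub_scalar.
Qed.

Lemma measurable_area : measurable_fun setT (fun w => area w).
Proof.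
rewrite (_ : (fun _ => _) = mu2 \o xsection pspec); last first.
  by apply/funext => w; rewrite area_xsection.
by apply: measurable_fun_xsection; exact: measurable_pspec.
Qed.

Lemma area_le w : (area w <= lebesgueC Omega)%E.
Proof.
rewrite area_xsection /lebesgueC; apply: le_measure; rewrite ?inE.
- by apply: measurable_xsection; exact: measurable_pspec.
- exact: borelC_measurable.
- by move=> q; rewrite /xsection /= inE => -[].
Qed.

Lemma mean_area_le (beta : R) : 0 <= beta ->
  (forall c, c != 0 -> (P [set w | sigma_min (quad A b c (Xw w)) <= eps]%R <= beta%:E)%E) ->
  (\int[P]_w area w <= beta%:E * lebesgueC Omega)%E.
Proof.
move=> beta0 hP; have mS := measurable_pspec; have mO := borelC_measurable hO.
have -> : (\int[P]_w area w = \int[mu2]_q P (ysection pspec q))%E.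
  have := indic_fubini_tonelli P mu2 mS.
  rewrite (indic_fubini_tonelli_FE mu2 mS) (indic_fubini_tonelli_GE P mS) => <-.
  by apply: eq_integral => w _; rewrite area_xsection.
have -> : (beta%:E * lebesgueC Omega = \int[mu2]_(q in @toC R @^-1` Omega) (cst beta%:E q))%E.
  by rewrite integral_cst.
rewrite [leRHS]integral_mkcond.
apply: ae_ge0_le_integral => //.
- exact: measurable_fun_ysection.
- by move=> q _; rewrite /patch; case: ifP => _ //; rewrite lee_fin.
- by apply/(measurable_restrictT _ _).1 => //; exact: measurable_cst.
(* At [c0] the shifted constant coefficient vanishes and [hP] does not apply; a single point is
   Lebesgue null. *)
exists [set (complex.Re c0, complex.Im c0)]; split.
- exact: measurable_plane_set1.
- exact: lebesgue_plane_set1.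
move=> -[x y] /= H; case: (eqVneq c0 (Complex x y)) => [->//|c0xy]; case: H => _.
rewrite /patch; case: ifPn => [|xyO].
  rewrite inE => hq.
  have -> : ysection pspec (x, y) = [set w | sigma_min (quad A b (c0 - Complex x y) (Xw w)) <= eps].
    by apply/seteqP; split => w; rewrite /ysection /pspec /= inE //= => -[].
  by apply: hP; rewrite subr_eq0.
rewrite (_ : ysection _ _ = set0) ?measure0 //.
apply/seteqP; split => w //; rewrite /ysection /pspec /= inE /= => -[_ h].
by move: xyO; rewrite notin_setE.
Qed.

End MeanArea.

(** * From the mean to high probability *)

Section MarkovBound.
Context d (T : measurableType d) (R : realType) (P : probability T R).
Local Open Scope ereal_scope.

Lemma prob_le_of_mean (f : T -> \bar R) (L : \bar R) (a beta : R) :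
  measurable_fun setT f -> (forall w, 0 <= f w <= L) -> 0 <= L < +oo ->
  (0 < a)%R -> (0 <= beta)%R -> \int[P]_w f w <= beta%:E * L ->
  (1 - beta / a)%:E <= P [set w | f w <= a%:E * L].
Proof.
move=> mf fL /andP[L0 Loo] a0 beta0 hint.
have ba0 : (0 <= beta / a)%R by rewrite divr_ge0 // ltW.
have absf w : `|f w| = f w by rewrite gee0_abs //; have /andP[] := fL w.
(* Markov's inequality needs a positive level; for [L = 0] the function [f] vanishes identically. *)
case: (eqVneq L 0) => [L_eq|Ln0].
  rewrite (_ : [set w | _] = setT) ?probability_setT ?lee_fin ?gerBl //.
  apply/seteqP; split => w // _ /=; rewrite L_eq mule0.
  by have /andP[_] := fL w; rewrite L_eq.
have Lfin : L \is a fin_num by rewrite ge0_fin_numE.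
have : 0 < L by rewrite lt0e Ln0.
move: Lfin hint; case: L {fL L0 Loo Ln0} => // r _ hint; rewrite lte_fin => r0.
have ar0 : (0 < a * r)%R by exact: mulr_gt0.
pose B := [set w | (a * r)%:E <= `|f w| ].
have mB : measurable B.
  by rewrite -[B]setTI; apply: emeasurable_fun_c_infty => //; exact: measurableT_comp.
have PB : P B <= (beta / a)%:E.
  have := le_integral_abse P measurableT mf ar0.
  rewrite setTI -/B; under eq_integral do rewrite absf.
  move=> /le_trans /(_ hint).
  have PBE : P B = (fine (P B))%:E by rewrite fineK // fin_num_measure.
  rewrite [X in _ * X <= _]PBE [X in _ -> X <= _]PBE -!EFinM !lee_fin mulrAC ler_pM2r // => h.
  by rewrite ler_pdivlMr // mulrC.
apply: (@le_trans _ _ (P (~` B))).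
  by rewrite probability_setC // EFinB leeB.
apply: le_measure; rewrite ?inE.
- exact: measurableC.
- by rewrite -[X in measurable X]setTI; exact: emeasurable_fun_infty_c.
- by move=> w /= /negP; rewrite -ltNge absf -EFinM => /ltW.
Qed.
End MarkovBound.

Section Exponents.
Variables (R : realType) (K K' : R) (k : nat).

(** The square root halves the exponent. Of 110, the part 10 absorbs N^10 and 100 is the target;
    [K'] absorbs the division by the Markov level, and [k] the constant, since K <= k <= N^k. *)
Lemma sqrt_powR_bound N : (1 < N)%N -> 0 < K -> K <= k%:R ->
  K * N%:R ^+ 10 * Num.sqrt (N%:R `^ (- (2 * (110 + K' + k%:R)))) / N%:R `^ (- K')
    <= N%:R ^- 100 :> R.
Proof.
move=> N1 K0 Kk; have x0 : 0 < N%:R :> R by rewrite ltr0n ltnW.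
set x := N%:R in x0 *; have x_ge0 := ltW x0.
rewrite -powR12_sqrt ?powR_ge0 // -powRrM.
rewrite (_ : - _ * 2^-1 = - 110%:R - K' - k%:R); last by field.
rewrite !powRD ?(gt_eqF x0) ?implybT // !(powRN _ _%:R) !powR_mulrn //.
rewrite (_ : _ / _ = K / x ^+ k * (x ^+ 10 / x ^+ 110)); last first.
  by field; rewrite !expf_eq0 !gt_eqF ?powR_gt0 ?andbF.
rewrite (_ : x ^+ 10 / x ^+ 110 = x ^- 100); last first.
  by rewrite -[110%N]/(10 + 100)%N exprD invfM mulrA divff ?mul1r // expf_neq0 // gt_eqF.
rewrite ler_piMl ?invr_ge0 ?exprn_ge0 // ler_pdivrMr ?exprn_gt0 // mul1r.
apply: (le_trans Kk); rewrite -natrX ler_nat; exact/ltnW/ltn_expl.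
Qed.

End Exponents.

Theorem corollary1p5 (R : realType) :
  exists C0 : R, 0 < C0 /\
  forall (n : nat) (p : ncpoly R[i] n), ncdegree p = 2%N ->
  exists C c : R, [/\ 0 < C, 0 < c,
    (forall (N : nat), (0 < N)%N ->
     forall (d : measure_display) (T : measurableType d) (P : probability T R)
       (X : 'I_n -> T -> 'M[R[i]]_N), independent_ginibre P X ->
     forall (Omega : set R[i]), borelC Omega ->
     forall eps : R, 0 < eps ->
       (\int[P]_w
          lebesgueC (pseudospectrum eps (nceval p (fun k => X k w)) `&` Omega)
        <= (C * (N%:R `^ C0 * eps `^ c + expR (- N%:R)))%:E * lebesgueC Omega)%E)
    & exists N0 : nat,
      forall K : R, 0 < K ->
      exists C' : R, 0 < C' /\
      forall (N : nat), (0 < N)%N -> (N0 <= N)%N ->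
      forall (d : measure_display) (T : measurableType d) (P : probability T R)
        (X : 'I_n -> T -> 'M[R[i]]_N), independent_ginibre P X ->
      forall (Omega : set R[i]), borelC Omega -> (lebesgueC Omega < +oo)%E ->
        ((1 - N%:R ^- 100)%:E <=
         P [set w | lebesgueC (pseudospectrum (N%:R `^ (- C'))
                      (nceval p (fun k => X k w)) `&` Omega)
                    <= (N%:R `^ (- K))%:E * lebesgueC Omega])%E].
Proof.
exists 10%:R; split; first by rewrite ltr0n.
move=> n p p2; have [i0 [j0 A_neq0]] := ncdegree2_neq0 p2.
have n_gt0 : (0 < n)%N := leq_ltn_trans (leq0n i0) (ltn_ord i0).
pose A i j : R[i] := monalg.mcoeff (monalg.FMonom [:: i; j]) p.
pose b i : R[i] := monalg.mcoeff (monalg.FMonom [:: i]) p.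
pose c0 : R[i] := monalg.mcoeff (monalg.FMonom [::]) p.
have [K K0 hK] := @small_ball R n A b i0 j0 A_neq0.
have pE N (X : 'I_n -> 'M[R[i]]_N) : nceval p X = quad A b c0 X := nceval_quad p2 X.
have e3 : 0 < expR 3%:R :> R := expR_gt0 _.
pose beta N eps : R := K * N%:R ^+ 10 * Num.sqrt eps.
have beta0 N eps : 0 <= beta N eps.
  by rewrite mulr_ge0 ?sqrtr_ge0 // mulr_ge0 ?exprn_ge0 // ltW.
have mean N : (2 < N)%N -> forall d (T : measurableType d) (P : probability T R)
    (X : 'I_n -> T -> 'M[R[i]]_N), independent_ginibre P X ->
    forall Omega, borelC Omega -> forall eps, 0 < eps ->
    (\int[P]_w lebesgueC (pseudospectrum eps (nceval p (fun k => X k w)) `&` Omega)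
      <= (beta N eps)%:E * lebesgueC Omega)%E.
  move=> N2 d T P X hX Omega hO eps eps0.
  under eq_integral do rewrite pE.
  have N_gt0 : (0 < N)%N by exact: ltn_trans N2.
  apply: (mean_area_le n_gt0 N_gt0 hX c0 hO eps0 (beta0 N eps)) => c c_neq0.
  exact: hK.
(* [K] serves N > 2. For N <= 2, [expR 3%:R * expR (- N%:R)] is at least 1 and the area of [Omega]
   is a sufficient bound. *)
exists (K + expR 3%:R), 2^-1; split; first exact: addr_gt0.
- by rewrite invr_gt0 ltr0n.
- move=> N N_gt0 d T P X hX Omega hO eps eps0.
  have m0 : (0 <= lebesgueC Omega)%E by exact: measure_ge0.
  have Cge0 : 0 <= K + expR 3%:R by rewrite addr_ge0 // ltW.
  have t0 : 0 <= N%:R `^ 10%:R * eps `^ 2^-1 by rewrite mulr_ge0 ?powR_ge0.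
  case: (ltnP 2 N) => N2.
    apply: (le_trans (mean N N2 d T P X hX Omega hO eps eps0)).
    apply: lee_wpmul2r => //; rewrite lee_fin /beta powR_mulrn // powR12_sqrt; last exact: ltW.
    rewrite -mulrA; apply: ler_pM; first exact: ltW.
    + by rewrite mulr_ge0 ?sqrtr_ge0 ?exprn_ge0.
    + by rewrite lerDl ltW.
    + by rewrite lerDl expR_ge0.
  apply: (@le_trans _ _ (\int[P]_(w in setT) cst (lebesgueC Omega) w)%E).
    apply: ge0_le_integral => //=.
    + by under eq_fun do rewrite pE; exact: (measurable_area n_gt0 N_gt0 hX A b c0 hO eps0).
    + by move=> w _; rewrite pE; exact: (area_le n_gt0 N_gt0 hX A b c0 hO eps0).
  rewrite integral_cst // [X in (_ * X)%E]probability_setT mule1 -[leLHS]mul1e.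
  apply: lee_wpmul2r => //; rewrite lee_fin.
  apply: (@le_trans _ _ (expR 3%:R * expR (- N%:R))).
    by rewrite -expRD -[leLHS]expR0 ler_expR subr_ge0 ler_nat; lia.
  apply: ler_pM; rewrite ?expR_ge0 //; first by rewrite lerDr ltW.
  by rewrite lerDr.
(* 3 is the least N with N + 2 < 2 N, and [k] is an integer above the small ball constant [K]. *)
exists 3%N => K' K'0; pose k := (Num.truncn K).+1.
exists (2 * (110 + K' + k%:R)); split.
  by rewrite mulr_gt0 // !addr_gt0.
move=> N N_gt0 N2 d T P X hX Omega hO Ooo.
have x0 : 0 < N%:R :> R by rewrite ltr0n.
set eps := _ `^ (- (2 * _)); have eps0 : 0 < eps by exact: powR_gt0.
apply: le_trans (@prob_le_of_mean _ _ _ P _ _ (N%:R `^ (- K')) (beta N eps) _ _ _ _ _ (mean N N2 d T P X hX Omega hO eps eps0)).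
- rewrite lee_fin lerB //; apply: sqrt_powR_bound => //; first exact: ltnW.
  exact/ltW/truncnS_gt.
- under eq_fun do rewrite pE; exact: (measurable_area n_gt0 N_gt0 hX A b c0 hO eps0).
- move=> w; rewrite measure_ge0 /= pE; exact: (area_le n_gt0 N_gt0 hX A b c0 hO eps0).
- by rewrite measure_ge0.
- exact: powR_gt0.
- exact: beta0.
Qed.
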